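(* Let $n,k,j$ be integers with $0\leq j\leq n-k-1\leq n-1$ and let $K$ be a centrally symmetric convex body in $\mathbb{R}^n$. Then $$c_{n,k,j}|K|^{n-k}W_{k+j}(K)\leq\int_{K}\cdots\int_{K}W^{(n-k)}_j(\mathrm{conv}\{0,x_1,\ldots ,x_{n-k}\})\,dx_{n-k}\cdots dx_1\leq\delta_{n,k,j}|K|^{n-k}W_{k+j}(K),$$ where $$c_{n,k,j}=\frac{\omega_j}{\omega_{k+j}\,\omega_{n-k-j}}\frac{1}{\binom{n-k}{j}}\,\mathcal{F}_{C,1}(\mathbf{1}_{B^{n-k-j}_2};n-k)\quad\text{with } C=\mathrm{conv}\{0,e_1,\ldots ,e_{n-k}\}\subset\mathbb{R}^{n-k},$$ and $$\delta_{n,k,j}=\frac{\omega_j}{\omega_{k+j}}\frac{\binom{n}{k+j}}{\binom{n-k}{j}}.$$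
   Context: A convex body in $\mathbb{R}^n$ is a compact convex set with non-empty interior; it is centrally symmetric if $x\in K$ implies $-x\in K$. $|\cdot|$ denotes volume in the appropriate dimension, $B_2^m$ is the Euclidean unit ball of $\mathbb{R}^m$ and $\omega_m=|B_2^m|$ ($\omega_0=1$); $e_1,e_2,\ldots$ is the standard basis. Quermassintegrals: for a non-empty compact convex set $L$ contained in an $m$-dimensional linear subspace $E$ of $\mathbb{R}^n$, $W_i^{(m)}(L)$, $0\leq i\leq m$, is the $i$-th quermassintegral of $L$ in dimension $m$, defined by Steiner's formula in $E$: $|L+\lambda B_E|=\sum_{i=0}^m\binom{m}{i}W_i^{(m)}(L)\lambda^i$ for $\lambda\geq 0$, where $B_E$ is the Euclidean unit ball of $E$ and volume is $m$-dimensional (equivalently, $W_i^{(m)}(L)$ is the mixed volume in $E$ of $m-i$ copies of $L$ and $i$ copies of $B_E$; it does not depend on the choice of $E$). For the convex body $K$ in $\mathbb{R}^n$, $W_{i}(K)=W_{i}^{(n)}(K)$. The set $\mathrm{conv}\{0,x_1,\ldots,x_{n-k}\}$ lies in an $(n-k)$-dimensional subspace, where $W_j^{(n-k)}$ is computed. For a compact convex set $C\subset\mathbb{R}^q$ and $x_1,\ldots,x_q\in\mathbb{R}^d$ put $[x_1,\ldots,x_q]C=\{\sum_{i=1}^q c_ix_i:(c_1,\ldots,c_q)\in C\}\subset\mathbb{R}^d$, and $$\mathcal{F}_{C,1}(\mathbf{1}_{B_2^d};q)=\frac{1}{\omega_d^{q}}\int_{B_2^d}\cdots\int_{B_2^d}\big|[x_1,\ldots,x_q]C\big|\,dx_1\cdots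 dx_q,$$ where $|\cdot|$ is $d$-dimensional volume. *)

(* Defs.v *)
From HB Require Import structures.
From mathcomp Require Import all_boot all_order all_algebra.
From mathcomp Require Import all_classical all_reals all_analysis.

Set Implicit Arguments.
Unset Strict Implicit.
Unset Printing Implicit Defensive.

Import Order.TTheory GRing.Theory Num.Theory.
Import numFieldNormedType.Exports.

Local Open Scope classical_set_scope.
Local Open Scope ring_scope.

(* R^n is 'rV[R]_n.  Its library topology comes from the sup norm, hence is the
   usual one; the Euclidean norm is [enorm] below.  The sigma-algebra is
   generated by the coordinates, i.e. it is the Borel sigma-algebra. *)

Definition rV_display : measure_display.
Proof. exact: default_measure_display. Qed.

Definition rV_coord (R : realType) n (i : 'I_n) (v : 'rV[R]_n) :
  measurableTypeR R := v ord0 i.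

Section measurable_rV.
Variables (R : realType) (n : nat).

Let rV_set0 : g_sigma_preimage (@rV_coord R n) set0.
Proof. exact: sigma_algebra0. Qed.

Let rV_setC A : g_sigma_preimage (@rV_coord R n) A ->
  g_sigma_preimage (@rV_coord R n) (~` A).
Proof. exact: sigma_algebraC. Qed.

Let rV_bigcup (F : _^nat) : (forall i, g_sigma_preimage (@rV_coord R n) (F i)) ->
  g_sigma_preimage (@rV_coord R n) (\bigcup_i (F i)).
Proof. exact: sigma_algebra_bigcup. Qed.

HB.instance Definition _ := @isMeasurable.Build rV_display 'rV[R]_n
  (g_sigma_preimage (@rV_coord R n)) rV_set0 rV_setC rV_bigcup.

End measurable_rV.

Lemma measurable_rV_coord (R : realType) n (i : 'I_n) :
  measurable_fun [set: 'rV[R]_n] (rV_coord i).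
Proof.
move=> _ Y mY; rewrite setTI; apply: sub_sigma_algebra => /=.
rewrite -bigcup_seq/=; exists i => /=; first by rewrite mem_index_enum.
by exists Y => //; rewrite setTI.
Qed.

Lemma measurable_fun_rV (R : realType) d (T : measurableType d) n
    (f : T -> 'rV[R]_n) :
  (forall i, measurable_fun [set: T] (rV_coord i \o f)) ->
  measurable_fun [set: T] f.
Proof.
move=> mf.
have S : g_sigma_preimage (fun i => rV_coord i \o f) `<=` measurable.
  apply: smallest_sub; first exact: sigma_algebra_measurable.
  case: n => [|n] in f mf *; first by rewrite big_ord0.
  rewrite -bigcup_mkord_ord; apply: bigcup_sub => i Ii.
  by move=> A [B mB <-]; exact: mf.
rewrite g_sigma_preimage_comp in S.
by move=> _ A mA; apply: S; exists A.
Qed.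

Definition rV_cons (R : realType) n (p : measurableTypeR R * 'rV[R]_n) :
  'rV[R]_n.+1 := row_mx (p.1 : R)%:M p.2.

Definition rV_uncons (R : realType) n (v : 'rV[R]_n.+1) :
    measurableTypeR R * 'rV[R]_n :=
  (v ord0 ord0, rsubmx (v : 'rV[R]_(1 + n))).

Lemma measurable_rV_cons (R : realType) n :
  measurable_fun setT (@rV_cons R n).
Proof.
apply: measurable_fun_rV => i.
have [j ->|j ->] := split_ordP (i : 'I_(1 + n)).
- rewrite (_ : _ \o _ = fst)//; apply/funext => -[x v] /=.
  rewrite /rV_coord /rV_cons; etransitivity; first exact: row_mxEl.
  by rewrite !ord1 mxE eqxx mulr1n.
- rewrite (_ : _ \o _ = rV_coord j \o snd); last first.
    by apply/funext => -[x v]; exact: row_mxEr.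
  apply: measurableT_comp => //; exact: measurable_rV_coord.
Qed.

Lemma measurable_rV_uncons (R : realType) n :
  measurable_fun setT (@rV_uncons R n).
Proof.
apply: measurable_fun_pair; first exact: measurable_rV_coord.
apply: measurable_fun_rV => i.
rewrite (_ : _ \o _ = rV_coord (rshift 1 i)); first exact: measurable_rV_coord.
by apply/funext => v; rewrite /rV_coord /= mxE.
Qed.

Lemma rV_consK (R : realType) n : cancel (@rV_cons R n) (@rV_uncons R n).
Proof.
move=> [x v]; rewrite /rV_uncons /rV_cons row_mxKr; congr pair.
have -> : ord0 = lshift n (ord0 : 'I_1) :> 'I_(1 + n) by exact: val_inj.
etransitivity; first exact: row_mxEl.
by rewrite mxE eqxx mulr1n.
Qed.

Section rV_cons_measure.
Local Open Scope ereal_scope.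
Variables (R : realType) (n : nat).
Variable mu : {sigma_finite_measure set 'rV[R]_n -> \bar R}.

Definition rV_cons_measure : set 'rV[R]_n.+1 -> \bar R :=
  pushforward ((@lebesgue_measure R) \x mu) (@rV_cons R n).

Let rV_cons_measure0 : rV_cons_measure set0 = 0.
Proof. by rewrite /rV_cons_measure /pushforward preimage_set0 measure0. Qed.

Let measurable_preimage A : measurable A -> measurable (@rV_cons R n @^-1` A).
Proof.
by move=> mA; rewrite -[X in measurable X]setTI; exact: measurable_rV_cons.
Qed.

Let rV_cons_measure_ge0 A : 0 <= rV_cons_measure A.
Proof. by rewrite /rV_cons_measure /pushforward measure_ge0. Qed.

Let rV_cons_measure_sigma_additive : semi_sigma_additive rV_cons_measure.
Proof.
move=> F mF tF mUF; rewrite /rV_cons_measure /pushforward preimage_bigcup.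
apply: measure_semi_sigma_additive.
- by move=> k; exact: measurable_preimage.
- apply/trivIsetP => /= i j _ _ ij; rewrite -preimage_setI.
  by move/trivIsetP : tF => /(_ _ _ _ _ ij) ->//; rewrite preimage_set0.
- by rewrite -preimage_bigcup; exact: measurable_preimage.
Qed.

HB.instance Definition _ := isMeasure.Build _ _ _ rV_cons_measure
  rV_cons_measure0 rV_cons_measure_ge0 rV_cons_measure_sigma_additive.

Let sigma_finite_rV_cons : sigma_finite setT rV_cons_measure.
Proof.
have /sigma_finiteP[F [TF ndF Foo]] := sigma_finiteT (@lebesgue_measure R).
have /sigma_finiteP[G [TG ndG Goo]] := sigma_finiteT mu.
exists (fun k => @rV_uncons R n @^-1` (F k `*` G k)).
  rewrite -preimage_bigcup (_ : \bigcup_k _ = setT) ?preimage_setT//.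
  rewrite -setXTT TF TG predeqE => -[x y]; split.
    by move=> [k _ []/= ? ?]; split; exists k.
  move=> [/= [k _ Fkx] [l _ Gly]]; exists (maxn k l) => //; split.
  - by move: x Fkx; exact/subsetPset/ndF/leq_maxl.
  - by move: y Gly; exact/subsetPset/ndG/leq_maxr.
move=> k; have [mF Fk] := Foo k; have [mG Gk] := Goo k; split.
  rewrite -[X in measurable X]setTI; apply: measurable_rV_uncons => //.
  exact: measurableX.
rewrite /rV_cons_measure /pushforward -comp_preimage.
rewrite (_ : _ \o _ = id) ?preimage_id; last first.
  by apply/funext => p /=; rewrite rV_consK.
by rewrite product_measure1E// lte_mul_pinfty// ge0_fin_numE.
Qed.

HB.instance Definition _ := Measure_isSigmaFinite.Build _ _ _ rV_cons_measure
  sigma_finite_rV_cons.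

End rV_cons_measure.

(* Lebesgue measure on R^n as an n-fold product; on R^0 it is the unit mass. *)
Fixpoint lebesgue_rV (R : realType) n :
    {sigma_finite_measure set 'rV[R]_n -> \bar R} :=
  match n with
  | 0 => \d_(0 : 'rV[R]_0)
  | n'.+1 => rV_cons_measure (lebesgue_rV R n')
  end.

(* [iter_integral D F] is \int_D ... \int_D F(x_1, ..., x_q) dx_q ... dx_1,
   the points x_1, ..., x_q being the rows of the argument of F. *)
Fixpoint iter_integral (R : realType) n q (D : set 'rV[R]_n) :
    ('M[R]_(q, n) -> \bar R) -> \bar R :=
  match q with
  | 0 => fun F => F 0
  | q'.+1 => fun F => (\int[lebesgue_rV R n]_(x in D)
      iter_integral D (fun X : 'M[R]_(q', n) => F (col_mx x X)))%E
  end.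

Definition volume (R : realType) n (A : set 'rV[R]_n) : R :=
  fine (lebesgue_rV R n A).

Definition enorm (R : realType) n (x : 'rV[R]_n) : R :=
  Num.sqrt (\sum_(i < n) x ord0 i ^+ 2).

Definition eball (R : realType) n : set 'rV[R]_n := [set x | enorm x <= 1].

Definition omega (R : realType) n : R := volume (@eball R n).

Definition is_convex (R : realType) n (A : set 'rV[R]_n) : Prop :=
  convex_set (A : set (convex_lmodType 'rV[R]_n)).

Definition convex_hull (R : realType) n (A : set 'rV[R]_n) : set 'rV[R]_n :=
  smallest (@is_convex R n) A.

Definition convex_body (R : realType) n (K : set 'rV[R]_n) : Prop :=
  [/\ compact K, is_convex K & K° !=set0].

Definition centrally_symmetric (R : realType) n (K : set 'rV[R]_n) : Prop :=
  forall x, K x -> K (- x).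

Definition minkowski_sum (R : realType) n (A B : set 'rV[R]_n) :
  set 'rV[R]_n := [set a + b | a in A & b in B].

Definition dilate (R : realType) n (l : R) (A : set 'rV[R]_n) :
  set 'rV[R]_n := [set l *: a | a in A].

(* An m-dimensional subspace E of R^n is given by an orthonormal basis, the rows
   of U.  The map y |-> y *m U is then an isometry from R^m onto E, through which
   m-dimensional volume in E is defined. *)
Definition orthonormal_rows (R : realType) m n (U : 'M[R]_(m, n)) : Prop :=
  U *m U^T = 1%:M.

Definition row_space (R : realType) m n (U : 'M[R]_(m, n)) : set 'rV[R]_n :=
  [set x | (x <= U)%MS].

Definition subspace_measure (R : realType) m n (U : 'M[R]_(m, n))
    (A : set 'rV[R]_n) : \bar R :=
  lebesgue_rV R m [set y | A (y *m U)].

(* Steiner's formula |L + l B_E| = \sum_i 'C(m, i) W_i l^i, E = row_space U. *)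
Definition steiner_formula (R : realType) m n (U : 'M[R]_(m, n))
    (L : set 'rV[R]_n) (W : nat -> R) : Prop :=
  forall l : R, 0 <= l ->
    subspace_measure U
      (minkowski_sum L (dilate l (row_space U `&` @eball R n)))
    = (\sum_(i < m.+1) 'C(m, i)%:R * W i * l ^+ i)%:E.

(* W_i^{(m)}(L) for 0 <= i <= m and L compact convex, contained in some
   m-dimensional subspace E: the unique w such that w = W_i for coefficients W
   satisfying Steiner's formula in E.  (The value for other arguments is
   irrelevant.) *)
Definition quermassintegral (R : realType) m n (L : set 'rV[R]_n) (i : nat) : R :=
  xget 0 [set w : R | exists (U : 'M[R]_(m, n)) (W : nat -> R),
    [/\ orthonormal_rows U, L `<=` row_space U,
        steiner_formula U L W & w = W i]].

Arguments quermassintegral {R} m {n} L i.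

Definition bracket (R : realType) q d (X : 'M[R]_(q, d)) (C : set 'rV[R]_q) :
  set 'rV[R]_d := [set \sum_(i < q) c ord0 i *: row i X | c in C].

(* F_{C,1}(1_{B_2^d}; q) *)
Definition calF (R : realType) q (C : set 'rV[R]_q) (d : nat) : \bar R :=
  ((omega R d ^+ q)^-1%:E * iter_integral (@eball R d)
     (fun X : 'M[R]_(q, d) => lebesgue_rV R d (bracket X C)))%E.

(* conv{0, e_1, ..., e_q} *)
Definition std_simplex (R : realType) q : set 'rV[R]_q :=
  convex_hull ([set 0] `|` range (fun i : 'I_q => delta_mx ord0 i)).

(* conv{0, x_1, ..., x_q} for x_1, ..., x_q the rows of X *)
Definition hull0 (R : realType) q n (X : 'M[R]_(q, n)) : set 'rV[R]_n :=
  convex_hull ([set 0] `|` range (fun i : 'I_q => row i X)).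

Definition c_const (R : realType) (n k j : nat) : \bar R :=
  ((omega R j / (omega R (k + j) * omega R (n - k - j)) *
      ('C(n - k, j)%:R)^-1)%:E
   * calF (@std_simplex R (n - k)) (n - k - j))%E.

Definition delta_const (R : realType) (n k j : nat) : R :=
  omega R j / omega R (k + j) * ('C(n, k + j)%:R / 'C(n - k, j)%:R).

(* Main.v *)
(* Put q = n - k and m = n - k - j.  Approximating the ball by zonotopes turns
   Steiner's formula into a statement about adding segments, and adding a
   segment changes the volume by the volume of a linear image.  Hence W_{k+j}
   is approximated, for all convex L at once, by a nonnegative combination of
   the functionals L |-> |L G| over finitely many n x m matrices G.  Since the
   quermassintegrals of L in dimension q and in dimension n are proportional,
   W_j^{(q)}(conv{0, x_i}) is a multiple of W_{k+j}^{(n)}(conv{0, x_i}), and the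
   upper bound is monotonicity in L.

   For the lower bound it suffices to treat each G, say of full rank.  The
   integral of |conv{0, x_i G}| over K^q is the integral of |conv{0, y_i}|
   against f(y_1) ... f(y_q), f being the density of the projection of K.  The
   Rogers-Shephard inequality bounds sup f by C(n, m) |K| / |K G|, and among
   all densities with given mass and supremum the integral is smallest for a
   multiple of the indicator of a centred ball.  This rearrangement statement
   rests on convexity of |conv{0, y_i}| in a simultaneous translation of the
   y_i along parallel lines, and on its evenness: replacing f on every line by
   the indicator of a centred interval does not increase the integral, and a
   suitable sequence of rotations and symmetrizations converges to the ball. *)

From mathcomp Require Import all_boot all_order all_algebra.
From mathcomp Require Import all_classical all_reals all_analysis.
From mathcomp Require Import measurable_realfun ring lra.
Require Import Defs.

Import Order.TTheory GRing.Theory Num.Theory.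
Import numFieldNormedType.Exports.

Local Open Scope classical_set_scope.
Local Open Scope ring_scope.

Set Implicit Arguments.
Unset Strict Implicit.
Unset Printing Implicit Defensive.

(** The error in approximating W_{k+j}(L) is h times a quantity monotone in L, hence uniform over
    all hulls inside K.

    The delicate step is the passage from a density f <= 1 on a line to the indicator of a centred
    interval. The quantile map of f pushes Lebesgue measure on that interval forward to f, and f <=
    1 makes it expand distances. Averaging it with its conjugate under the reflection of the line
    gives an odd map S, and by convexity and evenness this averaging does not increase the integral.
    An odd expanding map satisfies |s| <= |S s|, so s lies between S s and - S s, and undoing S does
    not increase the integral either.

    Convergence to the ball is measured by the mass missing from the ball. One well chosen
    symmetrization lowers a deficit d by at least d^2 / C, so the infimum of the deficits that can
    be reached is 0.

    The binomial coefficient lost to Rogers-Shephard is regained at the end, because the coefficient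
    of Steiner's polynomial is C(n, k+j) W_{k+j}; in the upper bound nothing is lost, and the same
    coefficient stays in delta. *)

Local Notation mu n := (lebesgue_rV _ n).
Local Notation leb := (@lebesgue_measure _).

(** * Measurable maps into R^n and integration one coordinate at a time *)

Section measurable_rV_maps.
Variable R : realType.

Lemma measurable_rV_coordP d (T : measurableType d) n (f : T -> 'rV[R]_n) :
  measurable_fun setT f <->
  forall i, measurable_fun setT (fun t => f t ord0 i : measurableTypeR R).
Proof.
split=> [mf i|mf]; last exact: measurable_fun_rV.
exact: (measurableT_comp (measurable_rV_coord i) mf).
Qed.

Lemma measurable_mulmx d (T : measurableType d) n m (f : T -> 'rV[R]_n)
    (G : 'M[R]_(n, m)) :
  measurable_fun setT f -> measurable_fun setT (fun t => f t *m G).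
Proof.
move=> /measurable_rV_coordP mf; apply/measurable_rV_coordP => i.
under eq_fun do rewrite mxE.
apply: measurable_sum => j.
apply: measurable_funM => //; exact: mf.
Qed.

Lemma measurable_row_mx d (T : measurableType d) n m (f : T -> 'rV[R]_n)
    (g : T -> 'rV[R]_m) :
  measurable_fun setT f -> measurable_fun setT g ->
  measurable_fun setT (fun t => row_mx (f t) (g t)).
Proof.
move=> /measurable_rV_coordP mf /measurable_rV_coordP mg.
apply/measurable_rV_coordP => i.
case: (split_ordP i) => j ->.
  by under eq_fun do rewrite row_mxEl; exact: mf.
by under eq_fun do rewrite row_mxEr; exact: mg.
Qed.

Lemma measurable_addmx d (T : measurableType d) n (f g : T -> 'rV[R]_n) :
  measurable_fun setT f -> measurable_fun setT g ->
  measurable_fun setT (fun t => f t + g t).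
Proof.
move=> /measurable_rV_coordP mf /measurable_rV_coordP mg.
apply/measurable_rV_coordP => i.
under eq_fun do rewrite mxE.
by apply: measurable_funD => //; [exact: mf|exact: mg].
Qed.

Lemma measurable_scalemx d (T : measurableType d) n (a : T -> measurableTypeR R)
    (f : T -> 'rV[R]_n) :
  measurable_fun setT a -> measurable_fun setT f ->
  measurable_fun setT (fun t => (a t : R) *: f t).
Proof.
move=> ma /measurable_rV_coordP mf.
apply/measurable_rV_coordP => i.
under eq_fun do rewrite mxE.
by apply: measurable_funM => //; exact: mf.
Qed.

Lemma rV_cons0 n (p : measurableTypeR R * 'rV[R]_n) : rV_cons p ord0 ord0 = p.1.
Proof.
rewrite /rV_cons (_ : ord0 = lshift n (ord0 : 'I_1)); last exact: val_inj.
by etransitivity; [exact: row_mxEl|rewrite mxE eqxx].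
Qed.

Lemma rV_consS n (p : measurableTypeR R * 'rV[R]_n) i :
  rV_cons p ord0 (lift ord0 i) = p.2 ord0 i.
Proof.
rewrite /rV_cons (_ : lift ord0 i = rshift 1 i); last exact: val_inj.
exact: row_mxEr.
Qed.

Lemma rV_consP n (v w : 'rV[R]_n.+1) :
  v ord0 ord0 = w ord0 ord0 ->
  (forall i, v ord0 (lift ord0 i) = w ord0 (lift ord0 i)) -> v = w.
Proof.
move=> v0 vS; apply/rowP => i.
by case: (unliftP ord0 i) => [j ->|->].
Qed.

Lemma rV_unconsK n : cancel (@rV_uncons R n) (@rV_cons R n).
Proof.
move=> w; apply: rV_consP => [|i]; rewrite (rV_cons0, rV_consS)//= mxE.
by congr (w _ _); exact: val_inj.
Qed.

Lemma rV_consD n (s t : R) (v w : 'rV[R]_n) :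
  rV_cons (s, v) + rV_cons (t, w) = rV_cons (s + t, v + w).
Proof. by apply: rV_consP => [|i]; rewrite mxE !(rV_cons0, rV_consS)//= mxE. Qed.

Lemma rV_consZ n (a s : R) (v : 'rV[R]_n) :
  a *: rV_cons (s, v) = rV_cons (a * s, a *: v).
Proof. by apply: rV_consP => [|i]; rewrite mxE !(rV_cons0, rV_consS)//= mxE. Qed.

End measurable_rV_maps.

Section integral_rV.
Local Open Scope ereal_scope.
Variable R : realType.

Lemma integral_rV0 (F : 'rV[R]_0 -> \bar R) : measurable_fun setT F ->
  \int[mu 0]_x F x = F 0%R.
Proof.
by move=> mF; rewrite (@integral_dirac _ _ _ _ setT)//= diracT mul1e.
Qed.

Lemma integral_rV_cons n (F : 'rV[R]_n.+1 -> \bar R) :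
  measurable_fun setT F -> (forall x, 0 <= F x) ->
  \int[mu n.+1]_x F x = \int[leb]_t \int[mu n]_v F (rV_cons (t, v)).
Proof.
move=> mF F0.
rewrite -(@fubini_tonelli1 _ _ _ _ R leb (mu n) (F \o @rV_cons R n))//=; last first.
  exact: measurableT_comp mF (@measurable_rV_cons R n).
rewrite -[in RHS](@preimage_setT _ _ (@rV_cons R n)).
rewrite -(ge0_integral_pushforward (@measurable_rV_cons R n))//=.
Qed.

Lemma measurable_indicE d (T : measurableType d) (A : set T) : measurable A ->
  measurable_fun setT (fun x => (\1_A x)%:E : \bar R).
Proof. by move=> mA; apply/measurable_EFinP; exact: measurable_indic. Qed.

Lemma measure_rV_cons n (A : set 'rV[R]_n.+1) : measurable A ->
  mu n.+1 A = \int[leb]_t mu n [set v | A (rV_cons (t, v))].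
Proof.
move=> mA; transitivity (\int[mu n.+1]_x (\1_A x)%:E).
  by rewrite integral_indic// setIT.
rewrite integral_rV_cons//; first apply: eq_integral => t _.
  transitivity (\int[mu n]_v (\1_[set v | A (rV_cons (t, v))] v)%:E).
    by apply: eq_integral => v _; rewrite !indicE.
  rewrite integral_indic ?setIT//.
  have := @measurable_rV_cons R n; move=> /(_ measurableT) /(_ A mA).
  rewrite setTI => /(measurable_xsection t).
  by congr measurable; apply/seteqP; split => v; rewrite /xsection /= inE.
exact: measurable_indicE.
Qed.

End integral_rV.

Definition pushforward_measure d d' (T1 : measurableType d) (T2 : measurableType d')
    (R : realType) (m : {measure set T1 -> \bar R}) (f : T1 -> T2)
    (mf : measurable_fun setT f) : {measure set T2 -> \bar R} :=
  measure_function_pushforward__canonical__measure_function_Measure m mf.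

(** * Linear changes of variables *)

Section linear_change_of_variables.
Local Open Scope ereal_scope.
Variable R : realType.

(** For positive slope both sides are measures that agree on half-open intervals, which determine
    Lebesgue measure; negative slope follows by invariance under negation. Every change of variables
    below rests on this case. *)
Lemma lebesgue_measure_affine (a b : R) (A : set (measurableTypeR R)) :
  a != 0%R -> measurable A ->
  leb A = `|a|%:E * leb ((fun t => a * t + b)%R @^-1` A).
Proof.
move=> a0 mA.
have mphi (c d : R) : measurable_fun setT
    ((fun t : R => c * t + d)%R : measurableTypeR R -> measurableTypeR R).
  apply: measurable_funD => //; exact: mulrl_measurable.
have pos (c d : R) (B : set (measurableTypeR R)) : (0 < c)%R -> measurable B ->
    leb B = c%:E * leb ((fun t => c * t + d)%R @^-1` B).
  move=> c0 mB.
  pose m := mscale (NngNum (ltW c0)) (pushforward_measure leb (mphi c d)).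
  pose m' : {measure set (measurableTypeR R) -> \bar R} := m.
  rewrite (@lebesgue_measure_unique R m')// => _ [[x y]] /= _ <-.
  rewrite /m /mscale /= /pushforward.
  rewrite (_ : _ @^-1` _ = `](c^-1 * (x - d)), (c^-1 * (y - d))]%classic)%R.
    rewrite !lebesgue_measure_itv /= !lte_fin ltr_pM2l ?invr_gt0// ltrD2r.
    case: ifPn => _; last by rewrite mule0.
    rewrite -!EFinD -EFinM; congr EFin; field; exact: lt0r_neq0.
  apply/seteqP; split => t /=; rewrite !in_itv /= ltr_pdivrMl// ler_pdivlMl//;
    by rewrite ltrBlDr lerBrDr.
have [a1|a1] := ltP 0%R a.
  by rewrite gtr0_norm//; exact: pos.
have {}a1 : (0 < - a)%R by rewrite oppr_gt0 lt_neqAle a0.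
rewrite -normrN gtr0_norm// (pos _ b _ a1 mA); congr (_ * _).
rewrite -lebesgue_measureN /pushforward; last first.
  by rewrite -[X in measurable X]setTI; exact: mphi.
by congr (leb _); apply/seteqP; split => t /=; rewrite mulrNN.
Qed.

Lemma integral_affine (a b : R) (F : measurableTypeR R -> \bar R) :
  a != 0%R -> measurable_fun setT F -> (forall x, 0 <= F x) ->
  \int[leb]_t F t = `|a|%:E * \int[leb]_t F (a * t + b)%R.
Proof.
move=> a0 mF F0.
have mphi : measurable_fun setT
    ((fun t : R => a * t + b)%R : measurableTypeR R -> measurableTypeR R).
  apply: measurable_funD => //; exact: mulrl_measurable.
pose m := mscale (NngNum (normr_ge0 a)) (pushforward_measure leb mphi).
rewrite (@eq_measure_integral _ _ _ _ m); last first.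
  by move=> A mA _; exact: (lebesgue_measure_affine b a0 mA).
rewrite ge0_integral_mscale//; congr (_ * _).
rewrite ge0_integral_pushforward//.
Qed.

Lemma integral_rV_translate n (w : 'rV[R]_n) (F : 'rV[R]_n -> \bar R) :
  measurable_fun setT F -> (forall x, 0 <= F x) ->
  \int[mu n]_x F (x + w)%R = \int[mu n]_x F x.
Proof.
elim: n w F => [|n IH] w F mF F0.
  by apply: eq_integral => x _; congr F; apply/rowP; case.
have wE := esym (rV_unconsK w).
have mt : measurable_fun setT (fun x : 'rV[R]_n.+1 => F (x + w)%R).
  by apply: measurableT_comp mF _; apply: measurable_addmx.
rewrite (integral_rV_cons mt (fun x => F0 _)) (integral_rV_cons mF F0).
have addE t v : (rV_cons (t, v) + w)%R =
    rV_cons ((t + w ord0 ord0)%R, (v + rsubmx (w : 'rV_(1 + n)))%R).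
  by rewrite {1}wE rV_consD.
under eq_integral do under eq_integral do rewrite addE.
have mc : measurable_fun setT (F \o @rV_cons R n).
  exact: measurableT_comp mF (@measurable_rV_cons R n).
under eq_integral => t _.
  rewrite (IH _ (fun v => F (rV_cons ((t + w ord0 ord0)%R, v))))//; last first.
    exact: measurableT_comp mc (pair1_measurable _).
  over.
pose G t := \int[mu n]_v F (rV_cons (t, v)).
rewrite [RHS](@integral_affine 1%R (w ord0 ord0) G)//.
- by rewrite normr1 mul1e; apply: eq_integral => t _; rewrite /G mul1r.
- exact: (measurable_fun_fubini_tonelli_F (m2 := mu n) _ mc (fun x => F0 _)).
- by move=> t; apply: integral_ge0.
Qed.

End linear_change_of_variables.

#[local] Opaque lebesgue_rV lebesgue_measure.

Section tonelli.
Local Open Scope ereal_scope.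
Context d1 d2 (T1 : measurableType d1) (T2 : measurableType d2) (R : realType).
Variables (m1 : {sigma_finite_measure set T1 -> \bar R})
  (m2 : {sigma_finite_measure set T2 -> \bar R}).
Variable F : T1 -> T2 -> \bar R.
Hypothesis mF : measurable_fun setT (fun p : T1 * T2 => F p.1 p.2).
Hypothesis F0 : forall x y, 0 <= F x y.

Lemma measurable_integral1 : measurable_fun setT (fun x => \int[m2]_y F x y).
Proof.
exact: (measurable_fun_fubini_tonelli_F (m2 := m2) _ mF (fun p => F0 p.1 p.2)).
Qed.

Lemma measurable_integral2 : measurable_fun setT (fun y => \int[m1]_x F x y).
Proof.
exact: (measurable_fun_fubini_tonelli_G (m1 := m1) _ mF (fun p => F0 p.1 p.2)).
Qed.

Lemma tonelli_swap :
  \int[m1]_x \int[m2]_y F x y = \int[m2]_y \int[m1]_x F x y.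
Proof.
exact: (fubini_tonelli (m1 := m1) (m2 := m2) _ mF (fun p => F0 p.1 p.2)).
Qed.

End tonelli.

Section linear.
Local Open Scope ereal_scope.
Variable R : realType.

(** Quantifying over all F makes the property stable under products, one factor being absorbed into
    F. It then suffices to treat block-triangular matrices. *)
Definition det_scaling n (T : 'M[R]_n) := forall F : 'rV[R]_n -> \bar R,
  measurable_fun setT F -> (forall x, 0 <= F x) ->
  \int[mu n]_x F x = `|\det T|%:E * \int[mu n]_x F (x *m T)%R.

Lemma det_scaling_mul n (A B : 'M[R]_n) :
  det_scaling A -> det_scaling B -> det_scaling (A *m B)%R.
Proof.
move=> hA hB F mF F0; rewrite (hB F mF F0) (hA (fun x => F (x *m B)%R))//.
  rewrite muleA -EFinM -normrM det_mulmx mulrC; congr (_ * _).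
  by apply: eq_integral => x _; rewrite mulmxA.
by apply: measurableT_comp mF _; exact: measurable_mulmx.
Qed.

Lemma rV_cons_mul_lblock n (p : measurableTypeR R * 'rV[R]_n)
    (a : 'M[R]_1) (c : 'cV[R]_n) (D : 'M[R]_n) :
  (rV_cons p *m (block_mx a 0 c D : 'M[R]_(1 + n)))%R =
  rV_cons ((a ord0 ord0 * p.1 + (p.2 *m c) ord0 ord0)%R, (p.2 *m D)%R).
Proof.
rewrite /rV_cons; etransitivity; first exact: (@mul_row_block _ 1 1 n 1 n).
congr row_mx; last by rewrite mulmx0 add0r.
apply/rowP => i; rewrite !ord1 [LHS]mxE [RHS]mxE eqxx mulr1n /=; congr (_ + _)%R.
by rewrite mul_scalar_mx mxE mulrC.
Qed.

Lemma rV_cons_mul_ublock n (p : measurableTypeR R * 'rV[R]_n)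
    (a : 'M[R]_1) (b : 'rV[R]_n) (D : 'M[R]_n) :
  (rV_cons p *m (block_mx a b 0 D : 'M[R]_(1 + n)))%R =
  rV_cons ((a ord0 ord0 * p.1)%R, (p.2 *m D + p.1 *: b)%R).
Proof.
rewrite /rV_cons; etransitivity; first exact: (@mul_row_block _ 1 1 n 1 n).
congr row_mx; last by rewrite addrC mul_scalar_mx.
apply/rowP => i; rewrite !ord1 [RHS]mxE eqxx mulr1n /=.
by rewrite mulmx0 addr0 mul_scalar_mx mxE mulrC.
Qed.

Lemma measurable_rV_cons_fun d (T : measurableType d) n
    (f : T -> measurableTypeR R) (g : T -> 'rV[R]_n) :
  measurable_fun setT f -> measurable_fun setT g ->
  measurable_fun setT (fun t => rV_cons (f t, g t)).
Proof.
move=> mf mg; apply: (measurableT_comp (@measurable_rV_cons R n)).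
exact: measurable_fun_pair.
Qed.

Lemma measurable_rV_coord_fun d (T : measurableType d) n i
    (g : T -> 'rV[R]_n) : measurable_fun setT g ->
  measurable_fun setT (fun t => g t ord0 i : measurableTypeR R).
Proof. by move/measurable_rV_coordP. Qed.

(** For fixed v the first coordinate undergoes an affine map whose shift depends on v, so the
    integral over t has to be the inner one; hence the exchange of integrals. *)
Lemma det_scaling_lblock n (a : 'M[R]_1) (c : 'cV[R]_n) (D : 'M[R]_n) :
  a ord0 ord0 != 0%R -> det_scaling D ->
  @det_scaling n.+1 (block_mx a 0 c D : 'M[R]_(1 + n)).
Proof.
move=> a0 hD F mF F0.
rewrite (integral_rV_cons mF F0) (integral_rV_cons _ (fun x => F0 _)); last first.
  by apply: measurableT_comp mF _; exact: measurable_mulmx.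
under [X in _ = _ * X]eq_integral do under eq_integral do
  rewrite rV_cons_mul_lblock /=.
have mc d (T : measurableType d) (f : T -> measurableTypeR R) (g : T -> 'rV[R]_n) :
    measurable_fun setT f ->
    measurable_fun setT g -> measurable_fun setT (fun t : T => F (rV_cons (f t, g t))).
  by move=> mf mg; apply: measurableT_comp mF _; exact: measurable_rV_cons_fun.
have maff : measurable_fun setT
    (fun p : measurableTypeR R * 'rV[R]_n =>
      (a ord0 ord0 * p.1 + (p.2 *m c) ord0 ord0)%R : measurableTypeR R).
  apply: measurable_funD; last exact/measurable_rV_coord_fun/measurable_mulmx.
  exact: measurable_funM.
pose F1 (t : measurableTypeR R) (v : 'rV[R]_n) := F (rV_cons (t, v)).
have mF1 : measurable_fun setT (fun p => F1 p.1 p.2) by exact: mc.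
have F10 (t : measurableTypeR R) (v : 'rV[R]_n) : 0 <= F1 t v by exact: F0.
pose F2 (t : measurableTypeR R) (v : 'rV[R]_n) :=
  F1 (a ord0 ord0 * t + (v *m c) ord0 ord0)%R (v *m D)%R.
have mF2 : measurable_fun setT (fun p => F2 p.1 p.2).
  by apply: mc => //; exact: measurable_mulmx.
have F20 (t : measurableTypeR R) (v : 'rV[R]_n) : 0 <= F2 t v by exact: F0.
rewrite -[LHS]/(\int[leb]_t \int[mu n]_v F1 t v).
rewrite -[X in _ = _ * X]/(\int[leb]_t \int[mu n]_v F2 t v).
rewrite (tonelli_swap leb (mu n) mF1 F10) (tonelli_swap leb (mu n) mF2 F20).
have -> : \det (block_mx a 0 c D : 'M[R]_(1 + n)) = (a ord0 ord0 * \det D)%R.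
  by rewrite det_lblock det_mx11.
have F1i v : 0 <= \int[leb]_t F1 t v by exact: integral_ge0.
have F2i v : [set: 'rV[R]_n] v -> 0 <= \int[leb]_t F2 t v by move=> _; exact: integral_ge0.
rewrite (hD _ (measurable_integral2 leb mF1 F10) F1i).
rewrite normrM EFinM [`|a _ _|%:E * _]muleC -muleA; congr (_ * _).
rewrite -(ge0_integralZl _ measurableT (measurable_integral2 leb mF2 F20) F2i)//.
apply: eq_integral => v _.
apply: (@integral_affine _ (a ord0 ord0) ((v *m c) ord0 ord0) (fun t => F1 t (v *m D)%R)) => //.
exact: mc.
Qed.

(** For fixed t the last coordinates are mapped by [D] and shifted by t b; translation invariance
    removes the shift. *)
Lemma det_scaling_ublock n (a : 'M[R]_1) (b : 'rV[R]_n) (D : 'M[R]_n) :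
  a ord0 ord0 != 0%R -> det_scaling D ->
  @det_scaling n.+1 (block_mx a b 0 D : 'M[R]_(1 + n)).
Proof.
move=> a0 hD F mF F0.
rewrite (integral_rV_cons mF F0) (integral_rV_cons _ (fun x => F0 _)); last first.
  by apply: measurableT_comp mF _; exact: measurable_mulmx.
under [X in _ = _ * X]eq_integral do under eq_integral do
  rewrite rV_cons_mul_ublock /=.
have mc d (T : measurableType d) (f : T -> measurableTypeR R) (g : T -> 'rV[R]_n) :
    measurable_fun setT f ->
    measurable_fun setT g -> measurable_fun setT (fun t : T => F (rV_cons (f t, g t))).
  by move=> mf mg; apply: measurableT_comp mF _; exact: measurable_rV_cons_fun.
pose F1 (t : measurableTypeR R) (v : 'rV[R]_n) := F (rV_cons (t, v)).
have mF1 : measurable_fun setT (fun p => F1 p.1 p.2) by exact: mc.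
have F10 (t : measurableTypeR R) (v : 'rV[R]_n) : 0 <= F1 t v by exact: F0.
pose F2 (t : measurableTypeR R) (v : 'rV[R]_n) :=
  F1 (a ord0 ord0 * t)%R (v *m D + t *: b)%R.
have mF2 : measurable_fun setT (fun p => F2 p.1 p.2).
  apply: mc; first exact: measurable_funM.
  apply: measurable_addmx; first exact: measurable_mulmx.
  exact: measurable_scalemx.
have F20 (t : measurableTypeR R) (v : 'rV[R]_n) : 0 <= F2 t v by exact: F0.
rewrite -[LHS]/(\int[leb]_t \int[mu n]_v F1 t v).
rewrite -[X in _ = _ * X]/(\int[leb]_t \int[mu n]_v F2 t v).
have -> : \det (block_mx a b 0 D : 'M[R]_(1 + n)) = (a ord0 ord0 * \det D)%R.
  by rewrite det_ublock det_mx11.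
have F1i (t : measurableTypeR R) : 0 <= \int[mu n]_v F1 t v by exact: integral_ge0.
have F2i (t : measurableTypeR R) : [set: measurableTypeR R] t -> 0 <= \int[mu n]_v F2 t v by move=> _; exact: integral_ge0.
rewrite (integral_affine 0%R a0 (measurable_integral1 (mu n) mF1 F10) F1i).
rewrite normrM EFinM -muleA; congr (_ * _).
rewrite -(ge0_integralZl _ measurableT (measurable_integral1 (mu n) mF2 F20) F2i)//.
apply: eq_integral => t _; rewrite addr0.
have m1 : measurable_fun setT (fun v : 'rV[R]_n => F1 (a ord0 ord0 * t)%R v) by exact: mc.
have m2 : measurable_fun setT (fun v : 'rV[R]_n => F1 (a ord0 ord0 * t)%R (v + t *: b)%R).
  by apply: mc => //; exact: measurable_addmx.
rewrite -(integral_rV_translate (t *: b)%R m1 (F10 _)).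
exact: (hD _ m2 (fun v => F10 _ _)).
Qed.

(** Induction on n by one step of Gaussian elimination: with a nonzero corner, [T] is a unipotent
    lower block matrix times an upper block matrix that carries the Schur complement. *)
Lemma det_scaling_unit n (T : 'M[R]_n) : T \in unitmx -> det_scaling T.
Proof.
elim: n T => [|n IH] T uT F mF F0.
  rewrite (_ : T = 1%:M)%R; last by apply/matrixP; case.
  rewrite det1 normr1 mul1e; apply: eq_integral => x _.
  by rewrite mulmx1.
pose low (c : 'cV[R]_n) : 'M[R]_n.+1 := block_mx 1%:M 0 c 1%:M.
have hlow c : det_scaling (low c).
  apply: det_scaling_lblock; first by rewrite mxE oner_neq0.
  by apply: IH; exact: unitmx1.
have lowM c d : (low c *m low d = low (c + d))%R.
  rewrite /low; etransitivity; first exact: (@mulmx_block _ 1 n 1 n 1 n).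
  by rewrite !mulmx1 !mul1mx !mul0mx !mulmx0 !addr0 add0r.
have low0 : low 0%R = 1%:M%R by rewrite /low; apply/esym; exact: (@scalar_mx_block _ 1 n).
have detlow c : \det (low c) = 1%R.
  by rewrite /low; etransitivity; [exact: (@det_lblock _ 1 n)|rewrite !det1 mulr1].
have base (S : 'M[R]_n.+1) : S \in unitmx -> S ord0 ord0 != 0%R -> det_scaling S.
  move=> {T uT F mF F0} uS S00.
  pose a : 'M[R]_1 := ulsubmx (S : 'M[R]_(1 + n)).
  pose b : 'rV[R]_n := ursubmx (S : 'M[R]_(1 + n)).
  pose c : 'cV[R]_n := dlsubmx (S : 'M[R]_(1 + n)).
  pose D : 'M[R]_n := drsubmx (S : 'M[R]_(1 + n)).
  have aE : a = (S ord0 ord0)%:M%R.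
    apply/matrixP => i j; rewrite !ord1 !mxE eqxx mulr1n.
    by congr (S _ _); exact: val_inj.
  pose e := ((S ord0 ord0)^-1 *: c)%R.
  have SE : S = (low e *m (block_mx a b 0 (D - e *m b) : 'M[R]_(1 + n)))%R.
    rewrite -[LHS](@submxK _ 1 n 1 n); apply/esym.
    etransitivity; first exact: (@mulmx_block _ 1 n 1 n 1 n).
    have ea : (e *m a = c)%R by rewrite aE mul_mx_scalar /e scalerA mulfV// scale1r.
    by rewrite !mul1mx !mul0mx !addr0 ea [X in block_mx _ _ _ X]addrC subrK.
  rewrite SE; apply: det_scaling_mul => //.
  apply: det_scaling_ublock; first by rewrite aE mxE.
  apply: IH; move: uS; rewrite SE unitmx_mul => /andP[_].
  rewrite !unitmxE (_ : \det _ = S ord0 ord0 * \det (D - e *m b))%R.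
    by rewrite unitrM => /andP[].
  by etransitivity; [exact: (@det_ublock _ 1 n)|rewrite aE det_scalar1].
(* With a zero corner, invertibility gives another nonzero entry in the first row. Adding its column
   to column 0 makes the corner nonzero, and the inverse operation is again of the form [low]. *)
have [T00|T00] := eqVneq (T ord0 ord0) 0%R; last exact: base.
have [i Ti] : exists i : 'I_n, T ord0 (lift ord0 i) != 0%R.
  apply/existsP; apply/contraT; rewrite negb_exists => /forallP Ti.
  move: uT; rewrite -row_free_unit => /row_freeP[S TS].
  suff : (T *m S) ord0 ord0 = 0%R.
    by move=> /eqP; rewrite TS mxE eqxx oner_eq0.
  rewrite mxE big1// => j _; case: (unliftP ord0 j) => [k ->|->].
    by move: (Ti k); rewrite negbK => /eqP ->; rewrite mul0r.
  by rewrite T00 mul0r.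
pose c : 'cV[R]_n := delta_mx i ord0.
have -> : T = (T *m low c *m low (- c))%R.
  by rewrite -mulmxA lowM subrr low0 mulmx1.
apply: det_scaling_mul => //; apply: base.
  by rewrite unitmx_mul uT unitmxE detlow unitr1.
rewrite mxE (bigD1 ord0)//= T00 mul0r add0r.
rewrite (bigD1 (lift ord0 i))//= big1 ?addr0.
  rewrite (_ : low c _ _ = 1)%R ?mulr1//.
  rewrite /low (_ : lift ord0 i = rshift 1 i); last exact: val_inj.
  rewrite (_ : ord0 = lshift n (ord0 : 'I_1)); last exact: val_inj.
  by etransitivity; [exact: (@block_mxEdl _ 1 n 1 n)|rewrite mxE !eqxx].
move=> j /andP[]; case: (unliftP ord0 j) => [k ->|->//] _ ki.
rewrite (_ : low c _ _ = 0)%R ?mulr0//.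
rewrite /low (_ : lift ord0 k = rshift 1 k); last exact: val_inj.
rewrite (_ : ord0 = lshift n (ord0 : 'I_1)); last exact: val_inj.
etransitivity; first exact: (@block_mxEdl _ 1 n 1 n).
rewrite mxE eqxx andbT; case: eqP => // kiE; move: ki.
by rewrite kiE eqxx.
Qed.

End linear.

(** * Matrix spaces: continuity, and measurability of open and closed conditions *)

Section matrix_topology.
Variable R : realType.

Lemma cvg_mx (T : Type) (F : set_system T) (FF : Filter F) m n
    (f : T -> 'M[R]_(m, n)) (l : 'M[R]_(m, n)) :
  (forall i j, f x i j @[x --> F] --> l i j) -> f @ F --> l.
Proof.
move=> fl; apply/cvg_ballP => e e0.
have : forall i, \forall x \near F, forall j, ball (l i j) e (f x i j).
  by move=> i; apply: filter_forall => j; have /cvg_ballP := fl i j; exact.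
move/filter_forall; apply: filterS => x h; split => // i j; exact: h.
Qed.

Lemma continuous_mx (T : topologicalType) m n (f : T -> 'M[R]_(m, n)) :
  (forall i j, continuous (fun x => f x i j)) -> continuous f.
Proof. by move=> cf x; apply: cvg_mx => i j; exact: cf. Qed.

Lemma continuous_coord (T : topologicalType) m n (f : T -> 'M[R]_(m, n)) i j :
  continuous f -> continuous (fun x => f x i j).
Proof.
move=> cf x; apply: (@continuous_comp _ _ _ f (fun M : 'M[R]_(m, n) => M i j)).
  exact: cf.
exact: coord_continuous.
Qed.

Lemma continuous_sum_fun (T : topologicalType) (I : finType) (f : I -> T -> R) :
  (forall i, continuous (f i)) -> continuous (fun x => \sum_i f i x).
Proof. by move=> cf x; apply: cvg_big => [|i _]; [exact: add_continuous|exact: cf]. Qed.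

Lemma continuous_mulmx_fun (T : topologicalType) m n p (f : T -> 'M[R]_(m, n))
    (g : T -> 'M[R]_(n, p)) :
  continuous f -> continuous g -> continuous (fun x => f x *m g x).
Proof.
move=> cf cg; apply: continuous_mx => i j.
under eq_fun do rewrite mxE.
apply: continuous_sum_fun => k x.
by apply: cvgM; [exact: (continuous_coord cf)|exact: (continuous_coord cg)].
Qed.

Lemma continuous_mulmxr n m (G : 'M[R]_(n, m)) :
  continuous (fun x : 'rV[R]_n => x *m G).
Proof. by apply: continuous_mulmx_fun; [move=> x; exact: cvg_id|exact: cst_continuous]. Qed.

(** An open set is the union of the balls with rational centre and radius 1/(k+1) that it contains,
    a countable family. The norm being the sup norm, membership in a ball is a finite conjunction of
    conditions on the entries. *)
Lemma measurable_preimage_open_mx d (T : measurableType d) m n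
    (f : T -> 'M[R]_(m, n)) (U : set 'M[R]_(m, n)) :
  (forall i j, measurable_fun setT (fun t => f t i j : measurableTypeR R)) ->
  open U -> measurable (f @^-1` U).
Proof.
move=> mf oU.
pose c (p : 'M[rat]_(m, n) * nat) : 'M[R]_(m, n) := \matrix_(i, j) ratr (p.1 i j).
pose e (p : 'M[rat]_(m, n) * nat) : R := (p.2.+1%:R)^-1.
have -> : f @^-1` U = \bigcup_p [set t | ball (c p) (e p) `<=` U /\
    ball (c p) (e p) (f t)].
  apply/seteqP; split => [t Uft|t [p _ [Dp ft]]]; last exact: Dp.
  have /nbhs_ballP[r /= r0 rU] : nbhs (f t) U by exact: open_nbhs_nbhs.
  have [k kr] : exists k : nat, k.+1%:R^-1 < r / 2.
    have [k _ kP] := near_infty_natSinv_lt (PosNum (divr_gt0 r0 (ltr0Sn _ 1))).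
    by exists k; exact: (kP k (leqnn _)).
  have qP i j : exists q : rat, `|f t i j - ratr q| < k.+1%:R^-1.
    have [q] := @rat_in_itvoo R (f t i j - k.+1%:R^-1) (f t i j + k.+1%:R^-1)
      (ltac:(by rewrite ltrD2l gtrN)).
    by rewrite in_itv /= => /andP[q1 q2]; exists q;
    move: q1 q2; set ek := (k.+1%:R^-1 : R); rewrite ltr_norml => q1 q2; apply/andP; split; lra.
  have [q qE] : exists q : 'M[rat]_(m, n), forall i j,
      `|f t i j - ratr (q i j)| < k.+1%:R^-1.
    exists (\matrix_(i, j) projT1 (cid (qP i j))) => i j; rewrite mxE.
    exact: (projT2 (cid (qP i j))).
  have cf : ball (c (q, k)) k.+1%:R^-1 (f t).
    by split => // i j; rewrite mxE /ball /= distrC.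
  exists (q, k) => //; split => //; rewrite /e /= => y cy; apply: rU.
  apply: le_ball (ball_triangle (ball_sym cf) cy).
  by rewrite [leRHS]splitr ltW// ltrD.
apply: countable_bigcupT_measurable => // p.
have [pU|pU] := pselect (ball (c p) (e p) `<=` U); last first.
  by rewrite (_ : [set t | _] = set0)// -subset0 => t [].
rewrite (_ : [set t | _] =
    \bigcap_(i in [set: 'I_m]) \bigcap_(j in [set: 'I_n])
      ((fun t => f t i j) @^-1` ball (c p i j) (e p))).
  apply: fin_bigcap_measurable => // i _; apply: fin_bigcap_measurable => // j _.
  by rewrite -[X in measurable X]setTI; apply: mf => //; exact: measurable_ball.
apply/seteqP; split => t /=.
  by move=> [_ [_ h]] i _ j _; exact: h.
by move=> h; split => //; split => [|i j]; [rewrite /e invr_gt0|exact: h].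
Qed.

Lemma measurable_preimage_closed_mx d (T : measurableType d) m n
    (f : T -> 'M[R]_(m, n)) (U : set 'M[R]_(m, n)) :
  (forall i j, measurable_fun setT (fun t => f t i j : measurableTypeR R)) ->
  closed U -> measurable (f @^-1` U).
Proof.
move=> mf cU; rewrite -[U]setCK preimage_setC; apply: measurableC.
exact: (measurable_preimage_open_mx mf (closed_openC cU)).
Qed.

Lemma closed_measurable_rV n (A : set 'rV[R]_n) : closed A -> measurable A.
Proof.
move=> cA; apply: (@measurable_preimage_closed_mx _ _ _ _ (@id 'rV[R]_n)) => // i j.
rewrite (_ : (fun t => _) = rV_coord j); first exact: measurable_rV_coord.
by apply/funext => t; rewrite /rV_coord ord1.
Qed.

Lemma compact_closed_mx m n (A : set 'M[R]_(m, n)) : compact A -> closed A.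
Proof.
by move=> cA; apply: (@compact_closed _ A _ cA); exact: norm_hausdorff.
Qed.

Lemma compact_measurable_rV n (A : set 'rV[R]_n) : compact A -> measurable A.
Proof. by move/compact_closed_mx; exact: closed_measurable_rV. Qed.

End matrix_topology.

Section linear_sets.
Local Open Scope ereal_scope.
Variable R : realType.

Lemma measurable_preimageT d1 d2 (T1 : measurableType d1)
    (T2 : measurableType d2) (f : T1 -> T2) A :
  measurable_fun setT f -> measurable A -> measurable (f @^-1` A).
Proof. by move=> mf mA; rewrite -[X in measurable X]setTI; exact: mf. Qed.

Lemma measure_integral_indic d (T : measurableType d)
    (m : {measure set T -> \bar R}) (A : set T) : measurable A ->
  m A = \int[m]_x (\1_A x)%:E.
Proof. by move=> mA; rewrite integral_indic// setIT. Qed.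

Lemma measure_preimage_linear n (T : 'M[R]_n) (A : set 'rV[R]_n) :
  T \in unitmx -> measurable A ->
  mu n A = `|\det T|%:E * mu n [set x | A (x *m T)%R].
Proof.
move=> uT mA.
have mA' : measurable [set x | A (x *m T)%R].
  by apply: measurable_preimageT mA; exact: measurable_mulmx.
rewrite (measure_integral_indic _ mA) (measure_integral_indic _ mA').
rewrite (det_scaling_unit uT (measurable_indicE mA)); last by move=> x; rewrite lee_fin.
by congr (_ * _); apply: eq_integral => x _; rewrite !indicE.
Qed.

Lemma measure_preimage_translate n (w : 'rV[R]_n) (A : set 'rV[R]_n) :
  measurable A -> mu n [set x | A (x + w)%R] = mu n A.
Proof.
move=> mA.
have mA' : measurable [set x | A (x + w)%R].
  by apply: measurable_preimageT mA; exact: measurable_addmx.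
rewrite (measure_integral_indic _ mA) (measure_integral_indic _ mA').
rewrite -(integral_rV_translate w (measurable_indicE mA)); last by move=> x; rewrite lee_fin.
by apply: eq_integral => x _; rewrite !indicE.
Qed.

Lemma measure_dilate n (a : R) (A : set 'rV[R]_n) :
  (0 < a)%R -> measurable A -> mu n (dilate a A) = (a ^+ n)%:E * mu n A.
Proof.
move=> a0 mA; have an0 : a != 0%R by rewrite gt_eqF.
have uT : (a^-1%:M : 'M[R]_n) \in unitmx.
  by rewrite unitmxE det_scalar unitrX// unitfE invr_eq0.
have DE : dilate a A = [set x | A (x *m a^-1%:M)%R].
  apply/seteqP; split => [_ [x Ax <-]|x]/=.
    by rewrite mul_mx_scalar scalerA mulVf// scale1r.
  by move=> Ax; exists (x *m a^-1%:M)%R => //; rewrite mul_mx_scalar scalerA mulfV// scale1r.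
rewrite [in RHS](measure_preimage_linear uT mA) -DE muleA -EFinM.
rewrite det_scalar normrX ger0_norm ?invr_ge0 ?ltW//.
by rewrite -exprMn mulfV// expr1n mul1e.
Qed.

Lemma measurable_dilate n (a : R) (A : set 'rV[R]_n) :
  (0 < a)%R -> measurable A -> measurable (dilate a A).
Proof.
move=> a0 mA; have an0 : a != 0%R by rewrite gt_eqF.
rewrite (_ : dilate a A = [set x | A (x *m a^-1%:M)%R]).
  by apply: measurable_preimageT mA; exact: measurable_mulmx.
apply/seteqP; split => [_ [x Ax <-]|x]/=.
  by rewrite mul_mx_scalar scalerA mulVf// scale1r.
by move=> Ax; exists (x *m a^-1%:M)%R => //; rewrite mul_mx_scalar scalerA mulfV// scale1r.
Qed.

Lemma rV_cons_row_mx m p (t : measurableTypeR R) (y : 'rV[R]_m) (z : 'rV[R]_p) :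
  row_mx (rV_cons (t, y)) z = rV_cons (t, row_mx y z) :> 'rV[R]_(m.+1 + p).
Proof.
apply: (@rV_consP R (m + p)).
  rewrite rV_cons0 (_ : ord0 = lshift p (ord0 : 'I_m.+1)); last exact: val_inj.
  by rewrite (@row_mxEl _ _ m.+1) rV_cons0.
move=> i; rewrite rV_consS /=; case: (split_ordP i) => j ->.
  rewrite row_mxEl (_ : lift _ _ = lshift p (lift ord0 j)); last exact: val_inj.
  by rewrite (@row_mxEl _ _ m.+1) rV_consS.
rewrite row_mxEr (_ : lift _ _ = rshift m.+1 j); last exact: val_inj.
by rewrite (@row_mxEr _ _ m.+1).
Qed.

Lemma integral_row_mx m p (F : 'rV[R]_(m + p) -> \bar R) :
  measurable_fun setT F -> (forall x, 0 <= F x) ->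
  \int[mu (m + p)]_x F x = \int[mu m]_y \int[mu p]_z F (row_mx y z).
Proof.
elim: m F => [|m IH] F mF F0.
  rewrite integral_rV0; last first.
    apply: (measurable_integral1 (mu p)) => //.
    by apply: measurableT_comp mF _; exact: measurable_row_mx.
  apply: eq_integral => x _; congr F; apply/rowP => i.
  case: (split_ordP (i : 'I_(0 + p))) => [[]//|j ->].
  by rewrite row_mxEr; congr (x _ _); exact: val_inj.
have mG : measurable_fun setT (fun y => \int[mu p]_z F (row_mx y z)).
  apply: (@measurable_integral1 _ _ _ _ R (mu p) (fun y z => F (row_mx y z))) => //.
  by apply: measurableT_comp mF _; exact: measurable_row_mx.
rewrite (integral_rV_cons (n := m + p) mF F0).
have G0 y : 0 <= \int[mu p]_z F (row_mx y z) by exact: integral_ge0.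
rewrite (integral_rV_cons mG G0).
apply: eq_integral => t _.
have mFt : measurable_fun setT (fun v : 'rV[R]_(m + p) => F (rV_cons (t, v))).
  by apply: measurableT_comp mF _; exact: measurable_rV_cons_fun.
rewrite (IH _ mFt (fun v => F0 _)).
apply: eq_integral => y _; apply: eq_integral => z _.
by rewrite rV_cons_row_mx.
Qed.

Lemma measure_row_mx m p (A : set 'rV[R]_(m + p)) : measurable A ->
  mu (m + p) A = \int[mu m]_y mu p [set z | A (row_mx y z)].
Proof.
move=> mA; rewrite (measure_integral_indic _ mA).
rewrite (integral_row_mx (measurable_indicE mA)); last by move=> x; rewrite lee_fin.
apply: eq_integral => y _.
rewrite -measure_integral_indic//.
by apply: measurable_preimageT mA; exact: measurable_row_mx.
Qed.

End linear_sets.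

(** * Euclidean geometry *)

Section euclidean.
Variable R : realType.

Definition dot n (x y : 'rV[R]_n) : R := \sum_(i < n) x ord0 i * y ord0 i.

Lemma dotE n (x y : 'rV[R]_n) : x *m y^T = (dot x y)%:M.
Proof.
apply/matrixP => i j; rewrite !ord1 [LHS]mxE mxE eqxx mulr1n.
by apply: eq_bigr => k _; rewrite mxE.
Qed.

Lemma dotC n (x y : 'rV[R]_n) : dot x y = dot y x.
Proof. by apply: eq_bigr => i _; rewrite mulrC. Qed.

Lemma dotDl n (x y z : 'rV[R]_n) : dot (x + y) z = dot x z + dot y z.
Proof. by rewrite -big_split; apply: eq_bigr => i _; rewrite mxE mulrDl. Qed.

Lemma dotZl n a (x z : 'rV[R]_n) : dot (a *: x) z = a * dot x z.
Proof. by rewrite mulr_sumr; apply: eq_bigr => i _; rewrite mxE mulrA. Qed.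

Lemma dotDr n (x y z : 'rV[R]_n) : dot z (x + y) = dot z x + dot z y.
Proof. by rewrite dotC dotDl !(dotC z). Qed.

Lemma dotZr n a (x z : 'rV[R]_n) : dot z (a *: x) = a * dot z x.
Proof. by rewrite dotC dotZl dotC. Qed.

Lemma dotNl n (x z : 'rV[R]_n) : dot (- x) z = - dot x z.
Proof. by rewrite -scaleN1r dotZl mulN1r. Qed.

Lemma dotNr n (x z : 'rV[R]_n) : dot z (- x) = - dot z x.
Proof. by rewrite dotC dotNl dotC. Qed.

Lemma dot_ge0 n (x : 'rV[R]_n) : 0 <= dot x x.
Proof. by apply: sumr_ge0 => i _; rewrite -expr2 sqr_ge0. Qed.

Lemma dot_eq0 n (x : 'rV[R]_n) : (dot x x == 0) = (x == 0).
Proof.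
apply/eqP/eqP => [|->]; last by rewrite /dot big1// => i _; rewrite mxE mul0r.
move/psumr_eq0P => h; apply/rowP => i; rewrite mxE; apply/eqP.
have := h (fun i _ => ltac:(by rewrite -expr2 sqr_ge0)) i isT.
by move/eqP; rewrite -expr2 sqrf_eq0.
Qed.

Lemma enorm_sqr n (x : 'rV[R]_n) : enorm x ^+ 2 = dot x x.
Proof.
rewrite sqr_sqrtr; last by apply: sumr_ge0 => i _; exact: sqr_ge0.
by apply: eq_bigr => i _; rewrite expr2.
Qed.

Lemma enorm_ge0 n (x : 'rV[R]_n) : 0 <= enorm x.
Proof. exact: sqrtr_ge0. Qed.

Lemma enorm_dot n (x : 'rV[R]_n) : enorm x = Num.sqrt (dot x x).
Proof. by rewrite -enorm_sqr sqrtr_sqr ger0_norm// enorm_ge0. Qed.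

Lemma enormZ n a (x : 'rV[R]_n) : enorm (a *: x) = `|a| * enorm x.
Proof.
rewrite !enorm_dot dotZl dotZr mulrA -expr2 sqrtrM ?sqr_ge0//.
by rewrite sqrtr_sqr.
Qed.

Lemma enormN n (x : 'rV[R]_n) : enorm (- x) = enorm x.
Proof. by rewrite -scaleN1r enormZ normrN1 mul1r. Qed.

Lemma enorm_eq0 n (x : 'rV[R]_n) : (enorm x == 0) = (x == 0).
Proof. by rewrite -dot_eq0 -enorm_sqr sqrf_eq0. Qed.

Lemma enorm0 n : enorm (0 : 'rV[R]_n) = 0.
Proof. by apply/eqP; rewrite enorm_eq0. Qed.

Lemma dot_le_enorm n (x y : 'rV[R]_n) : dot x y <= enorm x * enorm y.
Proof.
have [->|y0] := eqVneq y 0.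
  by rewrite enorm0 mulr0 /dot big1// => i _; rewrite mxE mulr0.
have yy : 0 < dot y y by rewrite lt_neqAle eq_sym dot_eq0 y0 dot_ge0.
have := dot_ge0 (dot y y *: x - dot x y *: y).
rewrite dotDl !dotDr !dotNl !dotNr !dotZl !dotZr (dotC y x) => h.
have {}h : dot x y ^+ 2 <= dot x x * dot y y.
  rewrite -(ler_pM2l yy); move: h; set a := dot x x; set b := dot y y.
  set c := dot x y => h; nra.
rewrite (le_trans (ler_norm _))// -(@ler_pXn2r _ 2)// ?nnegrE ?mulr_ge0 ?enorm_ge0//.
by rewrite real_normK ?num_real// exprMn !enorm_sqr.
Qed.

Lemma enorm_triangle n (x y : 'rV[R]_n) : enorm (x + y) <= enorm x + enorm y.
Proof.
rewrite -(@ler_pXn2r _ 2)// ?nnegrE ?addr_ge0 ?enorm_ge0//.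
rewrite enorm_sqr dotDl !dotDr (dotC y x) -!enorm_sqr.
have := dot_le_enorm x y; set a := enorm x; set b := enorm y => h; nra.
Qed.

Lemma coord_le_enorm n (x : 'rV[R]_n) i : `|x ord0 i| <= enorm x.
Proof.
rewrite -(@ler_pXn2r _ 2)// ?nnegrE ?enorm_ge0// enorm_sqr real_normK ?num_real//.
rewrite /dot (bigD1 i)//= -expr2 lerDl sumr_ge0// => j _.
by rewrite -expr2 sqr_ge0.
Qed.

Lemma enorm_le_sum n (x : 'rV[R]_n) : enorm x <= \sum_i `|x ord0 i|.
Proof.
rewrite -(@ler_pXn2r _ 2)// ?nnegrE ?enorm_ge0 ?sumr_ge0// enorm_sqr /dot.
rewrite expr2 mulr_suml; apply: ler_sum => i _.
rewrite (le_trans (ler_norm _))// normrM ler_wpM2l//.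
by rewrite (bigD1 i)//= lerDl sumr_ge0.
Qed.

Lemma enorm_continuous n : continuous (@enorm R n).
Proof.
have -> : @enorm R n = Num.sqrt \o (fun x => dot x x).
  by apply/funext => x; rewrite enorm_dot.
move=> x; apply: continuous_comp; last exact: sqrt_continuous.
apply: continuous_sum_fun => i {}x.
have ci : {for x, continuous (fun y : 'rV[R]_n => y ord0 i)}.
  exact: coord_continuous.
exact: (cvgM ci ci).
Qed.

Lemma mx_norm_le m n (x : 'M[R]_(m, n)) (M : R) : 0 <= M ->
  (forall i j, `|x i j| <= M) -> `|x| <= M.
Proof.
move=> M0 h; rewrite [leLHS]/Num.norm /= mx_normrE.
by apply/bigmax_leP; split => // -[i j] _ /=.
Qed.

Lemma coord_le_norm m n (x : 'M[R]_(m, n)) i j : `|x i j| <= `|x|.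
Proof.
rewrite [leRHS]/Num.norm /= mx_normrE.
by apply/bigmax_geP; right; exists (i, j).
Qed.

Definition is_orthogonal n (Q : 'M[R]_n) := Q *m Q^T = 1%:M.

Lemma orthogonal_unit n (Q : 'M[R]_n) : is_orthogonal Q -> Q \in unitmx.
Proof. by move=> QQ; have /mulmx1_unit[] := QQ. Qed.

Lemma orthogonal_tr n (Q : 'M[R]_n) : is_orthogonal Q -> is_orthogonal Q^T.
Proof. by move=> QQ; rewrite /is_orthogonal trmxK; exact: mulmx1C. Qed.

Lemma orthogonal_mul n (P Q : 'M[R]_n) :
  is_orthogonal P -> is_orthogonal Q -> is_orthogonal (P *m Q).
Proof.
move=> PP QQ; rewrite /is_orthogonal trmx_mul mulmxA -(mulmxA P) QQ mulmx1.
exact: PP.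
Qed.

Lemma orthogonal_det n (Q : 'M[R]_n) : is_orthogonal Q -> `|\det Q| = 1.
Proof.
move=> /(congr1 determinant); rewrite det_mulmx det_tr det1 -expr2 => /eqP.
by rewrite sqrf_eq1 => /orP[]/eqP ->; rewrite ?normrN normr1.
Qed.

Lemma orthogonal_dot n (Q : 'M[R]_n) (x y : 'rV[R]_n) : is_orthogonal Q ->
  dot (x *m Q) (y *m Q) = dot x y.
Proof.
move=> QQ; have /matrixP/(_ ord0 ord0) : (x *m Q) *m (y *m Q)^T = x *m y^T.
  by rewrite trmx_mul mulmxA -(mulmxA x) QQ mulmx1.
by rewrite !dotE !mxE.
Qed.

Lemma orthogonal_enorm n (Q : 'M[R]_n) (x : 'rV[R]_n) : is_orthogonal Q ->
  enorm (x *m Q) = enorm x.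
Proof. by move=> QQ; rewrite !enorm_dot orthogonal_dot. Qed.

(** The reflection in the hyperplane orthogonal to u - |u| e_0; the identity serves when this vector
    vanishes. *)
Lemma householder n (u : 'rV[R]_n.+1) : exists Q : 'M[R]_n.+1,
  is_orthogonal Q /\ u *m Q = enorm u *: delta_mx ord0 ord0.
Proof.
set w := enorm u *: delta_mx ord0 ord0; pose v := u - w.
have [v0|v0] := eqVneq v 0.
  exists 1%:M; split; first by rewrite /is_orthogonal mul1mx trmx1.
  by rewrite mulmx1; apply/eqP; rewrite -subr_eq0 -/v v0.
have vv : dot v v != 0 by rewrite dot_eq0.
have ww : dot w w = dot u u.
  rewrite dotZl dotZr mulrA -expr2 enorm_sqr -[RHS]mulr1; congr (_ * _).
  rewrite /dot (bigD1 ord0)//= mxE !eqxx mulr1 big1 ?addr0// => i i0.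
  by rewrite mxE (negbTE i0) mulr0.
have uv : dot u v *+ 2 = dot v v.
  by rewrite /v dotDl !dotDr !dotNl !dotNr ww (dotC w u) mulr2n; ring.
pose P := (2 / dot v v) *: (v^T *m v).
have PT : P^T = P by rewrite /P linearZ /= trmx_mul trmxK.
have PP : P *m P = P + P.
  rewrite /P -scalemxAl -scalemxAr scalerA mulmxA -(mulmxA v^T) dotE.
  rewrite mul_mx_scalar -scalemxAl scalerA -scalerDl; congr (_ *: _).
  by field.
exists (1%:M - P); split.
  rewrite /is_orthogonal linearB /= trmx1 PT mulmxBl mul1mx mulmxBr mulmx1 PP.
  by rewrite (opprD P P) addrA subrr add0r opprK subrK.
rewrite mulmxBr mulmx1 -scalemxAr mulmxA dotE mul_scalar_mx scalerA.
rewrite (_ : 2 / dot v v * dot u v = 1); first by rewrite scale1r /v opprB addrC subrK.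
by apply: (mulIf vv); rewrite mul1r mulrAC divfK// -uv mulr_natl.
Qed.

(** Householder reflections row by row: the first row goes to a multiple of e_0, and the recursion
    treats the remaining rows without their first coordinate. The rows of [X] may be dependent. The
    use is to rotate an N-dimensional subspace onto R^N x 0. *)
Lemma lq_decomposition N k (X : 'M[R]_(N, N + k)) :
  exists Q : 'M[R]_(N + k), is_orthogonal Q /\
    exists T : 'M[R]_N, X *m Q = row_mx T 0.
Proof.
suff [Q [oQ QX]] : exists Q : 'M[R]_(N + k), is_orthogonal Q /\
    forall i j, (X *m Q) i (rshift N j) = 0.
  exists Q; split => //; exists (lsubmx (X *m Q)).
  rewrite -[LHS]hsubmxK; congr (row_mx _ _).
  by apply/matrixP => i j; rewrite !mxE -[RHS](QX i j) mxE.
elim: N X => [|N IH] X.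
  by exists 1%:M; split; [rewrite /is_orthogonal mul1mx trmx1|case].
have [H [oH HX]] := @householder (N + k) (row ord0 X).
pose XH : 'M[R]_(1 + N, 1 + (N + k)) := X *m H.
have [Q' [oQ' QX']] := IH (drsubmx XH).
pose Qb : 'M[R]_(1 + (N + k)) := block_mx 1%:M 0 0 Q'.
have oQb : is_orthogonal Qb.
  rewrite /is_orthogonal /Qb tr_block_mx !trmx0 trmx1 mulmx_block.
  by rewrite !mulmx0 !mul0mx !mulmx1 addr0 !add0r oQ' -scalar_mx_block.
exists (H *m Qb); split; first exact: orthogonal_mul.
have XHe : XH = block_mx (ulsubmx XH) 0 (dlsubmx XH) (drsubmx XH).
  rewrite -[LHS]submxK; congr block_mx.
  apply/matrixP => i j; rewrite !ord1 !mxE.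
  have h : (row ord0 X *m H) ord0 (rshift 1 j) = 0.
    by rewrite HX !mxE mulr0.
  transitivity ((row ord0 X *m H) ord0 (rshift 1 j)); last exact: h.
  rewrite [RHS]mxE; apply: eq_bigr => l _; rewrite !mxE.
  by congr (X _ _ * H _ _); exact: val_inj.
have E : X *m (H *m Qb) = XH *m Qb :> 'M[R]_(1 + N, 1 + (N + k)).
  by rewrite /XH mulmxA.
move=> i j; rewrite E XHe /Qb mulmx_block.
rewrite !mulmx0 !mul0mx !addr0 !add0r mulmx1.
have Ej : (rshift N.+1 j : 'I_(1 + (N + k))) = rshift 1 (rshift N j).
  exact: val_inj.
rewrite [rshift N.+1 j]Ej; case: (split_ordP (i : 'I_(1 + N))) => i' ->.
  by etransitivity; [exact: (@block_mxEur _ 1 N 1 (N + k))|rewrite mxE].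
by etransitivity; [exact: (@block_mxEdr _ 1 N 1 (N + k))|rewrite QX'].
Qed.

End euclidean.

(** * Convex hulls and volumes *)

Section convex_sets.
Variable R : realType.

Lemma is_convexP n (A : set 'rV[R]_n) : is_convex A <->
  forall x y t, A x -> A y -> 0 <= t -> t <= 1 -> A (t *: x + (1 - t) *: y).
Proof.
split=> [cA x y t Ax Ay t0 t1|cA x y l].
  have := cA x y (Itv01 t0 t1) (mem_set Ax) (mem_set Ay).
  by move/set_mem.
rewrite !inE => Ax Ay; rewrite /conv /=.
by apply: cA => //.
Qed.

Definition simplex q : set 'rV[R]_q :=
  [set c | (forall i, 0 <= c ord0 i) /\ \sum_i c ord0 i <= 1].

Lemma convex_simplex q : is_convex (@simplex q).
Proof.
apply/is_convexP => x y t [x0 x1] [y0 y1] t0 t1; split => [i|].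
  by rewrite !mxE addr_ge0// mulr_ge0// subr_ge0.
under eq_bigr do rewrite !mxE.
rewrite big_split /= -!mulr_sumr.
have tx : t * \sum_i x ord0 i <= t by rewrite ler_piMr.
have ty : (1 - t) * \sum_i y ord0 i <= 1 - t by rewrite ler_piMr// subr_ge0.
by rewrite (le_trans (lerD tx ty))// addrC subrK.
Qed.

Lemma compact_simplex q : compact (@simplex q).
Proof.
apply: bounded_closed_compact.
  exists 1; split => // M M1 x [x0 x1] /=.
  apply: mx_norm_le => [|i j]; first lra.
  rewrite ord1 ger0_norm// (le_trans _ (ltW M1))// (le_trans _ x1)//.
  by rewrite (bigD1 j)//= lerDl sumr_ge0.
have -> : @simplex q = \bigcap_(i in [set: 'I_q]) (fun c : 'rV[R]_q => c ord0 i) @^-1`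
    [set r | 0 <= r] `&` (fun c : 'rV[R]_q => \sum_i c ord0 i) @^-1` [set r | r <= 1].
  apply/seteqP; split => x.
    by move=> [x0 x1]; split => // i _; exact: x0.
  by move=> [x0 x1]; split => // i; exact: x0.
apply: closedI.
  apply: closed_bigI => i _; apply: preimage_closed; last exact: closed_ge.
  by move=> x _; exact: coord_continuous.
apply: preimage_closed; last exact: closed_le.
by move=> x _; apply: continuous_sum_fun => i; exact: coord_continuous.
Qed.

Lemma convex_image_mulmx n m (G : 'M[R]_(n, m)) (A : set 'rV[R]_n) :
  is_convex A -> is_convex [set x *m G | x in A].
Proof.
move=> /is_convexP cA; apply/is_convexP => _ _ t [x Ax <-] [y Ay <-] t0 t1.
exists (t *: x + (1 - t) *: y); first exact: cA.
by rewrite mulmxDl -!scalemxAl.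
Qed.

Lemma compact_image_mulmx n m (G : 'M[R]_(n, m)) (A : set 'rV[R]_n) :
  compact A -> compact [set x *m G | x in A].
Proof.
move=> cA; apply: (@continuous_compact _ _ (fun x : 'rV[R]_n => x *m G)) => //.
by apply: continuous_subspaceT; exact: continuous_mulmxr.
Qed.

(** The weights need only sum to at most 1, since the point 0 of [B] absorbs the rest. *)
Lemma convex_combination n (B : set 'rV[R]_n) (I : eqType) (s : seq I)
    (c : I -> R) (x : I -> 'rV[R]_n) :
  is_convex B -> B 0 -> (forall i, B (x i)) -> (forall i, 0 <= c i) ->
  \sum_(i <- s) c i <= 1 -> B (\sum_(i <- s) c i *: x i).
Proof.
move=> /is_convexP cB B0 Bx; elim: s c => [|i s IH] c c0.
  by rewrite !big_nil.
rewrite !big_cons => cs.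
have s0 : 0 <= \sum_(j <- s) c j by exact: sumr_ge0.
have ci1 : c i <= 1 by rewrite (le_trans _ cs)// lerDl.
have [ci|ci] := eqVneq (c i) 1.
  have sz : \sum_(j <- s) c j = 0 by apply/eqP; rewrite eq_le s0 andbT; lra.
  rewrite ci scale1r big_seq big1 ?addr0// => j js.
  have : c j == 0.
    move/eqP: sz; rewrite psumr_eq0// => /allP/(_ j js); exact.
  by move=> /eqP ->; rewrite scale0r.
have d0 : 0 < 1 - c i by rewrite subr_gt0 lt_neqAle ci.
have -> : \sum_(j <- s) c j *: x j =
    (1 - c i) *: \sum_(j <- s) (c j / (1 - c i)) *: x j.
  rewrite scaler_sumr; apply: eq_bigr => j _; rewrite scalerA mulrCA mulfV ?mulr1//.
  exact: lt0r_neq0.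
apply: cB => //; apply: IH => [j|].
  by rewrite divr_ge0// ltW.
by rewrite -mulr_suml ler_pdivrMr// mul1r; lra.
Qed.

(** One compact parameter space for all hulls: compactness, images under linear maps and
    measurability in [X] are read off this form. *)
Lemma hull0E q n (X : 'M[R]_(q, n)) : hull0 X = [set c *m X | c in @simplex q].
Proof.
apply/seteqP; split.
  apply: smallest_sub; first exact/convex_image_mulmx/convex_simplex.
  move=> x [->|[i _ <-]].
    exists 0; last by rewrite mul0mx.
    by split => [i|]; [rewrite mxE|rewrite big1// => i _; rewrite mxE].
  exists (delta_mx ord0 i); last by rewrite rowE.
  split => [j|]; first by rewrite mxE; case: (_ && _).
  rewrite (bigD1 i)//= mxE !eqxx big1 ?addr0// => j ji.
  by rewrite mxE (negbTE ji) andbF.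
move=> _ [c [c0 c1] <-] B [cB sB].
rewrite mulmx_sum_row; apply: convex_combination => //.
  by apply: sB; left.
by move=> i; apply: sB; right; exists i.
Qed.

Lemma std_simplexE q : @std_simplex R q = @simplex q.
Proof.
have -> : @std_simplex R q = hull0 (1%:M : 'M[R]_q).
  rewrite /std_simplex /hull0.
  rewrite (_ : (fun i => row i 1%:M) = (fun i => delta_mx ord0 i))//.
  by apply/funext => i; rewrite row1.
rewrite hull0E; apply/seteqP; split => [_ [c cs <-]|c cs].
  by rewrite mulmx1.
by exists c; rewrite ?mulmx1.
Qed.

Lemma bracket_simplex q n (X : 'M[R]_(q, n)) :
  bracket X (@std_simplex R q) = hull0 X.
Proof.
rewrite hull0E std_simplexE; apply/seteqP; split => [_ [c cs <-]|_ [c cs <-]].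
  by exists c => //; rewrite mulmx_sum_row.
by exists c => //; rewrite mulmx_sum_row.
Qed.

Lemma convex_hull0 q n (X : 'M[R]_(q, n)) : is_convex (hull0 X).
Proof. by rewrite hull0E; exact/convex_image_mulmx/convex_simplex. Qed.

Lemma compact_hull0 q n (X : 'M[R]_(q, n)) : compact (hull0 X).
Proof. by rewrite hull0E; exact/compact_image_mulmx/compact_simplex. Qed.

Lemma hull0_0 q n (X : 'M[R]_(q, n)) : hull0 X 0.
Proof. by move=> B [_]; apply; left. Qed.

Lemma hull0_sub q n (X : 'M[R]_(q, n)) (A : set 'rV[R]_n) :
  is_convex A -> A 0 -> (forall i, A (row i X)) -> hull0 X `<=` A.
Proof.
move=> cA A0 AX; apply: smallest_sub => // x [->//|[i _ <-]]; exact: AX.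
Qed.

Lemma hull0_mulmx q n m (X : 'M[R]_(q, n)) (G : 'M[R]_(n, m)) :
  [set x *m G | x in hull0 X] = hull0 (X *m G).
Proof.
rewrite !hull0E; apply/seteqP; split => [_ [_ [c cs <-] <-]|_ [c cs <-]].
  by exists c => //; rewrite mulmxA.
by exists (c *m X); [exists c|rewrite mulmxA].
Qed.

End convex_sets.

Section volumes.
Variable R : realType.

Lemma measure_rV_cons_swap n (A : set 'rV[R]_n.+1) : measurable A ->
  (mu n.+1 A = \int[mu n]_v leb [set t | A (rV_cons (t, v))])%E.
Proof.
move=> mA.
have mF : measurable_fun setT (fun p : measurableTypeR R * 'rV[R]_n =>
    (\1_A (rV_cons (p.1, p.2)))%:E : \bar R).
  apply: (measurableT_comp (measurable_indicE mA)).
  exact: measurable_rV_cons_fun.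
rewrite (measure_integral_indic _ mA).
rewrite (integral_rV_cons (measurable_indicE mA)); last by move=> x; rewrite lee_fin.
rewrite (@tonelli_swap _ _ _ _ R leb (mu n) (fun t v => (\1_A (rV_cons (t, v)))%:E) mF); last first.
  by move=> t v; rewrite lee_fin.
apply: eq_integral => v _.
rewrite [RHS]measure_integral_indic//.
by apply: measurable_preimageT mA; exact: measurable_rV_cons_fun.
Qed.

Definition cube n (r : R) : set 'rV[R]_n := [set x | forall i, `|x ord0 i| <= r].

Lemma cube_rV_cons n (r : R) t (v : 'rV[R]_n) :
  cube r (rV_cons (t, v)) <-> `|t| <= r /\ cube r v.
Proof.
split=> [h|[ht hv] i].
  split; first by have := h ord0; rewrite rV_cons0.
  by move=> i; have := h (lift ord0 i); rewrite rV_consS.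
by case: (unliftP ord0 i) => [j ->|->]; rewrite (rV_consS, rV_cons0)//; exact: hv.
Qed.

Lemma cube_closed n (r : R) : closed (@cube n r).
Proof.
have -> : @cube n r = \bigcap_(i in [set: 'I_n])
    (fun c : 'rV[R]_n => `|c ord0 i|) @^-1` [set x | x <= r].
  by apply/seteqP; split => x h i; [move=> _; exact: h|exact: h].
apply: closed_bigI => i _; apply: preimage_closed; last exact: closed_le.
move=> x _; apply: continuous_comp; first exact: coord_continuous.
exact: norm_continuous.
Qed.

Lemma measurable_cube n (r : R) : measurable (@cube n r).
Proof. apply: closed_measurable_rV; exact: cube_closed. Qed.

Lemma measure_cube n (r : R) : 0 <= r -> mu n (@cube n r) = ((2 * r) ^+ n)%:E.
Proof.
move=> r0; elim: n => [|n IH].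
  have mT : measurable [set: 'rV[R]_0] by [].
  rewrite (_ : cube r = setT); last first.
    by apply/seteqP; split => // x _; case.
  rewrite (measure_integral_indic _ mT) integral_rV0 ?indicT ?expr0//.
  exact: (@measurable_cst _ _ _ _ setT (1%:E : \bar R)).
have mC : measurable (@cube n.+1 r) by exact: measurable_cube.
rewrite (measure_rV_cons mC).
transitivity (\int[leb]_t ((\1_(`[- r, r]%classic) t)%:E * ((2 * r) ^+ n)%:E))%E.
  apply: eq_integral => t _; have [tr|tr] := pselect (`|t| <= r).
    rewrite indicE mem_set ?mul1e; last by rewrite /= in_itv /= -ler_norml.
    rewrite -IH; congr (mu n _); apply/seteqP; split => v /=.
      by move/cube_rV_cons => [].
    by move=> ?; apply/cube_rV_cons.
  rewrite indicE memNset ?mul0e; last by rewrite /= in_itv /= -ler_norml.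
  rewrite (_ : [set _ | _] = set0) ?measure0//.
  by rewrite -subset0 => v /= /cube_rV_cons[].
rewrite ge0_integralZr//; last by rewrite lee_fin exprn_ge0// mulr_ge0.
  rewrite integral_indic//= setIT lebesgue_measure_itv /= lte_fin.
  rewrite exprS EFinM; congr (_ * _)%E.
  case: ifPn => [_|]; first by rewrite -EFinD; congr EFin; ring.
  rewrite -leNgt => h; congr EFin; lra.
exact: measurable_indicE.
Qed.

Lemma bounded_sub_cube n (A : set 'rV[R]_n) : bounded_set A ->
  exists2 r, 0 <= r & A `<=` cube r.
Proof.
move=> [M [_ /(_ (`|M| + 1))]]; rewrite (le_lt_trans (ler_norm _)) ?ltrDl// => /(_ isT) h.
exists (`|M| + 1); first by rewrite addr_ge0.
by move=> x Ax i; exact: le_trans (coord_le_norm _ _ _) (h x Ax).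
Qed.

Lemma bounded_finite_measure n (A : set 'rV[R]_n) : measurable A ->
  bounded_set A -> (mu n A < +oo)%E.
Proof.
move=> mA /bounded_sub_cube[r r0 Ar].
apply: (@le_lt_trans _ _ (mu n (cube r))); last by rewrite measure_cube// ltry.
by apply: le_measure; rewrite ?inE//; exact: measurable_cube.
Qed.

Lemma compact_bounded_rV n (A : set 'rV[R]_n) : compact A -> bounded_set A.
Proof. exact: compact_bounded. Qed.

Lemma compact_volume n (A : set 'rV[R]_n) : compact A ->
  mu n A = (volume A)%:E.
Proof.
move=> cA; rewrite /volume fineK// ge0_fin_numE//.
apply: bounded_finite_measure; last exact: compact_bounded_rV.
exact: compact_measurable_rV.
Qed.

Lemma volume_ge0 n (A : set 'rV[R]_n) : 0 <= volume A.
Proof. by rewrite /volume fine_ge0. Qed.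

Lemma le_volume n (A B : set 'rV[R]_n) : compact A -> compact B -> A `<=` B ->
  volume A <= volume B.
Proof.
move=> cA cB AB; rewrite -lee_fin -!compact_volume//.
by apply: le_measure; rewrite ?inE//; exact: compact_measurable_rV.
Qed.

Lemma eball_closed n r : closed [set x : 'rV[R]_n | enorm x <= r].
Proof.
apply: (@preimage_closed _ _ (@enorm R n) [set x | x <= r]); last exact: closed_le.
by move=> x _; exact: enorm_continuous.
Qed.

Lemma eball_bounded n r : bounded_set [set x : 'rV[R]_n | enorm x <= r].
Proof.
exists `|r|; split; first exact: num_real.
move=> M rM x /= xr.
apply: mx_norm_le => [|i j]; first exact: le_trans (ltW rM).
rewrite ord1 (le_trans (coord_le_enorm _ _))// (le_trans xr)//.
by rewrite (le_trans (ler_norm _))// ltW.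
Qed.

Lemma compact_eballr n r : compact [set x : 'rV[R]_n | enorm x <= r].
Proof.
by apply: bounded_closed_compact; [exact: eball_bounded|exact: eball_closed].
Qed.

Lemma compact_eball n : compact (@eball R n).
Proof. exact: compact_eballr. Qed.

Lemma convex_eballr n r : is_convex [set x : 'rV[R]_n | enorm x <= r].
Proof.
apply/is_convexP => x y t /= xr yr t0 t1.
rewrite (le_trans (enorm_triangle _ _))// !enormZ ger0_norm// ger0_norm ?subr_ge0//.
have : t * enorm x <= t * r by rewrite ler_wpM2l.
have : (1 - t) * enorm y <= (1 - t) * r by rewrite ler_wpM2l// subr_ge0.
lra.
Qed.

Lemma eballrE n r : 0 < r -> [set x : 'rV[R]_n | enorm x <= r] = dilate r (@eball R n).
Proof.
move=> r0; apply/seteqP; split => x /=.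
  move=> xr; exists (r^-1 *: x).
    by rewrite /eball /= enormZ gtr0_norm ?invr_gt0// ler_pdivrMl// mulr1.
  by rewrite scalerA mulfV ?scale1r// gt_eqF.
by move=> [y yb <-]; rewrite enormZ gtr0_norm// ler_piMr// ltW.
Qed.

Lemma volume_eballr n r : 0 < r ->
  volume [set x : 'rV[R]_n | enorm x <= r] = r ^+ n * omega R n.
Proof.
move=> r0; apply: EFin_inj; rewrite -compact_volume; last exact: compact_eballr.
rewrite eballrE// (measure_dilate r0 (compact_measurable_rV (@compact_eball n))).
by rewrite compact_volume//; exact: compact_eball.
Qed.

Lemma omega_gt0 n : 0 < omega R n.
Proof.
(* The cube of half-side 1/(n+1) fits in the unit ball, the moduli of the coordinates summing to at
   most n/(n+1); with n+1 the formula also serves n = 0. *)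
pose r : R := n.+1%:R^-1.
have r0 : 0 < r by rewrite invr_gt0.
apply: (@lt_le_trans _ _ ((2 * r) ^+ n)).
  by rewrite exprn_gt0// mulr_gt0.
rewrite /omega -lee_fin -(measure_cube n (ltW r0)) -compact_volume; last exact: compact_eball.
apply: le_measure; rewrite ?inE; first exact: measurable_cube.
  apply: compact_measurable_rV; exact: compact_eball.
move=> x xr; rewrite /eball /= (le_trans (enorm_le_sum _))//.
apply: (@le_trans _ _ (\sum_(i < n) r)); first by apply: ler_sum => i _; exact: xr.
rewrite sumr_const card_ord -mulr_natl ler_pdivrMr// mul1r ler_nat.
exact: leqnSn.
Qed.

Lemma compact_itvP (A : set R) : compact A -> A !=set0 ->
  (forall x y t, A x -> A y -> 0 <= t -> t <= 1 -> A (t * x + (1 - t) * y)) ->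
  exists a b, a <= b /\ A = `[a, b]%classic.
Proof.
move=> cA A0 cvA.
have cid : {within A, continuous (@id R)}.
  by apply: continuous_subspaceT => x; exact: cvg_id.
have [a aA amin] := compact_EVT_min A0 cA cid.
have [b bA bmax] := compact_EVT_max A0 cA cid.
exists a, b; split; first exact: amin.
apply/seteqP; split => x /=.
  by move=> Ax; rewrite in_itv /= amin ?bmax ?inE.
rewrite in_itv /= => /andP[ax xb].
rewrite !inE in aA bA.
have [ab|ab] := eqVneq a b.
  by rewrite (_ : x = a)//; apply/eqP; rewrite eq_le ax andbT ab.
have ab0 : 0 < b - a by rewrite subr_gt0 lt_neqAle ab (le_trans ax xb).
pose t := (b - x) / (b - a).
rewrite (_ : x = t * a + (1 - t) * b).
  apply: cvA => //; rewrite /t; first by rewrite divr_ge0 ?subr_ge0// (le_trans ax).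
  by rewrite ler_pdivrMr// mul1r lerD2l lerN2.
rewrite /t; field; exact: lt0r_neq0.
Qed.

Lemma volume_orthogonal n (Q : 'M[R]_n) (A : set 'rV[R]_n) : is_orthogonal Q ->
  measurable A -> mu n [set x *m Q | x in A] = mu n A.
Proof.
move=> oQ mA.
have oQt := orthogonal_tr oQ.
rewrite [RHS](measure_preimage_linear (orthogonal_unit oQt) mA) orthogonal_det// mul1e.
congr (mu n _); apply/seteqP; split => [_ [x Ax <-]|x Ax] /=.
  by rewrite -mulmxA oQ mulmx1.
by exists (x *m Q^T) => //; rewrite -mulmxA (mulmx1C oQ) mulmx1.
Qed.

End volumes.

Section measurable_sections.
Local Open Scope ereal_scope.
Context d1 d2 (T1 : measurableType d1) (T2 : measurableType d2) (R : realType).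

Lemma measurable_measure_section1 (m2 : {sigma_finite_measure set T2 -> \bar R})
    (B : set (T1 * T2)) : measurable B ->
  measurable_fun setT (fun x => m2 [set y | B (x, y)]).
Proof.
move=> mB; have := measurable_integral1 m2 (F := fun x y => (\1_B (x, y))%:E).
move=> h; rewrite (_ : (fun x => _) = (fun x => \int[m2]_y (\1_B (x, y))%:E)).
  apply: h => [|x y]; last by rewrite lee_fin.
  rewrite (_ : (fun p => _) = (fun p => (\1_B p)%:E)); first exact: measurable_indicE.
  by apply/funext => -[].
apply/funext => x; rewrite measure_integral_indic//.
by apply: (measurable_preimageT _ mB); exact: pair1_measurable.
Qed.

Lemma measurable_measure_section2 (m1 : {sigma_finite_measure set T1 -> \bar R})
    (B : set (T1 * T2)) : measurable B ->
  measurable_fun setT (fun y => m1 [set x | B (x, y)]).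
Proof.
move=> mB; have := measurable_integral2 m1 (F := fun x y => (\1_B (x, y))%:E).
move=> h; rewrite (_ : (fun x => _) = (fun y => \int[m1]_x (\1_B (x, y))%:E)).
  apply: h => [|x y]; last by rewrite lee_fin.
  rewrite (_ : (fun p => _) = (fun p => (\1_B p)%:E)); first exact: measurable_indicE.
  by apply/funext => -[].
apply/funext => x; rewrite measure_integral_indic//.
by apply: (measurable_preimageT _ mB); exact: pair2_measurable.
Qed.

End measurable_sections.

(** * Volume of a sum with segments *)

Section segments.
Variable R : realType.

Definition add_segment n (A : set 'rV[R]_n) (v : 'rV[R]_n) : set 'rV[R]_n :=
  [set y | exists a t, [/\ A a, `|t| <= 1 & y = a + t *: v]].

Lemma add_segment0 n (A : set 'rV[R]_n) : add_segment A 0 = A.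
Proof.
apply/seteqP; split => [y [a [t [Aa _ ->]]]|y Ay].
  by rewrite scaler0 addr0.
by exists y, 0; rewrite normr0 scaler0 addr0.
Qed.

Lemma add_segment_mulmx n m (G : 'M[R]_(n, m)) (A : set 'rV[R]_n) v :
  [set x *m G | x in add_segment A v] =
  add_segment [set x *m G | x in A] (v *m G).
Proof.
apply/seteqP; split => [_ [_ [a [t [Aa t1 ->]]] <-]|_ [_ [t [[a Aa <-] t1 ->]]]].
  by exists (a *m G), t; split => //; [exists a|rewrite mulmxDl scalemxAl].
by exists (a + t *: v); [exists a, t|rewrite mulmxDl scalemxAl].
Qed.

Lemma convex_add_segment n (A : set 'rV[R]_n) v :
  is_convex A -> is_convex (add_segment A v).
Proof.
move=> /is_convexP cA; apply/is_convexP.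
move=> _ _ t [a [s [Aa s1 ->]]] [b [r [Ab r1 ->]]] t0 t1.
exists (t *: a + (1 - t) *: b), (t * s + (1 - t) * r); split.
- exact: cA.
- rewrite (le_trans (ler_normD _ _))// !normrM (ger0_norm t0) [`|1 - t|]ger0_norm ?subr_ge0//.
  have : t * `|s| <= t by rewrite ler_piMr.
  have : (1 - t) * `|r| <= 1 - t by rewrite ler_piMr// subr_ge0.
  lra.
- by rewrite !scalerDr (scalerDl v (t * s)) !scalerA addrACA.
Qed.

Lemma compact_sum_image m n (A B : set 'rV[R]_n) : compact A -> compact B ->
  forall (f : 'rV[R]_n * 'rV[R]_n -> 'rV[R]_m), continuous f ->
  compact [set f (a, b) | a in A & b in B].
Proof.
move=> cA cB f cf.
have -> : [set f (a, b) | a in A & b in B] = f @` (A `*` B).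
  apply/seteqP; split => [_ [a Aa [b Bb <-]]|_ [[a b] [/= Aa Bb] <-]].
    by exists (a, b).
  by exists a => //; exists b.
apply: continuous_compact; first exact: continuous_subspaceT.
exact: compact_setX.
Qed.

Lemma compact_minkowski_sum n (A B : set 'rV[R]_n) :
  compact A -> compact B -> compact (minkowski_sum A B).
Proof.
move=> cA cB; apply: (compact_sum_image cA cB (f := fun p => p.1 + p.2)).
exact: add_continuous.
Qed.

Lemma compact_dilate n l (A : set 'rV[R]_n) : compact A -> compact (dilate l A).
Proof.
move=> cA; apply: (@continuous_compact _ _ (fun x : 'rV[R]_n => l *: x)) => //.
apply: continuous_subspaceT => x; exact: scaler_continuous.
Qed.

Definition segment n (v : 'rV[R]_n) : set 'rV[R]_n :=
  [set t *: v | t in `[-1, 1]%classic].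

Lemma compact_segment n (v : 'rV[R]_n) : compact (segment v).
Proof.
apply: (@continuous_compact _ _ (fun t : R => t *: v)); last exact: segment_compact.
by apply: continuous_subspaceT => x; exact: scalel_continuous.
Qed.

Lemma add_segmentE n (A : set 'rV[R]_n) v :
  add_segment A v = minkowski_sum A (segment v).
Proof.
apply/seteqP; split => [_ [a [t [Aa t1 ->]]]|_ [a Aa [_ [t tI <-] <-]]].
  exists a => //; exists (t *: v) => //; exists t => //=.
  by rewrite in_itv /= -ler_norml.
by exists a, t; split => //; rewrite ler_norml; move: tI; rewrite /= in_itv.
Qed.

Lemma compact_add_segment n (A : set 'rV[R]_n) v :
  compact A -> compact (add_segment A v).
Proof.
move=> cA; rewrite add_segmentE; apply: compact_minkowski_sum => //.
exact: compact_segment.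
Qed.

(** Forgets coordinate 0. As a matrix it composes with a rotation into the projection along an
    arbitrary vector. *)
Definition drop_mx n : 'M[R]_(n.+1, n) := \matrix_(i, j) (i == lift ord0 j)%:R.

Lemma rV_cons_drop n (p : measurableTypeR R * 'rV[R]_n) :
  rV_cons p *m drop_mx n = p.2.
Proof.
apply/rowP => i; rewrite mxE (bigD1 (lift ord0 i))//= [drop_mx _ _ _]mxE eqxx mulr1 rV_consS.
by rewrite big1 ?addr0// => j ji; rewrite [drop_mx _ _ _]mxE (negbTE ji) mulr0.
Qed.

Lemma rV_uncons_drop n (x : 'rV[R]_n.+1) :
  x = rV_cons (x ord0 ord0, x *m drop_mx n).
Proof.
by rewrite -{1}[x]rV_unconsK -{3}[x]rV_unconsK rV_cons_drop.
Qed.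

Lemma compact_section n (A : set 'rV[R]_n.+1) (v : 'rV[R]_n) : compact A ->
  compact [set t : R | A (rV_cons (t, v))].
Proof.
move=> cA.
rewrite (_ : [set t | _] = (fun x : 'rV[R]_n.+1 => x ord0 ord0) @`
    (A `&` [set x | x *m drop_mx n = v])).
  apply: continuous_compact.
    by apply: continuous_subspaceT => x; exact: coord_continuous.
  apply: compact_closedI => //.
  apply: (@preimage_closed _ _ (fun x : 'rV[R]_n.+1 => x *m drop_mx n) [set v]).
    by move=> x _; exact: continuous_mulmxr.
  apply: compact_closed_mx; exact: compact_set1.
apply/seteqP; split => [t At|_ [x [Ax xv] <-]] /=.
  by exists (rV_cons (t, v)); rewrite ?rV_cons0//; split => //=; rewrite rV_cons_drop.
by rewrite -xv -rV_uncons_drop.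
Qed.

Lemma convex_section n (A : set 'rV[R]_n.+1) (v : 'rV[R]_n) x y t :
  is_convex A -> A (rV_cons (x, v)) -> A (rV_cons (y, v)) -> 0 <= t -> t <= 1 ->
  A (rV_cons (t * x + (1 - t) * y, v)).
Proof.
move=> /is_convexP cA Ax Ay t0 t1.
have := cA _ _ t Ax Ay t0 t1; rewrite !rV_consZ rV_consD.
have -> : t *: v + (1 - t) *: v = v by rewrite -scalerDl addrC subrK scale1r.
exact.
Qed.

(** Cut by the lines parallel to e_0: a nonempty section of [A] is a compact interval and grows by l
    at both ends, an empty one stays empty, and the nonempty ones are indexed by the projection of
    [A]. *)
Lemma measure_add_segment_e0 n (A : set 'rV[R]_n.+1) (l : R) :
  compact A -> is_convex A -> 0 <= l ->
  (mu n.+1 (add_segment A (l *: delta_mx ord0 ord0)) =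
   mu n.+1 A + (2 * l)%:E * mu n [set x *m drop_mx n | x in A])%E.
Proof.
move=> cA vA l0.
have cP : compact [set x *m drop_mx n | x in A] by exact: compact_image_mulmx.
have mP := compact_measurable_rV cP.
have mA := compact_measurable_rV cA.
have mS := compact_measurable_rV (compact_add_segment (v := l *: delta_mx ord0 ord0) cA).
rewrite (measure_rV_cons_swap mS) (measure_rV_cons_swap mA).
have ml2 : (0 <= (2 * l)%:E)%E by rewrite lee_fin mulr_ge0.
rewrite (measure_integral_indic _ mP).
rewrite -(ge0_integralZl _ measurableT (measurable_indicE mP))//.
rewrite -ge0_integralD//; last 3 first.
- apply: (@measurable_measure_section2 _ _ _ _ R leb (@rV_cons R n @^-1` A)).
  exact: measurable_preimageT (@measurable_rV_cons R n) mA.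
- by move=> v _; rewrite mule_ge0// lee_fin.
- by apply: emeasurable_funM => //; exact: measurable_indicE.
apply: eq_integral => v _.
have e0 : l *: delta_mx ord0 ord0 = rV_cons (l, (0 : 'rV[R]_n)) :> 'rV_n.+1.
  apply: rV_consP => [|i]; rewrite (rV_cons0, rV_consS) !mxE//= ?eqxx ?mulr1//.
  by rewrite mulr0.
have secE s : add_segment A (l *: delta_mx ord0 ord0) (rV_cons (s, v)) <->
    exists2 t : R, `|t| <= l & A (rV_cons (s + t, v)).
  rewrite e0; split => [[a [t [Aa t1 E]]]|[t tl At]].
    have E' : a = rV_cons (s + - (t * l), v).
      rewrite (_ : rV_cons (s + - (t * l), v) = rV_cons (s, v) + rV_cons (- (t * l), 0)).
        rewrite E (_ : rV_cons (- (t * l), _) = - (t *: rV_cons (l, (0 : 'rV[R]_n)))).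
          by rewrite addrK.
        by rewrite -[RHS]scaleNr rV_consZ scaler0 mulNr.
      by rewrite rV_consD addr0.
    exists (- (t * l)); last by rewrite -E'.
    by rewrite normrN normrM (ger0_norm l0) ler_piMl.
  (* The witness - (t / l) used afterwards is meaningless for l = 0, where the segment is a
     point. *)
  have [l00|l00] := eqVneq l 0.
    exists (rV_cons (s, v)), 0; split => //.
      move: At; rewrite (_ : t = 0) ?addr0//; apply/eqP.
      by rewrite -normr_le0 -l00.
      by rewrite normr0.
    by rewrite scale0r addr0.
  exists (rV_cons (s + t, v)), (- (t / l)); split => //.
    rewrite normrN normrM normfV (ger0_norm l0) ler_pdivrMr ?mul1r//.
    by rewrite lt_neqAle eq_sym l00.
  by rewrite rV_consZ rV_consD scaler0 addr0 mulNr divfK// addrK.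
have [Pv|Pv] := pselect ([set x *m drop_mx n | x in A] v); last first.
  rewrite indicE memNset// mule0 adde0; congr (leb _).
  have N s : ~ A (rV_cons (s, v)).
    by move=> As; apply: Pv; exists (rV_cons (s, v)); rewrite ?rV_cons_drop.
  apply/seteqP; split => s /=; last by move/N.
  by move/secE => [t _ /N].
rewrite indicE mem_set// mule1.
have [a [b [ab sE]]] : exists a b, a <= b /\
    [set t : R | A (rV_cons (t, v))] = `[a, b]%classic.
  apply: compact_itvP; first exact: compact_section.
    case: Pv => x Ax xv; exists (x ord0 ord0) => /=.
    by rewrite -xv -rV_uncons_drop.
  by move=> x y t /=; exact: convex_section.
have -> : [set s : R | add_segment A (l *: delta_mx ord0 ord0) (rV_cons (s, v))] =
    `[a - l, b + l]%classic.
  have sE' s : A (rV_cons (s, v)) <-> (a <= s <= b).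
    by have /seteqP[h1 h2] := sE; split; [move/h1|move=> ?; apply: h2]; rewrite /= in_itv.
  apply/seteqP; split => s /=; rewrite in_itv /=.
    move/secE => [t]; rewrite ler_norml => /andP[t1 t2] /sE' /andP[s1 s2].
    by apply/andP; split; lra.
  move=> /andP[s1 s2]; apply/secE.
  have [sa|sa] := ltP s a.
    exists (a - s); first by rewrite ger0_norm; lra.
    by apply/sE'; rewrite addrC subrK lexx.
  have [sb|sb] := ltP b s.
    exists (b - s); first by rewrite ltr0_norm; lra.
    by apply/sE'; rewrite addrC subrK lexx andbT.
  exists 0; first by rewrite normr0.
  by apply/sE'; rewrite addr0 sa sb.
rewrite sE.
rewrite !lebesgue_measure_itv /= !lte_fin.
have [ab1|ab1] := ltP a b; have [ab2|ab2] := ltP (a - l) (b + l);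
  rewrite -?EFinD ?add0e; congr EFin; lra.
Qed.

Lemma image_mulmx_comp n m p (G : 'M[R]_(n, m)) (H : 'M[R]_(m, p)) (A : set 'rV[R]_n) :
  [set x *m H | x in [set y *m G | y in A]] = [set x *m (G *m H) | x in A].
Proof.
apply/seteqP; split => [_ [_ [x Ax <-] <-]|_ [x Ax <-]].
  by exists x => //; rewrite mulmxA.
by exists (x *m G); [exists x|rewrite mulmxA].
Qed.

Lemma image_mulmx1 n (A : set 'rV[R]_n) : [set x *m 1%:M | x in A] = A.
Proof.
by apply/seteqP; split => [_ [x Ax <-]|x Ax]; [rewrite mulmx1|exists x; rewrite ?mulmx1].
Qed.

(** A Householder reflection turns [v] into the direction e_0; [G] is the resulting projection along
    [v], the same for all [A] and l. The factor 2 l |v| is the length of the segment from - l v to l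
    v. *)
Lemma volume_add_segment n (v : 'rV[R]_n.+1) : exists G : 'M[R]_(n.+1, n),
  forall A l, compact A -> is_convex A -> 0 <= l ->
  volume (add_segment A (l *: v)) =
    volume A + 2 * l * enorm v * volume [set x *m G | x in A].
Proof.
have [Q [oQ vQ]] := householder v.
exists (Q *m drop_mx n) => A l cA vA l0.
have cAQ : compact [set x *m Q | x in A] by exact: compact_image_mulmx.
have vAQ : is_convex [set x *m Q | x in A] by exact: convex_image_mulmx.
have cS := compact_add_segment (v := l *: v) cA.
have cP : compact [set x *m (Q *m drop_mx n) | x in A] by exact: compact_image_mulmx.
have lv0 : 0 <= l * enorm v by rewrite mulr_ge0 ?enorm_ge0.
apply: EFin_inj; rewrite EFinD EFinM -!compact_volume//.
rewrite -(volume_orthogonal oQ (compact_measurable_rV cS)).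
rewrite add_segment_mulmx -scalemxAl vQ scalerA.
rewrite (measure_add_segment_e0 cAQ vAQ lv0) image_mulmx_comp mulrA.
by rewrite (volume_orthogonal oQ (compact_measurable_rV cA)).
Qed.

Definition add_segments n (A : set 'rV[R]_n) (s : seq 'rV[R]_n) : set 'rV[R]_n :=
  foldr (fun v B => add_segment B v) A s.

Lemma compact_add_segments n (A : set 'rV[R]_n) s :
  compact A -> compact (add_segments A s).
Proof. by move=> cA; elim: s => //= v s IH; exact: compact_add_segment. Qed.

Lemma convex_add_segments n (A : set 'rV[R]_n) s :
  is_convex A -> is_convex (add_segments A s).
Proof. by move=> cA; elim: s => //= v s IH; exact: convex_add_segment. Qed.

Lemma add_segments_mulmx n m (G : 'M[R]_(n, m)) (A : set 'rV[R]_n) s :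
  [set x *m G | x in add_segments A s] =
  add_segments [set x *m G | x in A] [seq v *m G | v <- s].
Proof. by elim: s => //= v s <-; rewrite add_segment_mulmx. Qed.

(* The projection terms [p.2] depend on the segments only, not on [A]. *)
Lemma volume_add_segments n (s : seq 'rV[R]_n) :
  exists Gs : forall m, seq (R * 'M[R]_(n, m)),
    (forall m p, p \in Gs m -> 0 <= p.1) /\
    forall A l, compact A -> is_convex A -> 0 <= l ->
    volume (add_segments A [seq l *: v | v <- s]) =
    \sum_(m < n.+1) l ^+ (n - m) *
      \sum_(p <- Gs m) p.1 * volume [set x *m p.2 | x in A].
Proof.
move: {2}(size s) (erefl (size s)) => k.
elim: k n s => [n [|//] _|k IH n [//|v s] /= [sk]].
  (* [pid_mx n] is the identity for m = n while being typed for every m. *)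
  exists (fun m => if m == n then [:: (1, pid_mx n)] else [::]); split.
    by move=> m p; case: ifP => // _; rewrite inE => /eqP ->.
  move=> A l cA vA l0 /=; rewrite (bigD1 ord_max)//= eqxx subnn expr0 mul1r.
  rewrite big_seq1 /= mul1r pid_mx_1 image_mulmx1 big1 ?addr0// => i iM.
  rewrite ifF ?big_nil ?mulr0//; apply: contraNF iM => /eqP iE.
  by apply/eqP/val_inj.
case: n v s sk => [|n] v s sk.
  have [Gs [G0 GE]] := IH 0%N s sk; exists Gs; split => // A l cA vA l0.
  rewrite -GE//= (_ : l *: v = 0) ?add_segment0//.
  by apply/rowP; case.
have [G GE] := volume_add_segment v.
have [Gs1 [Gs10 Gs1E]] := IH n.+1 s sk.
have [Gs2 [Gs20 Gs2E]] := IH n [seq w *m G | w <- s] (etrans (size_map _ _) sk).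
(* The terms of the projected sum in R^n reappear in R^(n+1) with one more factor l, which the
   exponent n + 1 - m supplies; the length of the new segment enters the weight. *)
exists (fun m => Gs1 m ++ if (m <= n)%N then
  [seq (2 * enorm v * p.1, G *m p.2) | p <- Gs2 m] else [::]); split.
  move=> m p; rewrite mem_cat => /orP[/Gs10//|]; case: ifP => // _.
  by move=> /mapP[q /Gs20 q0 ->] /=; rewrite !mulr_ge0 ?enorm_ge0.
move=> A l cA vA l0 /=.
rewrite GE//; [|exact: compact_add_segments|exact: convex_add_segments].
rewrite add_segments_mulmx -map_comp.
rewrite (eq_map (g := (fun w => l *: w) \o (fun w => w *m G))); last first.
  by move=> w /=; rewrite scalemxAl.
rewrite map_comp Gs1E// Gs2E//; [|exact: compact_image_mulmx|exact: convex_image_mulmx].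
under [RHS]eq_bigr do rewrite big_cat mulrDr.
rewrite big_split /=; congr (_ + _).
rewrite [RHS]big_ord_recr /= ltnn big_nil mulr0 addr0 mulr_sumr.
apply: eq_bigr => i _; rewrite -ltnS ltn_ord big_map /=.
have iN : (i <= n)%N by rewrite -ltnS.
rewrite (subSn iN) exprS !mulr_sumr; apply: eq_bigr => p _.
by rewrite image_mulmx_comp; ring.
Qed.

End segments.

(** * Zonotope approximation of the ball *)

Section zonotopes.
Variable R : realType.

Lemma measurable_dot d (T : measurableType d) n (f g : T -> 'rV[R]_n) :
  measurable_fun setT f -> measurable_fun setT g ->
  measurable_fun setT (fun t => dot (f t) (g t)).
Proof.
move=> mf mg; apply: measurable_sum => i.
by apply: measurable_funM; exact: measurable_rV_coord_fun.
Qed.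

(** By rotation invariance the integral of |u . v| over the ball is this number times |u|. Up to a
    dimensional factor it is the mean width of a unit segment. *)
Definition mean_width n : R := fine (\int[mu n.+1]_(v in @eball R n.+1) (`|v ord0 ord0|)%:E)%E.

Lemma eball_orthogonal n (Q : 'M[R]_n) x : is_orthogonal Q ->
  eball (x *m Q) = @eball R n x.
Proof. by move=> oQ; rewrite /eball /= orthogonal_enorm. Qed.

Lemma measurable_eball n : measurable (@eball R n).
Proof. by apply: compact_measurable_rV; exact: compact_eball. Qed.

Lemma measurable_EFin_normr_dot n (u : 'rV[R]_n) :
  measurable_fun setT (fun v : 'rV[R]_n => (`|dot u v|)%:E).
Proof.
apply/measurable_EFinP; apply: measurableT_comp => //.
by apply: measurable_dot => //; exact: measurable_cst.
Qed.

Lemma normr_dot_le n (x y : 'rV[R]_n) : `|dot x y| <= enorm x * enorm y.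
Proof.
rewrite ler_norml dot_le_enorm andbT lerNl -dotNl -(enormN x).
exact: dot_le_enorm.
Qed.

Lemma dot_delta n (v : 'rV[R]_n) i : dot (delta_mx ord0 i) v = v ord0 i.
Proof.
rewrite /dot (bigD1 i)//= mxE !eqxx mul1r big1 ?addr0// => j ji.
by rewrite mxE (negbTE ji) andbF mul0r.
Qed.

Lemma integral_eball_dot_fin n (u : 'rV[R]_n) :
  (\int[mu n]_(v in @eball R n) (`|dot u v|)%:E < +oo)%E.
Proof.
apply: (@le_lt_trans _ _ (\int[mu n]_(v in @eball R n) (cst (enorm u)%:E v))%E).
  apply: ge0_le_integral => //.
  - exact: measurable_eball.
  - apply: measurable_funTS; exact: measurable_EFin_normr_dot.
  - move=> v vB /=; rewrite lee_fin -(mulr1 (enorm u)).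
    by rewrite (le_trans (normr_dot_le _ _))// ler_wpM2l ?enorm_ge0.
rewrite integral_cst; last exact: measurable_eball.
rewrite lte_mul_pinfty ?lee_fin ?enorm_ge0//.
by apply: bounded_finite_measure; [exact: measurable_eball|exact: eball_bounded].
Qed.

Lemma integral_eball_dot n (u : 'rV[R]_n.+1) :
  (\int[mu n.+1]_(v in @eball R n.+1) (`|dot u v|)%:E = (enorm u * mean_width n)%:E)%E.
Proof.
have [Q [oQ uQ]] := householder u.
have oQt := orthogonal_tr oQ.
have fin := @integral_eball_dot_fin n.+1 (delta_mx ord0 ord0).
rewrite integral_mkcond.
have mB := @measurable_eball n.+1.
have mF : measurable_fun setT
    ((fun v : 'rV[R]_n.+1 => (`|dot u v|)%:E) \_ (@eball R n.+1)).
  by apply: (measurable_restrictT _ mB).1; apply: measurable_funTS; exact: measurable_EFin_normr_dot.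
rewrite (det_scaling_unit (orthogonal_unit oQt) mF); last first.
  by move=> x; apply: erestrict_ge0 => y _; rewrite lee_fin.
rewrite orthogonal_det// mul1e.
have E x : ((fun v : 'rV[R]_n.+1 => (`|dot u v|)%:E) \_ (@eball R n.+1)) (x *m Q^T) =
   ((enorm u)%:E * ((fun v : 'rV[R]_n.+1 => (`|v ord0 ord0|)%:E) \_ (@eball R n.+1)) x)%E.
  rewrite !patchE.
  have -> : (x *m Q^T \in @eball R n.+1) = (x \in @eball R n.+1).
    by apply/idP/idP; rewrite !inE eball_orthogonal.
  case: ifP => _; last by rewrite mule0.
  rewrite -(orthogonal_dot _ _ oQ) -mulmxA (mulmx1C oQ) mulmx1 uQ dotZl dot_delta.
  by rewrite normrM ger0_norm ?enorm_ge0.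
under eq_integral do rewrite E.
rewrite ge0_integralZl//.
- rewrite -integral_mkcond EFinM; congr (_ * _)%E.
  rewrite /mean_width fineK// ge0_fin_numE; last by apply: integral_ge0 => x _; rewrite lee_fin.
  move: fin; under eq_integral do rewrite dot_delta; exact.
- apply: (measurable_restrictT _ mB).1; apply: measurable_funTS.
  have := @measurable_EFin_normr_dot n.+1 (delta_mx ord0 ord0).
  by under eq_fun do rewrite dot_delta.
- by move=> x _; apply: erestrict_ge0 => y _; rewrite lee_fin.
- by rewrite lee_fin enorm_ge0.
Qed.

Lemma mean_width_gt0 n : 0 < mean_width n.
Proof.
pose r : R := n.+2%:R^-1.
have r0 : 0 < r by rewrite invr_gt0.
(* The cube of half-side r/4 about (3/4) r e_0 lies in the ball, and |v_0| >= r/2 on it. *)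
pose c : 'rV[R]_n.+1 := (3 / 4 * r) *: delta_mx ord0 ord0.
pose D := [set v : 'rV[R]_n.+1 | cube (r / 4) (v + - c)].
have mD : measurable D.
  have mt : measurable_fun setT (fun v : 'rV[R]_n.+1 => v + - c).
    by apply: measurable_addmx => //; exact: measurable_cst.
  exact: (measurable_preimageT mt (measurable_cube _)).
have r4 : 0 <= r / 4 by rewrite divr_ge0// ltW.
have muD : mu n.+1 D = ((2 * (r / 4)) ^+ n.+1)%:E.
  by rewrite measure_preimage_translate ?measure_cube//; exact: measurable_cube.
have DB : D `<=` @eball R n.+1.
  move=> v vD; rewrite /eball /= (le_trans (enorm_le_sum _))//.
  apply: (@le_trans _ _ (\sum_(i < n.+1) r)).
    apply: ler_sum => i _; have := vD i; rewrite !mxE eqxx /= !ler_norml.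
    case: (i == ord0) => /= /andP[h1 h2]; apply/andP; split; lra.
  rewrite sumr_const card_ord -mulr_natl ler_pdivrMr// mul1r ler_nat.
  exact: leqnSn.
have Dr v : D v -> r / 2 <= `|v ord0 ord0|.
  move=> vD; have := vD ord0; rewrite !mxE !eqxx /= ler_norml => /andP[h1 h2].
  rewrite (le_trans _ (ler_norm _))//; lra.
have mv : measurable_fun setT (fun v : 'rV[R]_n.+1 => (`|v ord0 ord0|)%:E).
  have := @measurable_EFin_normr_dot n.+1 (delta_mx ord0 ord0).
  by under eq_fun do rewrite dot_delta.
rewrite -lte_fin /mean_width fineK; last first.
  rewrite ge0_fin_numE; last by apply: integral_ge0 => x _; rewrite lee_fin.
  have := @integral_eball_dot_fin n.+1 (delta_mx ord0 ord0).
  by under eq_integral do rewrite dot_delta.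
apply: (@lt_le_trans _ _ (\int[mu n.+1]_(v in D) (cst (r / 2)%:E v))%E).
  rewrite integral_cst// mule_gt0// ?lte_fin ?divr_gt0//.
  have : (0 < mu n.+1 D)%E by rewrite muD lte_fin exprn_gt0// mulr_gt0// divr_gt0.
  exact.
apply: (@le_trans _ _ (\int[mu n.+1]_(v in D) (`|v ord0 ord0|)%:E)%E).
  apply: ge0_le_integral => //.
  - by move=> x _; rewrite lee_fin divr_ge0// ltW.
  - exact: measurable_funTS mv.
apply: ge0_subset_integral => //; first exact: measurable_eball.
exact: measurable_funTS mv.
Qed.

Lemma bounded_setS n (A B : set 'rV[R]_n) : A `<=` B -> bounded_set B -> bounded_set A.
Proof.
by move=> AB [M [Mr MP]]; exists M; split => // x /MP xP y /AB; exact: xP.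
Qed.

(* Lower-left corner of the cell of side 1/M indexed by k in a subdivision of
   [-1, 1 + 1/M]^n. *)
Definition corner n M (k : {ffun 'I_n -> 'I_(2 * M).+1}) : 'rV[R]_n :=
  \row_i ((k i)%:R / M%:R - 1).

(** Half-open boxes, so that distinct cells are disjoint; the last index 2 M takes the points with a
    coordinate equal to 1. *)
Definition cell n M (k : {ffun 'I_n -> 'I_(2 * M).+1}) : set 'rV[R]_n :=
  @eball R n `&` [set v | forall i, corner k ord0 i <= v ord0 i < corner k ord0 i + M%:R^-1].

Lemma measurable_cell n M (k : {ffun 'I_n -> 'I_(2 * M).+1}) : measurable (cell k).
Proof.
apply: measurableI; first exact: measurable_eball.
rewrite [X in measurable X](_ : _ =
  \bigcap_(i in [set: 'I_n]) (fun v : 'rV[R]_n => v ord0 i) @^-1`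
     `[corner k ord0 i, corner k ord0 i + M%:R^-1[%classic); last first.
  apply/seteqP; split => v h i => [_|].
    by rewrite /= in_itv /=; exact: h.
  by have := h i Logic.I; rewrite /= in_itv.
apply: fin_bigcap_measurable => // i _.
rewrite -[X in measurable X]setTI; exact: measurable_rV_coord.
Qed.

Lemma cell_exists n M (v : 'rV[R]_n) : (0 < M)%N -> @eball R n v ->
  exists k : {ffun 'I_n -> 'I_(2 * M).+1}, cell k v.
Proof.
move=> M0 vB.
have MR : (0 : R) < M%:R by rewrite ltr0n.
have vi i : 0 <= M%:R * (v ord0 i + 1) <= (2 * M)%:R.
  have := le_trans (coord_le_enorm v i) vB; rewrite ler_norml => /andP[v1 v2].
  rewrite mulr_ge0 ?ler0n//=; last by rewrite -lerBlDr sub0r.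
  by rewrite mulnC natrM ler_wpM2l ?ler0n//; lra.
exists [ffun i => inord (Num.truncn (M%:R * (v ord0 i + 1)))]; split => // i.
have /andP[v1 v2] := vi i.
have /andP[t1 t2] := truncn_itv v1.
rewrite mxE ffunE inordK; last by rewrite ltnS -(ler_nat R) (le_trans t1).
set T := Num.truncn _ in t1 t2 *.
have h1 : T%:R / M%:R <= v ord0 i + 1 by rewrite ler_pdivrMr// mulrC.
have h2 : v ord0 i + 1 < T%:R / M%:R + M%:R^-1.
  rewrite -(ltr_pM2l MR) (_ : M%:R * (T%:R / M%:R + M%:R^-1) = T.+1%:R)//.
  by rewrite -natr1; field; rewrite gt_eqF.
apply/andP; split; lra.
Qed.

Lemma cell_unique n M (v : 'rV[R]_n) (k l : {ffun 'I_n -> 'I_(2 * M).+1}) :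
  (0 < M)%N -> cell k v -> cell l v -> k = l.
Proof.
move=> M0 [_ kv] [_ lv]; apply/ffunP => i; apply/val_inj/eqP.
have MR : (0 : R) < M%:R by rewrite ltr0n.
have le (a b : nat) : a%:R / M%:R - 1 <= v ord0 i < a%:R / M%:R - 1 + M%:R^-1 ->
    b%:R / M%:R - 1 <= v ord0 i < b%:R / M%:R - 1 + M%:R^-1 -> (a <= b)%N.
  move=> /andP[a1 a2] /andP[b1 b2].
  have : a%:R / M%:R < (b%:R / M%:R + M%:R^-1 : R) by lra.
  by rewrite -[X in _ + X]mul1r -mulrDl ltr_pM2r ?invr_gt0// natr1 ltr_nat ltnS.
by have := kv i; have := lv i; rewrite !mxE => h1 h2; rewrite eqn_leq !le.
Qed.

Lemma cell_corner n M (v : 'rV[R]_n) (k : {ffun 'I_n -> 'I_(2 * M).+1}) :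
  cell k v -> enorm (v - corner k) <= n%:R / M%:R.
Proof.
move=> [_ kv]; rewrite (le_trans (enorm_le_sum _))//.
apply: (@le_trans _ _ (\sum_(i < n) M%:R^-1)); last by rewrite sumr_const card_ord mulr_natl.
apply: ler_sum => i _; have /andP[k1 k2] := kv i.
rewrite [X in `|X|]mxE [X in _ + X]mxE ger0_norm; lra.
Qed.

(** The sum is the support function at [u] of the zonotope spanned by [s]. The vectors are grid
    corners weighted by cell volumes, which gives a Riemann sum for the integral of |u . v| over the
    ball, a multiple of |u|. The error is also proportional to |u|, so one mesh serves all
    directions. *)
Lemma zonotope_support n (e : R) : 0 < e -> exists s : seq 'rV[R]_n.+1,
  forall u, enorm u <= \sum_(v <- s) `|dot u v| <= (1 + e) * enorm u.
Proof.
move=> e0.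
set k0 := mean_width n; have k00 : 0 < k0 := mean_width_gt0 n.
set w := omega R n.+1; have w0 : 0 < w := @omega_gt0 R n.+1.
(* the relative error of the Riemann sum is n.+1 * w / (M * k0) *)
have [M M0 Md] : exists2 M, (0 < M)%N & n.+1%:R / M%:R * w <= k0 * (e / (2 + e)).
  have c0 : 0 < k0 * (e / (2 + e)) / (n.+1%:R * w).
    by rewrite divr_gt0// mulr_gt0// divr_gt0// addr_gt0.
  have [M _ MP] := near_infty_natSinv_lt (PosNum c0).
  exists M.+1 => //; have := MP M (leqnn _); rewrite /= ltr_pdivlMr ?mulr_gt0//.
  by move/ltW; rewrite (_ : n.+1%:R / M.+1%:R * w = M.+1%:R^-1 * (n.+1%:R * w)) //; ring.
set d := n.+1%:R / M%:R in Md.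
have d0 : 0 <= d by rewrite divr_ge0 ?ler0n.
pose K := {ffun 'I_n.+1 -> 'I_(2 * M).+1}.
pose A (u : 'rV[R]_n.+1) := \sum_(k : K) volume (cell k) * `|dot u (corner k)|.
have fincell (k : K) : mu n.+1 (cell k) = (volume (cell k))%:E.
  rewrite /volume fineK// ge0_fin_numE//.
  apply: bounded_finite_measure; first exact: measurable_cell.
  by apply: bounded_setS (@eball_bounded R n.+1 1); exact: subIsetl.
(* The step function with integral [A u]; it replaces v by the corner of its cell. *)
pose g (u : 'rV[R]_n.+1) v := (\sum_(k : K) `|dot u (corner k)|%:E * (\1_(cell k) v)%:E)%E.
have mterm u (k : K) : measurable_fun setT
    (fun v => `|dot u (corner k)|%:E * (\1_(cell k) v)%:E)%E.
  by apply: emeasurable_funM => //; apply: measurable_indicE; exact: measurable_cell.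
have gA u : (\int[mu n.+1]_v g u v = (A u)%:E)%E.
  rewrite ge0_integral_sum//.
    rewrite /A -sumEFin; apply: eq_bigr => k _.
    rewrite ge0_integralZl//; last by apply: measurable_indicE; exact: measurable_cell.
    have -> : (\int[mu n.+1]_x (\1_(cell k) x)%:E = (volume (cell k))%:E)%E.
      rewrite -fincell; apply/esym.
      exact: (measure_integral_indic (mu n.+1) (measurable_cell k)).
    by rewrite EFinM muleC.
have gE u v (k : K) : cell k v -> g u v = `|dot u (corner k)|%:E.
  move=> kv; rewrite /g (bigD1 k)//= indicE mem_set// mule1 big1 ?adde0// => l lk.
  rewrite indicE memNset ?mule0// => lv; move/eqP: lk; apply.
  exact: cell_unique lv kv.
have gout u v : ~ @eball R n.+1 v -> g u v = 0%E.
  move=> vB; rewrite /g big1// => k _.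
  by rewrite indicE memNset ?mule0// => -[].
have mg u : measurable_fun setT (g u) by exact: emeasurable_sum.
have g0 u v : (0 <= g u v)%E.
  by apply: sume_ge0 => k _; rewrite mule_ge0// lee_fin.
have gB u : (\int[mu n.+1]_(v in @eball R n.+1) g u v = (A u)%:E)%E.
  rewrite -gA [LHS]integral_mkcond; apply: eq_integral => v _.
  rewrite patchE; case: ifPn => // vB; rewrite gout// => /mem_set.
  exact/negP.
have near_corner u v (k : K) : cell k v ->
    `|dot u (corner k)| <= `|dot u v| + enorm u * d /\
    `|dot u v| <= `|dot u (corner k)| + enorm u * d.
  move=> kv; have h : `|dot u (v - corner k)| <= enorm u * d.
    rewrite (le_trans (normr_dot_le _ _))// ler_wpM2l ?enorm_ge0//.
    exact: cell_corner kv.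
  split.
    rewrite (_ : dot u (corner k) = dot u v - dot u (v - corner k)).
      by rewrite (le_trans (ler_normB _ _))// lerD2l.
    by rewrite dotDr dotNr opprB addrC subrK.
  rewrite {1}(_ : dot u v = dot u (corner k) + dot u (v - corner k)).
    by rewrite (le_trans (ler_normD _ _))// lerD2l.
  by rewrite dotDr dotNr addrC subrK.
have mB := @measurable_eball n.+1.
have cB (u : 'rV[R]_n.+1) : (\int[mu n.+1]_(v in @eball R n.+1) (cst (enorm u * d)%:E v) =
    (enorm u * (d * w))%:E)%E.
  transitivity ((enorm u * d)%:E * mu n.+1 (@eball R n.+1))%E; first exact: integral_cst.
  rewrite (compact_volume (@compact_eball R n.+1)) -EFinM; congr EFin.
  by rewrite -mulrA.
have ud u : 0 <= enorm u * d by rewrite mulr_ge0// enorm_ge0.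
have mdB u := measurable_funTS (D := @eball R n.+1) (measurable_EFin_normr_dot u).
have mgB u := measurable_funTS (D := @eball R n.+1) (mg u).
have up u : A u <= enorm u * (k0 + d * w).
  rewrite -lee_fin -gB mulrDr EFinD -integral_eball_dot -cB -ge0_integralD//.
  - apply: ge0_le_integral => //.
    + by apply: emeasurable_funD => //; exact: measurable_cst.
    + move=> v vB; have [k kv] := cell_exists M0 vB.
      by rewrite (gE _ _ _ kv) -EFinD lee_fin; have [] := near_corner u _ _ kv.
  - by move=> v _; rewrite lee_fin.
have lo u : enorm u * (k0 - d * w) <= A u.
  rewrite mulrBr lerBlDr -lee_fin EFinD -gB -integral_eball_dot -cB -ge0_integralD//.
  - apply: ge0_le_integral => //.
    + by apply: emeasurable_funD => //; exact: measurable_cst.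
    + move=> v vB; have [k kv] := cell_exists M0 vB.
      by rewrite (gE _ _ _ kv) -EFinD lee_fin; have [] := near_corner u _ _ kv.
  - by move=> v _; rewrite lee_fin.
have e2 : 0 < 2 + e by rewrite addr_gt0.
have dwe : d * w * (2 + e) <= k0 * e by rewrite -ler_pdivlMr// -[leRHS]mulrA.
have c0 : 0 < k0 - d * w.
  rewrite subr_gt0 -(ltr_pM2r e2) (le_lt_trans dwe)// ltr_pM2l//; lra.
(* Dividing by k0 - d w rather than k0 makes the lower bound exactly |u|; the ratio (k0 + d w) / (k0
   - d w) is at most 1 + e by [dwe]. *)
exists [seq (volume (cell k) / (k0 - d * w)) *: corner k | k <- index_enum K] => u.
rewrite big_map (_ : \sum_(j <- _) _ = A u / (k0 - d * w)); last first.
  rewrite mulr_suml; apply: eq_bigr => k _.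
  by rewrite dotZr normrM ger0_norm ?divr_ge0 ?volume_ge0 ?(ltW c0)// mulrAC.
rewrite ler_pdivlMr// lo/= ler_pdivrMr// (le_trans (up u))//.
rewrite [leRHS](_ : _ = enorm u * ((1 + e) * (k0 - d * w))); last by ring.
rewrite ler_wpM2l ?enorm_ge0//; move: dwe; set b := d * w; nra.
Qed.

Definition zonotope n (s : seq 'rV[R]_n) : set 'rV[R]_n := add_segments [set 0] s.

Lemma is_convex1 n (x : 'rV[R]_n) : is_convex [set x].
Proof.
by apply/is_convexP => _ _ t -> -> _ _ /=; rewrite -scalerDl addrC subrK scale1r.
Qed.

Lemma compact_zonotope n (s : seq 'rV[R]_n) : compact (zonotope s).
Proof. by apply: compact_add_segments; exact: compact_set1. Qed.

Lemma convex_zonotope n (s : seq 'rV[R]_n) : is_convex (zonotope s).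
Proof. by apply: convex_add_segments; exact: is_convex1. Qed.

Lemma zonotope_dot_le n (s : seq 'rV[R]_n) u z : zonotope s z ->
  dot u z <= \sum_(v <- s) `|dot u v|.
Proof.
elim: s z => [|v s IH] z /=.
  by move=> ->; rewrite big_nil dotC -(scale0r 0) dotZl mul0r.
move=> [a [t [/IH az t1 ->]]]; rewrite big_cons dotDr dotZr addrC lerD//.
by rewrite (le_trans (ler_norm _))// normrM ler_piMl.
Qed.

Lemma zonotope_dot_eq n (s : seq 'rV[R]_n) u : exists2 z, zonotope s z &
  dot u z = \sum_(v <- s) `|dot u v|.
Proof.
elim: s => [|v s [z sz zE]].
  by exists 0 => //; rewrite big_nil dotC -(scale0r 0) dotZl mul0r.
exists (z + Num.sg (dot u v) *: v); last first.
  by rewrite dotDr dotZr zE big_cons addrC -normrEsg.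
exists z, (Num.sg (dot u v)); split => //.
by rewrite normr_sg; case: eqP.
Qed.

Lemma dot_subZ n (u q : 'rV[R]_n) t :
  dot (u - t *: q) (u - t *: q) = dot u u - 2 * t * dot u q + t ^+ 2 * dot q q.
Proof. by rewrite dotDl !dotDr !dotNl !dotNr !dotZl !dotZr (dotC q u); ring. Qed.

(** First-order condition at the minimizer y of |x - z|, from moving y a little towards z inside Z.
    It makes x - y an outer normal at y, which separates x from Z when x is outside. *)
Lemma nearest_point n (Z : set 'rV[R]_n) x : compact Z -> is_convex Z -> Z !=set0 ->
  exists2 y, Z y & forall z, Z z -> dot (x - y) z <= dot (x - y) y.
Proof.
move=> cZ /is_convexP vZ Z0.
have ce : {within Z, continuous (fun z => enorm (x - z))}.
  apply: continuous_subspaceT => z.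
  apply: (@continuous_comp _ _ _ (fun z : 'rV[R]_n => x - z) (@enorm R n)).
    have c1 : {for z, continuous (fun=> x : 'rV[R]_n)} by exact: cst_continuous.
    have c2 : {for z, continuous (@id 'rV[R]_n)} by exact: cvg_id.
    exact: (continuousB c1 c2).
  exact: enorm_continuous.
have [y] := EVT_min_rV Z0 cZ ce.
rewrite inE => Zy ymin; exists y => // z Zz.
set u := x - y; rewrite -subr_le0 -dotNr -dotDr.
have h t : 0 < t -> t <= 1 -> 2 * dot u (z - y) <= t * dot (z - y) (z - y).
  move=> t0 t1; have Zt := vZ z y t Zz Zy (ltW t0) t1.
  have := ymin _ (mem_set Zt).
  rewrite -(@ler_pXn2r _ 2) ?nnegrE ?enorm_ge0// !enorm_sqr -/u.
  have -> : x - (t *: z + (1 - t) *: y) = u - t *: (z - y).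
    by rewrite /u scalerBl scale1r scalerBr !opprD !opprK addrACA -!addrA; congr (_ + _); rewrite addrCA.
  rewrite dot_subZ; set a := dot u (z - y); set b := dot (z - y) (z - y) => h.
  rewrite -(ler_pM2l t0); lra.
rewrite leNgt; apply/negP => c0.
set b := dot (z - y) (z - y) in h; have b0 : 0 <= b by exact: dot_ge0.
have b1 : 0 < b + 1 by rewrite ltr_wpDl.
set c := dot u (z - y) in h c0.
(* A step t so short that t b < 2 c, against [h]; the denominator b + 1 avoids dividing by 0. *)
have := h (Num.min 1 (c / (b + 1))).
rewrite lt_min ltr01 divr_gt0// ge_min lexx => /(_ isT isT).
apply/negP; rewrite -ltNge.
have : Num.min 1 (c / (b + 1)) <= c / (b + 1) by rewrite ge_min lexx orbT.
move=> m1; apply: (le_lt_trans (ler_wpM2r b0 m1)).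
rewrite mulrAC ltr_pdivrMr//; nra.
Qed.

(** Compares support functions. A point of the ball outside the zonotope would be separated from it
    in the direction x - y, with y nearest to x, against the lower bound; a point of the zonotope
    tested in its own direction gives the upper bound. *)
Lemma zonotope_eball n (e : R) : 0 < e -> exists s : seq 'rV[R]_n,
  @eball R n `<=` zonotope s /\
  zonotope s `<=` [set x : 'rV[R]_n | enorm x <= 1 + e].
Proof.
case: n => [|n] e0.
  exists [::]; split => x _; first by apply/rowP; case.
  by rewrite (_ : x = 0) /= ?enorm0 ?addr_ge0// ?ltW//; apply/rowP; case.
have [s sP] := zonotope_support n e0; exists s; split => x.
  move=> xB; have Z0 : zonotope s !=set0.
    by have [z zs _] := zonotope_dot_eq s 0; exists z.
  have [y Zy yP] := nearest_point x (@compact_zonotope _ s) (@convex_zonotope _ s) Z0.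
  have [xy|xy] := eqVneq (x - y) 0; first by rewrite (subr0_eq xy).
  have u0 : 0 < enorm (x - y) by rewrite lt_neqAle eq_sym enorm_eq0 xy enorm_ge0.
  have [z Zz zE] := zonotope_dot_eq s (x - y).
  have /andP[h _] := sP (x - y).
  have := yP z Zz; rewrite zE => /(le_trans h).
  have -> : dot (x - y) y = dot (x - y) x - dot (x - y) (x - y).
    by rewrite -dotNr -dotDr subKr.
  have := dot_le_enorm (x - y) x; rewrite -enorm_sqr.
  have : enorm (x - y) * enorm x <= enorm (x - y) by rewrite ler_piMr ?enorm_ge0.
  have := exprn_gt0 2 u0; lra.
move=> Zx /=; have [->|x0] := eqVneq x 0; first by rewrite enorm0 addr_ge0// ltW.
have u0 : 0 < enorm x by rewrite lt_neqAle eq_sym enorm_eq0 x0 enorm_ge0.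
have /andP[_ h] := sP x; have := le_trans (zonotope_dot_le x Zx) h.
by rewrite -enorm_sqr expr2 ler_pM2r.
Qed.

Lemma add_segments_zonotope n (A : set 'rV[R]_n) l s :
  add_segments A [seq l *: v | v <- s] = minkowski_sum A (dilate l (zonotope s)).
Proof.
elim: s => [|v s IH] /=.
  apply/seteqP; split => [x Ax|_ [a Aa [_ [_ -> <-] <-]]].
    by exists x => //; exists 0; rewrite ?addr0//; exists 0; rewrite ?scaler0.
  by rewrite scaler0 addr0.
rewrite IH; apply/seteqP; split.
  move=> _ [_ [t [[a Aa [_ [z Zz <-] <-]] t1 ->]]].
  exists a => //; exists (l *: (z + t *: v)); last by rewrite scalerDr addrA !scalerA mulrC.
  by exists (z + t *: v) => //; exists z, t.
move=> _ [a Aa [_ [_ [z [t [Zz t1 ->]]] <-] <-]].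
exists (a + l *: z), t; split => //; last by rewrite scalerDr addrA !scalerA mulrC.
by exists a => //; exists (l *: z) => //; exists z.
Qed.

Lemma exp1D_le n (h : R) : 0 < h -> exists2 e, 0 < e & (1 + e) ^+ n <= 1 + h.
Proof.
elim: n h => [|n IH] h h0; first by exists 1; rewrite // expr0 lerDl ltW.
have h2 : 0 < h / 2 by rewrite divr_gt0.
have [e e0 eh] := IH _ h2.
have hh : 0 < h / (2 + h) by rewrite divr_gt0// addr_gt0.
exists (Num.min e (h / (2 + h))); first by rewrite lt_min e0.
have m0 : 0 < 1 + Num.min e (h / (2 + h)).
  by rewrite addr_gt0// lt_min e0.
have m1 : (1 + Num.min e (h / (2 + h))) ^+ n <= 1 + h / 2.
  by apply: le_trans eh; rewrite lerXn2r ?nnegrE ?(ltW m0)// ?addr_ge0 ?(ltW e0)// lerD2l ge_min lexx.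
have m2 : 1 + Num.min e (h / (2 + h)) <= 1 + h / (2 + h) by rewrite lerD2l ge_min lexx orbT.
rewrite exprS (le_trans (ler_pM (ltW m0) _ m2 m1))//.
  by rewrite exprn_ge0// ltW.
have -> : (1 + h / (2 + h)) * (1 + h / 2) = 1 + h.
  by field; rewrite gt_eqF// addr_gt0.
by [].
Qed.

Definition parallel_body n (L : set 'rV[R]_n) (l : R) : set 'rV[R]_n :=
  minkowski_sum L (dilate l (@eball R n)).

Lemma compact_parallel_body n (L : set 'rV[R]_n) l :
  compact L -> compact (parallel_body L l).
Proof.
move=> cL; apply: compact_minkowski_sum => //; apply: compact_dilate.
exact: compact_eball.
Qed.

(** Since 0 lies in L, the set L is contained in (1 + e) L. If Z is contained in (1 + e) B, then L +
    l Z is contained in (1 + e) (L + l B), whose volume is larger than that of L + l B by the factor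
    (1 + e)^n. The list [s] is chosen before [L] and l. *)
Lemma parallel_body_zonotope n (h : R) : 0 < h -> exists s : seq 'rV[R]_n,
  forall L l, compact L -> is_convex L -> L 0 -> 0 <= l ->
  volume (parallel_body L l) <= volume (add_segments L [seq l *: v | v <- s]) /\
  volume (add_segments L [seq l *: v | v <- s]) <= (1 + h) * volume (parallel_body L l).
Proof.
move=> h0; have [e e0 eh] := exp1D_le n h0.
have [s [Bs sB]] := zonotope_eball n e0.
exists s => L l cL vL L0 l0; rewrite add_segments_zonotope.
have cZ : compact (minkowski_sum L (dilate l (zonotope s))).
  by apply: compact_minkowski_sum => //; apply: compact_dilate; exact: compact_zonotope.
have cP := @compact_parallel_body _ L l cL.
split.
  apply: le_volume => // _ [a La [_ [b bB <-] <-]].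
  by exists a => //; exists (l *: b) => //; exists b => //; exact: Bs.
have e1 : 0 < 1 + e by rewrite addr_gt0.
apply: (@le_trans _ _ ((1 + e) ^+ n * volume (parallel_body L l))); last first.
  by rewrite ler_wpM2r// volume_ge0.
rewrite -lee_fin EFinM -!compact_volume// -measure_dilate//; last exact: compact_measurable_rV.
apply: le_measure; rewrite ?inE; first exact: compact_measurable_rV.
  by apply: measurable_dilate => //; exact: compact_measurable_rV.
move=> _ [a La [_ [b /sB bB <-] <-]].
exists ((1 + e)^-1 *: a + l *: ((1 + e)^-1 *: b)); last first.
  rewrite scalerDr !scalerA mulfV ?gt_eqF// scale1r; congr (_ + _ *: _).
  by field; rewrite gt_eqF.
exists ((1 + e)^-1 *: a).
  have /is_convexP := vL; move=> /(_ a 0 (1 + e)^-1 La L0).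
  rewrite scaler0 addr0; apply; first by rewrite invr_ge0 ltW.
  by rewrite invf_le1// lerDl ltW.
exists (l *: ((1 + e)^-1 *: b)) => //; exists ((1 + e)^-1 *: b) => //.
rewrite /eball /= enormZ gtr0_norm ?invr_gt0// ler_pdivrMl// mulr1.
exact: bB.
Qed.

End zonotopes.

(** * Steiner coefficients and quermassintegrals *)

Section steiner.
Variable R : realType.

Definition int_vandermonde n : 'M[R]_n.+1 := Vandermonde n.+1 (\row_i (i%:R)).

Lemma int_vandermonde_unit n : int_vandermonde n \in unitmx.
Proof.
rewrite unitmxE /int_vandermonde det_Vandermonde unitfE.
apply/prodf_neq0 => i _; apply/prodf_neq0 => j ij.
by rewrite !mxE subr_eq0 eqr_nat gtn_eqF.
Qed.

(* The coefficients of the polynomial of degree at most n with values p(i) at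
   the integers i = 0, ..., n. *)
Definition interpolate n (p : R -> R) (k : 'I_n.+1) : R :=
  \sum_(i < n.+1) p i%:R * invmx (int_vandermonde n) i k.

Lemma interpolate_poly n (a : 'I_n.+1 -> R) k :
  interpolate (fun x => \sum_(j < n.+1) a j * x ^+ j) k = a k.
Proof.
pose r : 'rV[R]_n.+1 := \row_j a j.
transitivity ((r *m int_vandermonde n *m invmx (int_vandermonde n)) ord0 k).
  rewrite [RHS]mxE; apply: eq_bigr => i _; congr (_ * _).
  by rewrite mxE; apply: eq_bigr => j _; rewrite !mxE.
by rewrite -mulmxA mulmxV ?int_vandermonde_unit// mulmx1 mxE.
Qed.

Lemma eq_interpolate n (p q : R -> R) (k : 'I_n.+1) :
  (forall x, 0 <= x -> p x = q x) -> interpolate p k = interpolate q k.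
Proof. by move=> pq; apply: eq_bigr => i _; rewrite pq. Qed.

(** C(n, k) W_k(L), once Steiner's formula is available. Interpolation at 0, ..., n defines it
    beforehand as a fixed linear function of n + 1 volumes, so that approximating the volumes
    approximates the coefficient. *)
Definition steiner_coef n (L : set 'rV[R]_n) (k : 'I_n.+1) : R :=
  interpolate (fun l => volume (parallel_body L l)) k.

(** A relative error h in the n + 1 volumes changes the coefficient by at most h times this. With
    the absolute values it is monotone in [L]. *)
Definition steiner_bound n (L : set 'rV[R]_n) (k : 'I_n.+1) : R :=
  \sum_(i < n.+1) volume (parallel_body L i%:R) * `|invmx (int_vandermonde n) i k|.

(** The coefficient of l^k in the volume of L plus l times a zonotope: k factors l leave images of
    dimension n - k. *)
Definition segment_coef n (Gs : forall m, seq (R * 'M[R]_(n, m)))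
    (L : set 'rV[R]_n) (k : 'I_n.+1) : R :=
  \sum_(p <- Gs (n - k)%N) p.1 * volume [set x *m p.2 | x in L].

(** The polynomial in l from [volume_add_segments] is within relative error h of the volume of every
    parallel body; interpolation is linear and recovers the coefficients of that polynomial
    exactly. *)
Lemma steiner_coef_approx n (h : R) : 0 < h ->
  exists Gs : forall m, seq (R * 'M[R]_(n, m)),
    (forall m p, p \in Gs m -> 0 <= p.1) /\
    forall L, compact L -> is_convex L -> L 0 ->
    (forall k, `|segment_coef Gs L k - steiner_coef L k| <= h * steiner_bound L k) /\
    forall l, 0 <= l ->
    `|\sum_(k < n.+1) segment_coef Gs L k * l ^+ k - volume (parallel_body L l)| <=
      h * volume (parallel_body L l).
Proof.
move=> h0; have [s sP] := @parallel_body_zonotope R n h h0.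
have [Gs [Gs0 GsE]] := volume_add_segments s; exists Gs; split => // L cL vL L0.
have polyE l : 0 <= l -> volume (add_segments L [seq l *: v | v <- s]) =
    \sum_(k < n.+1) segment_coef Gs L k * l ^+ k.
  move=> l0; rewrite GsE// (reindex_inj rev_ord_inj); apply: eq_bigr => k _ /=.
  rewrite subSS mulrC /segment_coef; congr (_ * _ ^+ _).
  by rewrite subKn// -ltnS.
have close l : 0 <= l ->
    `|\sum_(k < n.+1) segment_coef Gs L k * l ^+ k - volume (parallel_body L l)| <=
      h * volume (parallel_body L l).
  move=> l0; rewrite -polyE//; have [h1 h2] := sP L l cL vL L0 l0.
  rewrite ger0_norm ?subr_ge0// lerBlDr; lra.
split => // k.
rewrite -[segment_coef Gs L k](interpolate_poly (segment_coef Gs L)).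
rewrite /steiner_coef /interpolate -sumrB (le_trans (ler_norm_sum _ _ _))//.
rewrite /steiner_bound mulr_sumr; apply: ler_sum => i _.
by rewrite -mulrBl normrM mulrA ler_wpM2r// close.
Qed.

Lemma ler_all_eps (a b c : R) : (forall h, 0 < h -> a <= b + h * c) -> a <= b.
Proof.
move=> H; rewrite leNgt; apply/negP => ba.
have c1 : 0 < `|c| + 1 by rewrite ltr_wpDl.
have := H ((a - b) / (`|c| + 1)); rewrite divr_gt0 ?subr_gt0// => /(_ isT).
apply/negP; rewrite -ltNge -ltrBrDl.
rewrite mulrAC ltr_pdivrMr// ltr_pM2l ?subr_gt0//.
by rewrite (le_lt_trans (ler_norm c))// ltrDl.
Qed.

Lemma steiner_coef_ge0 n (L : set 'rV[R]_n) k :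
  compact L -> is_convex L -> L 0 -> 0 <= steiner_coef L k.
Proof.
move=> cL vL L0; apply: (@ler_all_eps _ _ (steiner_bound L k)) => h h0.
have [Gs [Gs0 GsP]] := @steiner_coef_approx n h h0.
have [/(_ k) + _] := GsP L cL vL L0.
have : 0 <= segment_coef Gs L k.
  by rewrite /segment_coef big_seq sumr_ge0// => p /Gs0 p0; rewrite mulr_ge0// volume_ge0.
rewrite ler_norml => g0 /andP[h1 h2]; lra.
Qed.

(** Steiner's formula, by letting h tend to 0: the volume is h-close to a polynomial in l whose
    coefficients are h-close to the interpolated ones. *)
Lemma volume_parallel_body n (L : set 'rV[R]_n) l :
  compact L -> is_convex L -> L 0 -> 0 <= l ->
  volume (parallel_body L l) = \sum_(k < n.+1) steiner_coef L k * l ^+ k.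
Proof.
move=> cL vL L0 l0; apply/eqP; rewrite -subr_eq0 -normr_le0.
apply: (@ler_all_eps _ _ (volume (parallel_body L l) +
  \sum_(k < n.+1) steiner_bound L k * l ^+ k)) => h h0.
have [Gs [Gs0 GsP]] := @steiner_coef_approx n h h0.
have [GsC GsL] := GsP L cL vL L0; rewrite add0r mulrDr.
rewrite [X in `|X|](_ : _ =
    (volume (parallel_body L l) - \sum_(k < n.+1) segment_coef Gs L k * l ^+ k) +
    (\sum_(k < n.+1) segment_coef Gs L k * l ^+ k -
     \sum_(k < n.+1) steiner_coef L k * l ^+ k)); last by rewrite addrA subrK.
rewrite (le_trans (ler_normD _ _))// lerD//; first by rewrite distrC GsL.
rewrite -sumrB (le_trans (ler_norm_sum _ _ _))// mulr_sumr.
apply: ler_sum => k _; rewrite -mulrBl normrM [`|l ^+ k|]ger0_norm ?exprn_ge0//.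
by rewrite mulrA ler_wpM2r ?exprn_ge0.
Qed.

Lemma steiner_coef_unique n (L : set 'rV[R]_n) (a : 'I_n.+1 -> R) :
  (forall l, 0 <= l -> volume (parallel_body L l) = \sum_(k < n.+1) a k * l ^+ k) ->
  steiner_coef L =1 a.
Proof.
by move=> LE k; rewrite -[RHS](interpolate_poly a); exact: eq_interpolate.
Qed.

Lemma le_parallel_body n (L K : set 'rV[R]_n) l :
  compact L -> compact K -> L `<=` K ->
  volume (parallel_body L l) <= volume (parallel_body K l).
Proof.
move=> cL cK LK; apply: le_volume; [exact: compact_parallel_body..|].
by move=> _ [a La [b bB <-]]; exists a; [exact: LK|exists b].
Qed.

Lemma le_steiner_bound n (L K : set 'rV[R]_n) k :
  compact L -> compact K -> L `<=` K -> steiner_bound L k <= steiner_bound K k.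
Proof.
move=> cL cK LK; apply: ler_sum => i _; rewrite ler_wpM2r//.
exact: le_parallel_body.
Qed.

(** Each |L G| is monotone in L and enters with a nonnegative weight; the approximation hands this
    on to the limit. *)
Lemma le_steiner_coef n (L K : set 'rV[R]_n) k :
  compact L -> is_convex L -> L 0 -> compact K -> is_convex K -> L `<=` K ->
  steiner_coef L k <= steiner_coef K k.
Proof.
move=> cL vL L0 cK vK LK; have K0 := LK _ L0.
apply: (@ler_all_eps _ _ (steiner_bound L k + steiner_bound K k)) => h h0.
have [Gs [Gs0 GsP]] := @steiner_coef_approx n h h0.
have [/(_ k) + _] := GsP L cL vL L0; have [/(_ k) + _] := GsP K cK vK K0.
have : segment_coef Gs L k <= segment_coef Gs K k.
  rewrite /segment_coef big_seq [leRHS]big_seq ler_sum// => p /Gs0 p0.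
  rewrite ler_wpM2l// le_volume//; [exact: compact_image_mulmx..|].
  by move=> _ [x Lx <-]; exists x => //; exact: LK.
rewrite !ler_norml => g0 /andP[h1 h2] /andP[h3 h4]; lra.
Qed.

Lemma enorm_row_mx m p (y : 'rV[R]_m) (z : 'rV[R]_p) :
  enorm (row_mx y z) ^+ 2 = enorm y ^+ 2 + enorm z ^+ 2.
Proof.
rewrite !enorm_sqr /dot big_split_ord /=.
by congr (_ + _); apply: eq_bigr => i _; rewrite ?row_mxEl ?row_mxEr.
Qed.

Lemma measure_row_mx_swap m p (A : set 'rV[R]_(m + p)) : measurable A ->
  (mu (m + p) A = \int[mu p]_z mu m [set y | A (row_mx y z)])%E.
Proof.
move=> mA.
have mrow : measurable_fun setT (fun q : 'rV[R]_m * 'rV[R]_p => row_mx q.1 q.2).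
  exact: measurable_row_mx.
have mF : measurable_fun setT (fun q : 'rV[R]_m * 'rV[R]_p =>
    (\1_A (row_mx q.1 q.2))%:E : \bar R).
  exact: (measurableT_comp (measurable_indicE mA) mrow).
rewrite (measure_integral_indic _ mA).
rewrite (integral_row_mx (measurable_indicE mA)); last by move=> x; rewrite lee_fin.
rewrite (@tonelli_swap _ _ _ _ R (mu m) (mu p) (fun y z => (\1_A (row_mx y z))%:E) mF); last first.
  by move=> y z; rewrite lee_fin.
apply: eq_integral => z _.
rewrite [RHS]measure_integral_indic//.
by apply: (measurable_preimageT _ mA); exact: measurable_row_mx.
Qed.

(* The section of a ball of radius l at distance |z| from its centre has radius
   chord l z. *)
Definition chord p l (z : 'rV[R]_p) : R := Num.sqrt (l ^+ 2 - enorm z ^+ 2).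

Lemma ball_row_mx m p l (y : 'rV[R]_m) (z : 'rV[R]_p) : 0 <= l ->
  (enorm (row_mx y z) <= l) = (enorm z <= l) && (enorm y <= chord l z).
Proof.
move=> l0; rewrite -(@ler_pXn2r _ 2) ?nnegrE ?enorm_ge0// enorm_row_mx.
have [zl|zl] := leP (enorm z) l => /=; last first.
  apply/negbTE; rewrite -ltNge.
  have : l ^+ 2 < enorm z ^+ 2 by rewrite ltrXn2r// nnegrE enorm_ge0.
  have := sqr_ge0 (enorm y); lra.
have d0 : 0 <= l ^+ 2 - enorm z ^+ 2.
  by rewrite subr_ge0 lerXn2r// nnegrE enorm_ge0.
rewrite -[RHS](@ler_pXn2r _ 2) ?nnegrE ?enorm_ge0 ?sqrtr_ge0//.
by rewrite /chord (sqr_sqrtr d0) lerBrDr.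
Qed.

(** The explicit zero matters for i = 0: beyond distance l, [Num.sqrt] of a negative number is 0,
    but 0 ^+ 0 is 1. *)
Definition chord_power p l i (z : 'rV[R]_p) : \bar R :=
  if enorm z <= l then (chord l z ^+ i)%:E else 0%E.

Lemma volume_eballr0 n r : 0 <= r ->
  volume [set x : 'rV[R]_n | enorm x <= r] = r ^+ n * omega R n.
Proof.
rewrite le_eqVlt => /predU1P[<-|]; last exact: volume_eballr.
have -> : [set x : 'rV[R]_n | enorm x <= 0] = cube 0.
  apply/seteqP; split => x /=; last first.
    by move=> h; rewrite (le_trans (enorm_le_sum _))// sumr_le0.
  by move=> x0 i; rewrite (le_trans (coord_le_enorm _ _)).
rewrite /volume measure_cube//= mulr0.
case: n => [|n]; last by rewrite !expr0n /= mul0r.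
rewrite !expr0 mul1r /omega /volume.
have -> : @eball R 0 = cube 0.
  apply/seteqP; split => x _; first by case.
  by rewrite /eball /= (_ : x = 0) ?enorm0//; apply/rowP; case.
by rewrite measure_cube//= expr0.
Qed.

Lemma measurable_enorm d (T : measurableType d) n (f : T -> 'rV[R]_n) :
  measurable_fun setT f -> measurable_fun setT (fun t => enorm (f t)).
Proof.
move=> mf; under eq_fun do rewrite enorm_dot.
apply: (measurableT_comp (f := @Num.sqrt R)).
  by apply: continuous_measurable_fun; exact: sqrt_continuous.
exact: measurable_dot.
Qed.

Lemma measurable_chord_power p l i : measurable_fun setT (@chord_power p l i).
Proof.
apply: measurable_fun_ifT => //.
  apply: (@measurable_fun_ler _ _ R setT (@enorm R p) (cst l)) => //.
  exact: measurable_enorm.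
apply/measurable_EFinP; apply: measurable_funX.
apply: (measurableT_comp (f := @Num.sqrt R)).
  by apply: continuous_measurable_fun; exact: sqrt_continuous.
apply: measurable_funB => //; apply: measurable_funX; exact: measurable_enorm.
Qed.

(** Slices the ball of radius l in R^(i + p) into i-dimensional balls of radius [chord l z], with z
    in R^p. *)
Lemma integral_chord_power p l i : 0 <= l ->
  ((omega R i)%:E * \int[mu p]_z chord_power l i z = (l ^+ (i + p) * omega R (i + p))%:E)%E.
Proof.
move=> l0.
have <- : mu (i + p) [set x | enorm x <= l] = (l ^+ (i + p) * omega R (i + p))%:E.
  by rewrite compact_volume ?volume_eballr0//; exact: compact_eballr.
rewrite measure_row_mx_swap; last by apply: compact_measurable_rV; exact: compact_eballr.
have w0 : 0 <= omega R i by rewrite ltW// omega_gt0.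
rewrite -ge0_integralZl ?lee_fin//.
- apply: eq_integral => z _; rewrite /chord_power.
  under eq_set do rewrite /= ball_row_mx//.
  case: ifP => zl /=; last by rewrite set_false measure0 mule0.
  have c0 : 0 <= chord l z by exact: sqrtr_ge0.
  by rewrite -EFinM mulrC -volume_eballr0// -compact_volume//; exact: compact_eballr.
- exact: measurable_chord_power.
- by move=> z _; rewrite /chord_power; case: ifP => // _; rewrite lee_fin exprn_ge0// sqrtr_ge0.
Qed.

Lemma parallel_body_row_mx N k (L : set 'rV[R]_N) l (y : 'rV[R]_N) (z : 'rV[R]_k) :
  0 <= l ->
  parallel_body [set row_mx x 0 | x in L] l (row_mx y z) <->
  enorm z <= l /\ parallel_body L (chord l z) y.
Proof.
have dil n (r : R) (x : 'rV[R]_n) : 0 <= r -> dilate r (@eball R n) x <-> enorm x <= r.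
  rewrite le_eqVlt => /predU1P[<-|r0].
    split=> [[w _ <-]|x0]; first by rewrite scale0r enorm0.
    exists 0; first by rewrite /eball /= enorm0.
    by rewrite scale0r; apply/esym/eqP; rewrite -enorm_eq0 eq_le x0 enorm_ge0.
  by rewrite -eballrE.
move=> l0; split.
  move=> [_ [x Lx <-] [b /(dil _ _ _ l0) bl E]].
  have [E1 E2] : lsubmx b = y - x /\ rsubmx b = z.
    have -> : b = row_mx y z - row_mx x 0 by rewrite -E addrC addKr.
    by rewrite opp_row_mx add_row_mx row_mxKl row_mxKr oppr0 addr0.
  move: bl; rewrite -[b]hsubmxK E1 E2 ball_row_mx// => /andP[zl yl]; split => //.
  exists x => //; exists (y - x); last by rewrite addrC subrK.
  by apply/dil => //; exact: sqrtr_ge0.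
move=> [zl [x Lx [b /dil bl E]]].
exists (row_mx x 0); first by exists x.
exists (row_mx b z); last by rewrite add_row_mx add0r E.
by apply/dil => //; rewrite ball_row_mx// zl bl// sqrtr_ge0.
Qed.

Lemma compact_embed N k (L : set 'rV[R]_N) :
  compact L -> compact [set row_mx x (0 : 'rV[R]_k) | x in L].
Proof.
have -> : [set row_mx x (0 : 'rV[R]_k) | x in L] =
    [set x *m row_mx 1%:M 0 | x in L].
  by apply/seteqP; split => [_ [x Lx <-]|_ [x Lx <-]]; exists x => //;
    rewrite mul_mx_row mulmx1 mulmx0.
exact: compact_image_mulmx.
Qed.

(** Over z, the parallel body of the embedded set is the parallel body of [L] with radius
    [chord l z]. Expand it by Steiner's formula in R^N and integrate each power of the chord over
    z. *)
Lemma volume_parallel_embed N k (L : set 'rV[R]_N) l :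
  compact L -> is_convex L -> L 0 -> 0 <= l ->
  volume (parallel_body [set row_mx x (0 : 'rV[R]_k) | x in L] l) =
  \sum_(i < N.+1) steiner_coef L i * (omega R (i + k) / omega R i) * l ^+ (i + k).
Proof.
move=> cL vL L0 l0; apply: EFin_inj.
have cP := compact_parallel_body (l := l) (@compact_embed N k L cL).
rewrite -compact_volume// measure_row_mx_swap; last exact: compact_measurable_rV.
transitivity (\int[mu k]_z (\sum_(i < N.+1) (steiner_coef L i)%:E * chord_power l i z))%E.
  apply: eq_integral => z _; have [zl|zl] := boolP (enorm z <= l).
    rewrite (_ : [set y | _] = parallel_body L (chord l z)); last first.
      apply/seteqP; split => y /=; first by move/(parallel_body_row_mx _ _ _ l0) => [].
      by move=> ?; apply/parallel_body_row_mx.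
    rewrite compact_volume; last exact: compact_parallel_body.
    rewrite volume_parallel_body// ?sqrtr_ge0// -sumEFin; apply: eq_bigr => i _.
    by rewrite /chord_power zl EFinM.
  rewrite (_ : [set y | _] = set0) ?measure0.
    by rewrite big1// => i _; rewrite /chord_power (negbTE zl) mule0.
  rewrite -subset0 => y /= /(parallel_body_row_mx _ _ _ l0)[zl' _].
  by rewrite zl' in zl.
have cpos i z : (0 <= @chord_power k l i z)%E.
  by rewrite /chord_power; case: ifP => // _; rewrite lee_fin exprn_ge0// sqrtr_ge0.
have s0 i : 0 <= steiner_coef L i by exact: steiner_coef_ge0.
rewrite ge0_integral_sum//; last 2 first.
- by move=> i; apply: emeasurable_funM => //; exact: measurable_chord_power.
- by move=> i z _; rewrite mule_ge0// lee_fin.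
rewrite -sumEFin; apply: eq_bigr => i _.
rewrite ge0_integralZl//.
- have w0 : omega R i != 0 by rewrite gt_eqF// omega_gt0.
  rewrite -!mulrA EFinM; congr (_ * _)%E.
  have := @integral_chord_power k l i l0.
  have i0 : (0 <= \int[mu k]_z chord_power l i z)%E by apply: integral_ge0.
  case: (\int[mu k]_z chord_power l i z)%E i0 => [r| |]//= _.
    rewrite -EFinM => -[E]; congr EFin; apply: (mulfI w0); rewrite E; field.
    exact: w0.
  by rewrite gt0_muley// lte_fin omega_gt0.
- exact: measurable_chord_power.
- by rewrite lee_fin.
Qed.

(** Compare coefficients in [volume_parallel_embed]. The ratio of ball volumes found here is the
    source of the factor omega_j / omega_(k+j) in both constants of the theorem. *)
Lemma steiner_coef_embed N k (L : set 'rV[R]_N) (i : 'I_N.+1) :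
  compact L -> is_convex L -> L 0 ->
  steiner_coef [set row_mx x (0 : 'rV[R]_k) | x in L] (inord (i + k)) =
  steiner_coef L i * (omega R (i + k) / omega R i).
Proof.
move=> cL vL L0.
pose a (q : 'I_(N + k).+1) : R :=
  if (k <= q)%N then steiner_coef L (inord (q - k)) * (omega R q / omega R (q - k)) else 0.
rewrite (@steiner_coef_unique _ _ a).
  have ik : (i + k < (N + k).+1)%N by rewrite ltnS leq_add2r -ltnS.
  by rewrite /a inordK// leq_addl addnK inord_val.
move=> l l0; rewrite volume_parallel_embed//.
pose F (q : nat) := (if (k <= q)%N then
  steiner_coef L (inord (q - k)) * (omega R q / omega R (q - k)) else 0) * l ^+ q.
rewrite -[RHS](big_mkord xpredT F) (@big_cat_nat _ _ _ k)//=; last first.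
  by rewrite leqW// leq_addl.
have -> : \sum_(0 <= q < k) F q = 0.
  by rewrite big_nat_cond big1// => q /andP[/andP[_ qk] _]; rewrite /F leqNgt qk mul0r.
rewrite add0r.
have := @big_addn _ 0 +%R 0%N (N + k).+1 k xpredT F; rewrite add0n => ->.
rewrite subSn ?leq_addl// addnK big_mkord.
by apply: eq_bigr => q _; rewrite /F leq_addl addnK inord_val.
Qed.

Lemma dilate_orthogonal n (Q : 'M[R]_n) (L : set 'rV[R]_n) l : is_orthogonal Q ->
  parallel_body [set x *m Q | x in L] l = [set x *m Q | x in parallel_body L l].
Proof.
move=> oQ; apply/seteqP; split.
  move=> _ [_ [x Lx <-] [_ [b bB <-] <-]].
  exists (x + l *: (b *m Q^T)).
    exists x => //; exists (l *: (b *m Q^T)) => //; exists (b *m Q^T) => //.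
    by rewrite eball_orthogonal//; exact: orthogonal_tr.
  by rewrite mulmxDl -scalemxAl -mulmxA (mulmx1C oQ) mulmx1.
move=> _ [_ [x Lx [_ [b bB <-] <-]] <-].
exists (x *m Q); first by exists x.
exists (l *: (b *m Q)); last by rewrite mulmxDl scalemxAl.
by exists (b *m Q) => //; rewrite eball_orthogonal.
Qed.

Lemma steiner_coef_orthogonal n (Q : 'M[R]_n) (L : set 'rV[R]_n) k :
  is_orthogonal Q -> compact L ->
  steiner_coef [set x *m Q | x in L] k = steiner_coef L k.
Proof.
move=> oQ cL; apply: eq_interpolate => l _; rewrite dilate_orthogonal//.
have cP := compact_parallel_body (l := l) cL.
apply: EFin_inj; rewrite -!compact_volume//; last exact: compact_image_mulmx.
by rewrite volume_orthogonal//; exact: compact_measurable_rV.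
Qed.

(* The polynomial coefficients absorb the binomials of Steiner's formula. *)
Lemma quermassintegralE m k (L : set 'rV[R]_(m + k)) (j : nat) (jm : (j <= m)%N) :
  compact L -> is_convex L -> L 0 ->
  (exists U : 'M[R]_(m, m + k), orthonormal_rows U /\ L `<=` row_space U) ->
  quermassintegral m L j =
    omega R j / omega R (j + k) * steiner_coef L (inord (j + k)) / 'C(m, j)%:R.
Proof.
move=> cL vL L0 [U0 [oU0 LU0]].
(* [L'] is [L] in the coordinates of E. Both Steiner's formula in E and the coefficient in R^(m + k)
   are expressed through [L'], for every basis [U] alike, so the value cannot depend on [U]. *)
have key (U : 'M[R]_(m, m + k)) : orthonormal_rows U -> L `<=` row_space U ->
  let L' := [set y : 'rV[R]_m | L (y *m U)] in
  [/\ compact L', is_convex L', L' 0 &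
   (forall l, 0 <= l -> subspace_measure U
     (minkowski_sum L (dilate l (row_space U `&` @eball R (m + k)))) =
     (volume (parallel_body L' l))%:E) /\
   steiner_coef L (inord (j + k)) =
     steiner_coef L' (inord j) * (omega R (j + k) / omega R j)].
  move=> oU LU L'.
  have UU : U *m U^T = 1%:M by [].
  have LE x : L x -> x *m U^T *m U = x.
    by move=> /LU /submxP[D ->]; rewrite -!mulmxA (mulmxA U) UU mul1mx.
  have L'E : L' = [set x *m U^T | x in L].
    apply/seteqP; split => [y Ly|_ [x Lx <-]].
      by exists (y *m U) => //; rewrite -mulmxA UU mulmx1.
    by rewrite /L' /= LE.
  have cL' : compact L' by rewrite L'E; exact: compact_image_mulmx.
  have vL' : is_convex L' by rewrite L'E; exact: convex_image_mulmx.
  have L'0 : L' 0 by rewrite /L' /= mul0mx.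
  have enormU (y : 'rV[R]_m) : enorm (y *m U) = enorm y.
    by rewrite !enorm_dot -[dot (y *m U) _]/(dot _ _); congr Num.sqrt;
      have /matrixP/(_ ord0 ord0) : (y *m U) *m (y *m U)^T = y *m y^T;
      [by rewrite trmx_mul mulmxA -(mulmxA y) UU mulmx1|rewrite !dotE !mxE].
  split => //; split.
    move=> l l0; rewrite -compact_volume; last exact: compact_parallel_body.
    rewrite /subspace_measure; congr (mu m _); apply/seteqP; split => y /=.
      move=> [x Lx [_ [b [/submxP[D bE] bB] <-] E]].
      exists (x *m U^T); first by rewrite /L' /= LE.
      exists (l *: D); last first.
        have : (x *m U^T + l *: D) *m U = y *m U.
          by rewrite mulmxDl LE// -scalemxAl -bE.
        by move/(congr1 (mulmx^~ U^T)); rewrite -!mulmxA UU !mulmx1.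
      by exists D => //; rewrite /eball /= -enormU -bE.
    move=> [x Lx [_ [b bB <-] <-]].
    exists (x *m U) => //; exists (l *: (b *m U)); last by rewrite mulmxDl scalemxAl.
    exists (b *m U) => //; split; first by rewrite /row_space /= submxMl.
    by rewrite /eball /= enormU.
  (* A rotation carries E onto R^m x 0, where [steiner_coef_embed] applies; in the coordinates of E
     it acts as the orthogonal matrix [T]. *)
  have [Q [oQ [T QT]]] := lq_decomposition U.
  have oT : is_orthogonal T.
    have : (U *m Q) *m (U *m Q)^T = 1%:M.
      by rewrite trmx_mul mulmxA -(mulmxA U) oQ mulmx1.
    rewrite QT tr_row_mx mul_row_col trmx0 mulmx0 addr0; exact.
  have LT : [set x *m Q | x in L] = [set row_mx x 0 | x in [set y *m T | y in L']].
    have QE (y : 'rV[R]_m) : y *m U *m Q = row_mx (y *m T) 0.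
      by rewrite -mulmxA QT mul_mx_row mulmx0.
    apply/seteqP; split => [_ [x Lx <-]|_ [_ [y Ly <-] <-]].
      exists (x *m U^T *m T); first by exists (x *m U^T) => //; rewrite /L' /= LE.
      by rewrite -QE LE.
    by exists (y *m U) => //; exact: QE.
  rewrite -(steiner_coef_orthogonal _ oQ cL) LT.
  have jj : (inord j : 'I_m.+1) = j :> nat by rewrite inordK.
  rewrite -{1}jj steiner_coef_embed//.
  - by rewrite (steiner_coef_orthogonal _ oT cL') jj.
  - exact: compact_image_mulmx.
  - exact: convex_image_mulmx.
  - by exists 0; rewrite ?mul0mx.
have wj : omega R j != 0 by rewrite gt_eqF ?omega_gt0.
have wjk : omega R (j + k) != 0 by rewrite gt_eqF ?omega_gt0.
have Cmj : 'C(m, j)%:R != 0 :> R by rewrite pnatr_eq0 -lt0n bin_gt0.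
(* The choice made by [xget] is determined once the set is shown to be the singleton of [w]. *)
rewrite /quermassintegral; set S := (X in xget 0 X); set w := (X in _ = X).
have Sw x : S x -> x = w.
  move=> [U [W [oU LU sW ->]]]; have [cL' vL' L'0 [mE cE]] := key U oU LU.
  set L' := [set y | L (y *m U)] in cL' vL' L'0 mE cE.
  rewrite /w cE.
  have <- : 'C(m, j)%:R * W j = steiner_coef L' (inord j).
    rewrite (@steiner_coef_unique _ _ (fun i => 'C(m, i)%:R * W i)) ?inordK//.
    by move=> l l0; apply: EFin_inj; rewrite -mE// sW.
  by field; rewrite wj wjk Cmj.
suff : S w by move=> Sw'; apply: (xget_unique 0 Sw') => y /Sw.
have [cL' vL' L'0 [mE cE]] := key U0 oU0 LU0.
set L' := [set y | L (y *m U0)] in cL' vL' L'0 mE cE.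
exists U0, (fun i => steiner_coef L' (inord i) / 'C(m, i)%:R); split => //.
  move=> l l0; rewrite mE// volume_parallel_body//; congr EFin.
  apply: eq_bigr => i _; congr (_ * _).
  rewrite inord_val mulrCA mulfV ?mulr1// pnatr_eq0 -lt0n bin_gt0.
  by rewrite -ltnS.
by rewrite /w cE; field; rewrite wj wjk Cmj.
Qed.

(** The first m rows of Q^T in the LQ decomposition; this also covers dependent points, whose span
    is smaller than that of [U]. *)
Lemma exists_orthonormal_rows m k (X : 'M[R]_(m, m + k)) :
  exists U : 'M[R]_(m, m + k), orthonormal_rows U /\ (X <= U)%MS.
Proof.
have [Q [oQ [T QT]]] := lq_decomposition X.
exists (row_mx 1%:M 0 *m Q^T); split.
  rewrite /orthonormal_rows trmx_mul trmxK mulmxA -(mulmxA (row_mx _ _)).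
  rewrite (mulmx1C oQ) mulmx1 tr_row_mx mul_row_col trmx0 mulmx0 addr0.
  by rewrite trmx1 mulmx1.
apply/submxP; exists T.
by rewrite mulmxA mul_mx_row mulmx1 mulmx0 -QT -mulmxA oQ mulmx1.
Qed.

(** The equation on n avoids casts, since n - k + k equals n only propositionally. *)
Lemma quermassintegral_hull0 n m k (X : 'M[R]_(m, n)) (j : nat) :
  n = (m + k)%N -> (j <= m)%N ->
  quermassintegral m (hull0 X) j =
    omega R j / omega R (j + k) * steiner_coef (hull0 X) (inord (j + k)) / 'C(m, j)%:R.
Proof.
move=> nE; subst n => jm; have [U [oU XU]] := exists_orthonormal_rows X.
apply: quermassintegralE => //; [exact: compact_hull0|exact: convex_hull0|exact: hull0_0|].
exists U; split => //; rewrite hull0E => _ [c _ <-].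
by rewrite /row_space /= mulmx_sub.
Qed.

Lemma quermassintegral_full n m (K : set 'rV[R]_n) (j : nat) :
  n = (m + 0)%N -> (j <= m)%N ->
  compact K -> is_convex K -> K 0 ->
  quermassintegral m K j = steiner_coef K (inord j) / 'C(m, j)%:R.
Proof.
move=> nE; subst n => jn cK vK K0.
rewrite (quermassintegralE jn)//; last first.
  exists (row_mx 1%:M 0); split.
    by rewrite /orthonormal_rows tr_row_mx mul_row_col trmx1 mulmx1 mul0mx addr0.
  move=> x _; apply/submxP; exists (lsubmx x).
  rewrite mul_mx_row mulmx1 mulmx0 -[LHS]hsubmxK; congr (row_mx _ _).
  by apply/rowP; case.
by rewrite !addn0 mulfV ?gt_eqF ?omega_gt0// mul1r.
Qed.

End steiner.

(** * Weighted iterated integrals *)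

Section iterated.
Variable R : realType.

Definition entries_measurable d (T : measurableType d) q n (r : T -> 'M[R]_(q, n)) :=
  forall i j, measurable_fun setT (fun t => r t i j : measurableTypeR R).

(* Matrices carry no sigma-algebra here, so joint measurability in a parameter
   and in the rows is expressed by testing on all measurable families. *)
Definition pmeasurable d (T : measurableType d) q n (F : T -> 'M[R]_(q, n) -> \bar R) :=
  forall d' (T' : measurableType d') (s : T' -> T) (r : T' -> 'M[R]_(q, n)),
  measurable_fun setT s -> entries_measurable r ->
  measurable_fun setT (fun t => F (s t) (r t)).

Definition rows_measurable q n (F : 'M[R]_(q, n) -> \bar R) :=
  forall d (T : measurableType d) (r : T -> 'M[R]_(q, n)), entries_measurable r ->
  measurable_fun setT (fun t => F (r t)).

Lemma entries_measurable_rV d (T : measurableType d) n (f : T -> 'rV[R]_n) :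
  measurable_fun setT f <-> entries_measurable f.
Proof.
split=> [mf i j|mf]; first by rewrite ord1; exact: measurable_rV_coord_fun.
by apply/measurable_rV_coordP => i; exact: mf.
Qed.

Lemma entries_measurable_col_mx d (T : measurableType d) p q n
    (f : T -> 'M[R]_(p, n)) (r : T -> 'M[R]_(q, n)) :
  entries_measurable f -> entries_measurable r ->
  entries_measurable (fun t => col_mx (f t) (r t)).
Proof.
move=> mf mr i j; case: (split_ordP i) => k ->.
  by under eq_fun do rewrite col_mxEu; exact: mf.
by under eq_fun do rewrite col_mxEd; exact: mr.
Qed.

Lemma entries_measurable_cons d (T : measurableType d) q n
    (f : T -> 'rV[R]_n) (r : T -> 'M[R]_(q, n)) :
  measurable_fun setT f -> entries_measurable r ->
  entries_measurable (fun t => col_mx (f t) (r t) : 'M[R]_(q.+1, n)).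
Proof.
move=> /entries_measurable_rV mf mr.
exact: (@entries_measurable_col_mx _ _ 1 q n _ _ mf mr).
Qed.

Lemma row_consl q n (x : 'rV[R]_n) (X : 'M[R]_(q, n)) j :
  row (lshift q j) (col_mx x X : 'M[R]_(q.+1, n)) = x.
Proof. by apply/rowP => k; rewrite mxE (col_mxEu x) !ord1. Qed.

Lemma row_consr q n (x : 'rV[R]_n) (X : 'M[R]_(q, n)) j :
  row (rshift 1 j) (col_mx x X : 'M[R]_(q.+1, n)) = row j X.
Proof. by apply/rowP => k; rewrite mxE (col_mxEd x) mxE. Qed.

Lemma entries_measurable_comp d (T : measurableType d) d' (T' : measurableType d')
    q n (r : T -> 'M[R]_(q, n)) (s : T' -> T) :
  entries_measurable r -> measurable_fun setT s -> entries_measurable (r \o s).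
Proof. by move=> mr ms i j; exact: (measurableT_comp (mr i j) ms). Qed.

(** The iterated integral against the product density g(x_1) ... g(x_q). Weights take the place of
    sets because projecting turns an indicator into a density. *)
Fixpoint witer n q (g : 'rV[R]_n -> R) : ('M[R]_(q, n) -> \bar R) -> \bar R :=
  match q with
  | 0 => fun F => F 0
  | q'.+1 => fun F => (\int[mu n]_x
      ((g x)%:E * witer g (fun X : 'M[R]_(q', n) => F (col_mx x X))))%E
  end.

Lemma iter_integral_witer n q (D : set 'rV[R]_n) (F : 'M[R]_(q, n) -> \bar R) :
  iter_integral D F = witer \1_D F.
Proof.
elim: q F => [//|q IH] F /=; rewrite integral_mkcond; apply: eq_integral => x _.
rewrite patchE indicE; case: ifPn => xD; last by rewrite mul0e.
by rewrite mul1e IH.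
Qed.

Lemma eq_witer n q g (F G : 'M[R]_(q, n) -> \bar R) : F =1 G -> witer g F = witer g G.
Proof. by move/funext ->. Qed.

Section weight.
Variables (n : nat) (g : 'rV[R]_n -> R).
Hypotheses (mg : measurable_fun setT g) (g0 : forall x, 0 <= g x).

Let mgE : measurable_fun setT (EFin \o g).
Proof. exact/measurable_EFinP. Qed.

Lemma witer_ge0 q (F : 'M[R]_(q, n) -> \bar R) :
  (forall X, 0 <= F X)%E -> (0 <= witer g F)%E.
Proof.
elim: q F => [|q IH] F F0 /=; first exact: F0.
by apply: integral_ge0 => x _; rewrite mule_ge0 ?lee_fin ?IH.
Qed.

Lemma measurable_witer d (T : measurableType d) q (F : T -> 'M[R]_(q, n) -> \bar R) :
  pmeasurable F -> (forall t X, 0 <= F t X)%E ->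
  measurable_fun setT (fun t => witer g (F t)).
Proof.
elim: q d T F => [|q IH] d T F mF F0 /=.
  by apply: (mF _ T id (fun=> 0)) => // i j.
apply: (measurable_integral1 (mu n)
  (F := fun t x => (g x)%:E * witer g (fun X : 'M[R]_(q, n) => F t (col_mx x X)))%E).
  apply: emeasurable_funM.
    exact: (measurableT_comp (f := EFin \o g)).
  apply: (IH _ _ (fun p X => F p.1 (col_mx p.2 X))) => // d' T' s r ms mr.
  apply: mF; first exact: measurableT_comp.
  apply: entries_measurable_cons => //; exact: measurableT_comp.
by move=> t x; rewrite mule_ge0 ?lee_fin ?witer_ge0.
Qed.

Lemma pmeasurable_col_mx d (T : measurableType d) q (F : 'M[R]_(q.+1, n) -> \bar R)
    (s : T -> 'rV[R]_n) : rows_measurable F -> measurable_fun setT s ->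
  pmeasurable (fun t (X : 'M[R]_(q, n)) => F (col_mx (s t) X)).
Proof.
move=> mF ms d' T' t r mt mr; apply: mF; apply: entries_measurable_cons => //.
exact: (measurableT_comp ms mt).
Qed.

Lemma rows_measurable_col_mx q (F : 'M[R]_(q.+1, n) -> \bar R) (x : 'rV[R]_n) :
  rows_measurable F -> rows_measurable (fun X : 'M[R]_(q, n) => F (col_mx x X)).
Proof.
move=> mF d T r mr; by apply: mF; apply: entries_measurable_cons.
Qed.

Lemma measurable_witer_col_mx q (F : 'M[R]_(q.+1, n) -> \bar R) :
  rows_measurable F -> (forall X, 0 <= F X)%E ->
  measurable_fun setT (fun x => witer g (fun X : 'M[R]_(q, n) => F (col_mx x X))).
Proof.
move=> mF F0; apply: (measurable_witer (F := fun x (X : 'M[R]_(q, n)) => F (col_mx x X))) => //.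
exact: (pmeasurable_col_mx (s := id)).
Qed.

Lemma measurable_weight_witer q (F : 'M[R]_(q.+1, n) -> \bar R) :
  rows_measurable F -> (forall X, 0 <= F X)%E ->
  measurable_fun setT (fun x => (g x)%:E *
    witer g (fun X : 'M[R]_(q, n) => F (col_mx x X)))%E.
Proof.
by move=> mF F0; apply: emeasurable_funM => //; exact: measurable_witer_col_mx.
Qed.

(** The comparison is asked only where all rows have positive weight; for the indicator of K this
    means rows in K, as monotonicity under inclusion of hulls requires. *)
Lemma le_witer q (F G : 'M[R]_(q, n) -> \bar R) :
  rows_measurable F -> rows_measurable G -> (forall X, 0 <= F X)%E ->
  (forall X, (forall i, 0 < g (row i X)) -> (F X <= G X)%E) ->
  (forall X, 0 <= G X)%E ->
  (witer g F <= witer g G)%E.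
Proof.
elim: q F G => [|q IH] F G mF mG F0 FG G0 /=; first by apply: FG => -[].
apply: ge0_le_integral => //.
- by move=> x _; rewrite mule_ge0 ?lee_fin ?witer_ge0.
- exact: measurable_weight_witer.
- exact: measurable_weight_witer.
- move=> x _; have [gx|gx] := eqVneq (g x) 0; first by rewrite gx !mul0e.
  rewrite lee_wpmul2l ?lee_fin//; apply: IH => //; try exact: rows_measurable_col_mx.
  move=> X gX; apply: FG => i; case: (split_ordP (i : 'I_(1 + q))) => j ->.
    by rewrite row_consl lt_neqAle eq_sym gx g0.
  by rewrite row_consr.
Qed.

Lemma witerZ q c (F : 'M[R]_(q, n) -> \bar R) : 0 <= c ->
  rows_measurable F -> (forall X, 0 <= F X)%E ->
  (witer g (fun X => c%:E * F X) = c%:E * witer g F)%E.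
Proof.
elim: q F => [//|q IH] F c0 mF F0 /=.
rewrite -ge0_integralZl//.
- apply: eq_integral => x _; rewrite IH//; first by rewrite muleCA.
  exact: rows_measurable_col_mx.
- exact: measurable_weight_witer.
- by move=> x _; rewrite mule_ge0 ?lee_fin ?witer_ge0.
Qed.

Lemma witerD q (F G : 'M[R]_(q, n) -> \bar R) :
  rows_measurable F -> (forall X, 0 <= F X)%E ->
  rows_measurable G -> (forall X, 0 <= G X)%E ->
  (witer g (fun X => F X + G X) = witer g F + witer g G)%E.
Proof.
elim: q F G => [//|q IH] F G mF F0 mG G0 /=.
rewrite -ge0_integralD//.
- apply: eq_integral => x _; rewrite IH//; try exact: rows_measurable_col_mx.
  by rewrite ge0_muleDr// witer_ge0.
- by move=> x _; rewrite mule_ge0 ?lee_fin ?witer_ge0.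
- exact: measurable_weight_witer.
- by move=> x _; rewrite mule_ge0 ?lee_fin ?witer_ge0.
- exact: measurable_weight_witer.
Qed.

End weight.

Definition map_rows q n m (S : 'rV[R]_n -> 'rV[R]_m) (X : 'M[R]_(q, n)) : 'M[R]_(q, m) :=
  \matrix_(i < q) S (row i X).

Lemma map_rows_col_mx q n m (S : 'rV[R]_n -> 'rV[R]_m) x (X : 'M[R]_(q, n)) :
  map_rows S (col_mx x X) = col_mx (S x) (map_rows S X).
Proof.
apply/matrixP => i j; rewrite mxE; case: (split_ordP (i : 'I_(1 + q))) => k ->.
  by rewrite rowKu (col_mxEu (S x)) ord1 row_id.
by rewrite rowKd (col_mxEd (S x)) mxE.
Qed.

Lemma entries_measurable_map_rows d (T : measurableType d) q n m
    (S : 'rV[R]_n -> 'rV[R]_m) (r : T -> 'M[R]_(q, n)) :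
  measurable_fun setT S -> entries_measurable r ->
  entries_measurable (fun t => map_rows S (r t)).
Proof.
move=> mS mr i j; under eq_fun do rewrite mxE.
apply: measurable_rV_coord_fun; apply: (measurableT_comp mS).
apply/entries_measurable_rV => k l; under eq_fun do rewrite mxE; exact: mr.
Qed.

Lemma rows_measurable_map_rows q n m (S : 'rV[R]_n -> 'rV[R]_m)
    (F : 'M[R]_(q, m) -> \bar R) : measurable_fun setT S -> rows_measurable F ->
  rows_measurable (fun X : 'M[R]_(q, n) => F (map_rows S X)).
Proof. by move=> mS mF d T r mr; apply: mF; exact: entries_measurable_map_rows. Qed.

(** The integral hypothesis says that h is the density of c times the image under [S] of the measure
    with density g. One change of variables per row yields c ^+ q. *)
Lemma witer_map_rows q n m (g : 'rV[R]_n -> R) (h : 'rV[R]_m -> R) c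
    (S : 'rV[R]_n -> 'rV[R]_m) (F : 'M[R]_(q, m) -> \bar R) :
  measurable_fun setT g -> (forall x, 0 <= g x) ->
  measurable_fun setT h -> (forall x, 0 <= h x) ->
  measurable_fun setT S -> 0 <= c ->
  (forall f : 'rV[R]_m -> \bar R, measurable_fun setT f -> (forall x, 0 <= f x)%E ->
    \int[mu m]_y ((h y)%:E * f y) = c%:E * \int[mu n]_x ((g x)%:E * f (S x)))%E ->
  rows_measurable F -> (forall X, 0 <= F X)%E ->
  witer h F = ((c ^+ q)%:E * witer g (fun X => F (map_rows S X)))%E.
Proof.
move=> mg g0 mh h0 mS c0 gh; elim: q F => [|q IH] F mF F0 /=.
  by rewrite expr0 mul1e; congr F; apply/matrixP; case.
rewrite gh//; [|exact: measurable_witer_col_mx|by move=> x; exact: witer_ge0].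
rewrite exprS EFinM -muleA; congr (_ * _)%E.
rewrite -ge0_integralZl ?lee_fin ?exprn_ge0//.
- apply: eq_integral => x _.
  rewrite IH//.
  rewrite muleCA; congr (_ * (_ * _))%E; apply: eq_witer => X.
  by rewrite map_rows_col_mx.
- exact: rows_measurable_col_mx.
- have mFS := rows_measurable_map_rows mS mF.
  exact: (measurable_weight_witer mg g0 mFS).
- by move=> x _; rewrite mule_ge0 ?lee_fin ?witer_ge0.
Qed.

(** Tube lemma: projecting along a compact factor preserves closedness. The equation f = 0 encodes
    the closed relation that is projected. *)
Lemma closed_projection q m n p (K : set 'rV[R]_q)
    (f : 'rV[R]_q * 'M[R]_(m, n) -> 'rV[R]_p) :
  compact K -> continuous f -> closed [set Z | exists2 c, K c & f (c, Z) = 0].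
Proof.
move=> cK cf; rewrite -openC openE => Z0 nZ0.
have nK c : K c -> \forall x \near c & Z \near Z0, f (x, Z) != 0.
  move=> Kc; have fc : f (c, Z0) != 0.
    by apply/eqP => E; apply: nZ0; exists c.
  have oP : open (~` [set (0 : 'rV[R]_p)]).
    by apply: closed_openC; apply: compact_closed_mx; exact: compact_set1.
  have : nbhs (c, Z0) (f @^-1` (~` [set (0 : 'rV[R]_p)])).
    by apply: cf; apply: open_nbhs_nbhs; split => //; exact/eqP.
  by apply: filterS => -[a b] /= /eqP.
have := (compact_near_coveringP K).1 cK _ (nbhs Z0) (fun Z c => f (c, Z) != 0) _ nK.
move=> /(_ (nbhs_filter Z0)); apply: filterS => Z KZ [c Kc fc].
by have := KZ c Kc; rewrite fc eqxx.
Qed.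

Definition hull_volume q m (X : 'M[R]_(q, m)) : \bar R := mu m (hull0 X).

(** That y lies in the hull is a closed condition on y and the vertices together, being the
    projection of an equation along the simplex; the volume is then the measure of a section of a
    measurable set. *)
Lemma rows_measurable_hull_volume q m : rows_measurable (@hull_volume q m).
Proof.
move=> d T r mr.
(* Point and vertices are stacked in one matrix: the first row is y, the others are the vertices. *)
pose C := [set Z : 'M[R]_(1 + q, m) | exists2 c, @simplex R q c &
  c *m dsubmx Z - usubmx Z = 0].
have cC : closed C.
  apply: (closed_projection (f := fun p => p.1 *m dsubmx p.2 - usubmx p.2)).
    exact: compact_simplex.
  have c1 : continuous (fun p : 'rV[R]_q * 'M[R]_(1 + q, m) => p.1 *m dsubmx p.2).
    apply: continuous_mulmx_fun; first by move=> p; exact: cvg_fst.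
    apply: continuous_mx => i j.
    under eq_fun do rewrite mxE.
    apply: continuous_coord; by move=> p; exact: cvg_snd.
  have c2 : continuous (fun p : 'rV[R]_q * 'M[R]_(1 + q, m) => usubmx p.2).
    apply: continuous_mx => i j; under eq_fun do rewrite mxE.
    apply: continuous_coord; by move=> p; exact: cvg_snd.
  by move=> p; apply: (continuousB (c1 p) (c2 p)).
apply: (measurable_measure_section1 (mu m) (B := [set p | hull0 (r p.1) p.2])).
have -> : [set p : T * 'rV[R]_m | hull0 (r p.1) p.2] =
    (fun p => col_mx p.2 (r p.1)) @^-1` C.
  apply/seteqP; split => -[t y] /=; rewrite hull0E.
    by move=> [c cs <-]; exists c => //; rewrite col_mxKu col_mxKd subrr.
  by move=> [c cs]; rewrite col_mxKu col_mxKd => /subr0_eq E; exists c.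
apply: measurable_preimage_closed_mx => //.
apply: entries_measurable_col_mx; first exact/entries_measurable_rV.
exact: (entries_measurable_comp (s := fst)).
Qed.

End iterated.

(** * Volume of the hull as a function of its vertices *)

Section hull_volume.
Variable R : realType.

(** Equal projections mean that X and Y differ row by row by multiples of e_0; each row moves along
    its line at its own speed. *)
Definition e0_convex q n (F : 'M[R]_(q, n.+1) -> \bar R) :=
  forall (th : R) (X Y : 'M[R]_(q, n.+1)), 0 <= th -> th <= 1 ->
  X *m drop_mx R n = Y *m drop_mx R n ->
  (F (th *: X + (1 - th) *: Y)%R <= th%:E * F X + (1 - th)%:E * F Y)%E.

Lemma measurable_hull0 q n (X : 'M[R]_(q, n)) : measurable (hull0 X).
Proof. by apply: compact_measurable_rV; exact: compact_hull0. Qed.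

Lemma measure_hull0_swap q n (X : 'M[R]_(q, n.+1)) :
  (hull_volume X = \int[mu n]_v leb [set t | hull0 X (rV_cons (t, v))])%E.
Proof. by apply: measure_rV_cons_swap; exact: measurable_hull0. Qed.

Lemma measurable_section_hull0 q n (X : 'M[R]_(q, n.+1)) :
  measurable_fun setT (fun v : 'rV[R]_n => leb [set t | hull0 X (rV_cons (t, v))]).
Proof.
apply: (measurable_measure_section2 leb (B := [set p | hull0 X (rV_cons p)])).
apply: measurable_preimageT; first exact: measurable_rV_cons.
exact: measurable_hull0.
Qed.

Lemma section_hull0P q n (X : 'M[R]_(q, n.+1)) t (v : 'rV[R]_n) :
  hull0 X (rV_cons (t, v)) <->
  exists c, [/\ @simplex R q c, c *m (X *m drop_mx R n) = v & (c *m X) ord0 ord0 = t].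
Proof.
rewrite hull0E; split => [[c cs E]|[c [cs <- <-]]].
  by exists c; rewrite mulmxA E rV_cons_drop rV_cons0.
by exists c => //; rewrite [LHS]rV_uncons_drop mulmxA.
Qed.

Lemma measure_itv_cc (a b : R) : a <= b -> leb `[a, b]%classic = (b - a)%:E.
Proof.
move=> ab; rewrite lebesgue_measure_itv/= lte_fin.
by case: ltgtP ab => // -> _; rewrite subrr.
Qed.

Lemma section_hull0_itv q n (X : 'M[R]_(q, n.+1)) (v : 'rV[R]_n) t0 :
  hull0 X (rV_cons (t0, v)) ->
  exists a b, a <= b /\ [set t | hull0 X (rV_cons (t, v))] = `[a, b]%classic.
Proof.
move=> h; apply: compact_itvP; first exact/compact_section/compact_hull0.
  by exists t0.
move=> x y t hx hy t0' t1; apply: convex_section => //; exact: convex_hull0.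
Qed.

(** Volume along a shadow system. With the barycentric weights fixed, a point of the hull over v
    moves linearly in [th], so the section of the mixture over v lies in the mixture of the two
    sections, which are intervals. *)
Lemma hull_volume_e0_convex q n : e0_convex (@hull_volume R q n.+1).
Proof.
move=> th X Y th0 th1 XY; rewrite 3!measure_hull0_swap.
rewrite -ge0_integralZl ?lee_fin ?subr_ge0//; last exact: measurable_section_hull0.
rewrite -ge0_integralZl ?lee_fin ?subr_ge0//; last exact: measurable_section_hull0.
rewrite -ge0_integralD//; last 4 first.
- by move=> x _; rewrite mule_ge0.
- by apply: emeasurable_funM => //; exact: measurable_section_hull0.
- by move=> x _; rewrite mule_ge0 ?lee_fin ?subr_ge0.
- by apply: emeasurable_funM => //; exact: measurable_section_hull0.
apply: ge0_le_integral => //.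
- exact: measurable_section_hull0.
- apply: emeasurable_funD; apply: emeasurable_funM => //; exact: measurable_section_hull0.
move=> v _; set Z := th *: X + _.
have ZX : Z *m drop_mx R n = X *m drop_mx R n.
  by rewrite mulmxDl -!scalemxAl -XY -scalerDl addrC subrK scale1r.
have [[t0 /section_hull0P[c [cs cv _]]]|] :=
    pselect ([set t | hull0 Z (rV_cons (t, v))] !=set0); last first.
  move/set0P/negP/negPn/eqP => ->; rewrite measure0.
  by rewrite adde_ge0// mule_ge0 ?lee_fin ?subr_ge0.
have [a [b [ab Xab]]] : exists a b, a <= b /\
    [set t | hull0 X (rV_cons (t, v))] = `[a, b]%classic.
  apply: (section_hull0_itv (t0 := (c *m X) ord0 ord0)); apply/section_hull0P.
  by exists c; rewrite -ZX.
have [a' [b' [ab' Yab]]] : exists a b, a <= b /\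
    [set t | hull0 Y (rV_cons (t, v))] = `[a, b]%classic.
  apply: (section_hull0_itv (t0 := (c *m Y) ord0 ord0)); apply/section_hull0P.
  by exists c; rewrite -XY -ZX.
rewrite Xab Yab !measure_itv_cc//.
have sub : [set t | hull0 Z (rV_cons (t, v))] `<=`
    `[th * a + (1 - th) * a', th * b + (1 - th) * b']%classic.
  move=> t /section_hull0P[d [ds dv dt]].
  have /= : `[a, b]%classic ((d *m X) ord0 ord0).
    by rewrite -Xab; apply/section_hull0P; exists d; rewrite -ZX.
  rewrite in_itv/= => /andP[ax xb].
  have /= : `[a', b']%classic ((d *m Y) ord0 ord0).
    by rewrite -Yab; apply/section_hull0P; exists d; rewrite -XY -ZX.
  rewrite in_itv/= => /andP[ay yb].
  have -> : t = th * (d *m X) ord0 ord0 + (1 - th) * (d *m Y) ord0 ord0.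
    by rewrite -dt mulmxDr -!scalemxAr !mxE.
  by rewrite /= in_itv/=; apply/andP; split; apply: lerD; apply: ler_wpM2l;
    rewrite ?subr_ge0.
apply: (@le_trans _ _ (leb `[th * a + (1 - th) * a', th * b + (1 - th) * b']%classic)).
  apply: le_measure => //; rewrite inE.
    apply: compact_measurable; exact/compact_section/compact_hull0.
  exact: measurable_itv.
rewrite measure_itv_cc; last by apply: lerD; apply: ler_wpM2l; rewrite ?subr_ge0.
rewrite -!EFinM -EFinD lee_fin; lra.
Qed.

Lemma hull_volume_orthogonal q n (X : 'M[R]_(q, n)) (Q : 'M[R]_n) :
  is_orthogonal Q -> hull_volume (X *m Q) = hull_volume X.
Proof.
move=> oQ; rewrite /hull_volume -hull0_mulmx volume_orthogonal//.
exact: measurable_hull0.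
Qed.

Lemma hull_volume_ge0 q n (X : 'M[R]_(q, n)) : (0 <= hull_volume X)%E.
Proof. exact: measure_ge0. Qed.

Lemma hull_volume_le q n (X : 'M[R]_(q, n)) (A : set 'rV[R]_n) :
  compact A -> is_convex A -> A 0 -> (forall i, A (row i X)) ->
  (hull_volume X <= mu n A)%E.
Proof.
move=> cA coA A0 XA; apply: le_measure; rewrite ?inE.
- exact: measurable_hull0.
- exact: compact_measurable_rV.
- exact: hull0_sub.
Qed.

Lemma hull_volumeZ q n (X : 'M[R]_(q, n)) (r : R) : 0 < r ->
  hull_volume (r *: X) = ((r ^+ n)%:E * hull_volume X)%E.
Proof.
move=> r0; rewrite /hull_volume -measure_dilate//; last first.
  exact: measurable_hull0.
congr (mu n _); rewrite /dilate !hull0E; apply/seteqP; split.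
  by move=> _ [c cs <-]; exists (c *m X); [exists c|rewrite scalemxAr].
by move=> _ [_ [c cs <-] <-]; exists c => //; rewrite scalemxAr.
Qed.

End hull_volume.

(** * Steiner symmetrization of a weight *)

Section weighted_integral.
Local Open Scope ereal_scope.
Context d (T : measurableType d) (R : realType).
Variables (f : T -> \bar R).
Hypotheses (mf : measurable_fun setT f) (f0 : forall x, 0 <= f x).
Let h := nnsfun_approx measurableT mf.

Import HBNNSimple.

Let integral_approx d' (T' : measurableType d') (m : {measure set T' -> \bar R})
    (w : T' -> R) (phi : T' -> T) :
  measurable_fun setT w -> (forall x, (0 <= w x)%R) -> measurable_fun setT phi ->
  \int[m]_x ((w x)%:E * f (phi x)) = limn (fun k => \sum_(y \in range (h k))
    (y%:E * \int[m]_x ((w x)%:E * (\1_(h k @^-1` [set y]) (phi x))%:E))).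
Proof.
move=> mw w0 mphi.
have mwE : measurable_fun setT (EFin \o w) by exact/measurable_EFinP.
have mi k r : measurable_fun setT (fun x => (\1_(h k @^-1` [set r]) (phi x))%:E : \bar R).
  apply/measurable_EFinP.
  by apply: (measurableT_comp (f := \1_(h k @^-1` [set r]) : T -> measurableTypeR R)).
have mh k : measurable_fun setT (fun x => (h k (phi x))%:E : \bar R).
  apply/measurable_EFinP; exact: (measurableT_comp (measurable_funP (h k)) mphi).
transitivity (limn (fun k => \int[m]_x ((w x)%:E * (h k (phi x))%:E))).
  rewrite -monotone_convergence//.
  - apply: eq_integral => x _; apply/esym/cvg_lim => //.
    apply: cvgeZl => //; exact: (cvg_nnsfun_approx measurableT mf (fun x _ => f0 x)).
  - by move=> k; apply: emeasurable_funM.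
  - by move=> k x _; rewrite mule_ge0 ?lee_fin.
  - move=> x _ a b ab; rewrite lee_wpmul2l ?lee_fin//.
    exact/lefP/nd_nnsfun_approx.
congr (limn _); apply/funext => k.
transitivity (\int[m]_x \sum_(y \in range (h k))
    (y%:E * ((w x)%:E * (\1_(h k @^-1` [set y]) (phi x))%:E))).
  apply: eq_integral => x _.
  rewrite {1}(fimfunE (h k) (phi x)) -fsumEFin// ge0_mule_fsumr.
    by apply: eq_fsbigr => y _; rewrite muleCA EFinM.
  move=> y; exact: nnfun_muleindic_ge0.
have pos y : range (h k) y -> (0 <= y)%R by move=> [z _ <-].
rewrite ge0_integral_fsum//.
- apply: eq_fsbigr => y /[!inE] yr; rewrite ge0_integralZl ?lee_fin ?pos//.
    exact: emeasurable_funM.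
  by move=> x _; rewrite mule_ge0 ?lee_fin.
- move=> y; apply: emeasurable_funM => //; exact: emeasurable_funM.
- move=> y x _; rewrite muleCA mule_ge0 ?lee_fin//; exact: nnfun_muleindic_ge0.
Qed.

(** Agreement on sets extends to functions through simple functions increasing to f and monotone
    convergence. *)
Lemma eq_weighted_integral d1 d2 (T1 : measurableType d1) (T2 : measurableType d2)
    (m1 : {measure set T1 -> \bar R}) (m2 : {measure set T2 -> \bar R})
    (w1 : T1 -> R) (w2 : T2 -> R) (phi1 : T1 -> T) (phi2 : T2 -> T) :
  measurable_fun setT w1 -> (forall x, (0 <= w1 x)%R) -> measurable_fun setT phi1 ->
  measurable_fun setT w2 -> (forall x, (0 <= w2 x)%R) -> measurable_fun setT phi2 ->
  (forall A, measurable A -> \int[m1]_x ((w1 x)%:E * (\1_A (phi1 x))%:E) =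
    \int[m2]_x ((w2 x)%:E * (\1_A (phi2 x))%:E)) ->
  \int[m1]_x ((w1 x)%:E * f (phi1 x)) = \int[m2]_x ((w2 x)%:E * f (phi2 x)).
Proof.
move=> mw1 w10 mp1 mw2 w20 mp2 E; rewrite !integral_approx//.
congr (limn _); apply/funext => k; apply: eq_fsbigr => y _; congr (_ * _).
exact: E.
Qed.

End weighted_integral.

Lemma quantile_expanding_arith (R : realType) (a b m s s' q q' : R) :
  m - s <= a -> b <= m - s' -> a <= b + (q' - q) -> s' - s <= q' - q.
Proof. lra. Qed.

Lemma centered_arith (R : realType) (a m s : R) :
  a <= m -> m / 2 - a < s -> - (m / 2) < s.
Proof. lra. Qed.

Section quantile.
Variable R : realType.
Implicit Types (f : R -> R) (t s r : R).

Definition mass f : R := fine (\int[leb]_u (f u)%:E)%E.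
Definition tail f t : R := fine (\int[leb]_(u in `]t, +oo[) (f u)%:E)%E.

(* Pushes Lebesgue measure on ]-l/2, l/2[, where l is the mass of f, forward to
   the density f. *)
Definition quantile r f s : R :=
  inf [set t | - r <= t /\ tail f t <= Num.max 0 (mass f / 2 - s)].

Variables (r : R) (f : R -> R).
Hypotheses (r0 : 0 <= r) (mf : measurable_fun setT f).
Hypotheses (f0 : forall t, 0 <= f t) (f1 : forall t, f t <= 1).
Hypothesis fr : forall t, r < `|t| -> f t = 0.

Let mfE (D : set (measurableTypeR R)) : measurable_fun D (EFin \o f).
Proof. by apply: measurable_funTS; exact/measurable_EFinP. Qed.

Let mass_le : (\int[leb]_u (f u)%:E <= (2 * r)%:E)%E.
Proof.
have leb_r : leb (`[- r, r]%classic : set (measurableTypeR R)) = (2 * r)%:E.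
  rewrite measure_itv_cc; first by congr EFin; ring.
  by rewrite (le_trans _ r0)// oppr_le0.
have -> : ((2 * r)%:E = \int[leb]_u (\1_(`[- r, r]%classic : set (measurableTypeR R)) u)%:E)%E.
  by rewrite -leb_r; apply: measure_integral_indic; exact: measurable_itv.
apply: ge0_le_integral => //.
- by move=> u _; rewrite lee_fin.
- exact: measurable_indicE.
move=> u _; rewrite lee_fin indicE.
have [ur|ur] := leP `|u| r; last by rewrite fr.
by rewrite mem_set//= in_itv/= -ler_norml.
Qed.

Lemma massE : (\int[leb]_u (f u)%:E = (mass f)%:E)%E.
Proof.
rewrite /mass fineK// ge0_fin_numE ?(le_lt_trans mass_le) ?ltry//.
by apply: integral_ge0 => u _; rewrite lee_fin.
Qed.

Lemma mass_le2 : mass f <= 2 * r.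
Proof. by rewrite -lee_fin -massE; exact: mass_le. Qed.

Lemma tailE t : (\int[leb]_(u in `]t, +oo[) (f u)%:E = (tail f t)%:E)%E.
Proof.
rewrite /tail fineK// ge0_fin_numE; last by apply: integral_ge0 => u _; rewrite lee_fin.
apply: (@le_lt_trans _ _ (\int[leb]_u (f u)%:E)%E); last by rewrite massE ltry.
by apply: ge0_subset_integral => // u _; rewrite lee_fin.
Qed.

Lemma tail_ge0 t : 0 <= tail f t.
Proof. by rewrite -lee_fin -tailE; apply: integral_ge0 => u _; rewrite lee_fin. Qed.

Let tailD t t' : t <= t' ->
  ((tail f t)%:E = \int[leb]_(u in `]t, t']) (f u)%:E + (tail f t')%:E)%E.
Proof.
move=> tt'; rewrite -!tailE.
rewrite (itv_bndbnd_setU (x := BRight t')) ?bnd_simp//.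
rewrite ge0_integral_setU//=.
- by move=> u _; rewrite lee_fin.
- apply/disj_setPS => u /= []; rewrite !in_itv/= andbT => /andP[_ h].
  by rewrite ltNge h.
Qed.

Lemma tail_anti t t' : t <= t' -> tail f t' <= tail f t.
Proof.
move=> tt'; rewrite -lee_fin (tailD tt') leeDr//.
by apply: integral_ge0 => u _; rewrite lee_fin.
Qed.

(** This is where f <= 1 enters. It makes [tail] continuous, so that levels are attained at the
    quantile, and it is the reason why the quantile map expands. *)
Lemma tail_lipschitz t t' : t <= t' -> tail f t <= tail f t' + (t' - t).
Proof.
move=> tt'; rewrite -lee_fin EFinD (tailD tt') addeC leeD2l//.
have -> : ((t' - t)%:E = leb `]t, t']%classic)%E.
  rewrite lebesgue_measure_itv/= lte_fin; case: ltgtP tt' => // -> _.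
  by rewrite subrr.
rewrite -[leRHS]mul1e -[in leRHS]integral_cst//.
apply: ge0_le_integral => //; first by move=> u _; rewrite lee_fin.
by move=> u _; rewrite lee_fin.
Qed.

Lemma tail_right t : r <= t -> tail f t = 0.
Proof.
move=> rt; apply: EFin_inj; rewrite -tailE; apply: integral0_eq => u /=.
rewrite in_itv/= andbT => tu; rewrite fr//.
by rewrite (lt_le_trans _ (ler_norm _))// (le_lt_trans rt).
Qed.

Lemma tail_left t : t <= - r -> tail f t = mass f.
Proof.
move=> rt.
have tlt t' : t' < - r -> tail f t' = mass f.
  move=> tr; apply: EFin_inj; rewrite -tailE -massE.
  rewrite integral_mkcond; apply: eq_integral => u _; rewrite patchE.
  case: ifPn => //; rewrite notin_setE/= in_itv/= andbT => /negP; rewrite -leNgt => ut.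
  rewrite fr//; have : u < - r by exact: le_lt_trans ut tr.
  by rewrite ltrNr => /lt_le_trans; apply; rewrite -normrN ler_norm.
apply/eqP; rewrite eq_le; apply/andP; split.
  by rewrite -(tlt (t - 1)); [apply: tail_anti|]; lra.
apply/ler_addgt0Pr => e e0; rewrite -(tlt (t - e)); last lra.
by rewrite (le_trans (tail_lipschitz (t' := t) _))//; lra.
Qed.

Let level s := Num.max 0 (mass f / 2 - s).
Let ray s := [set t | - r <= t /\ tail f t <= level s].

(** The bound - r <= t and the truncation of the level at 0 ensure that, for every real s, the
    infimum is over a nonempty set bounded below. *)
Let has_inf_ray s : has_inf (ray s).
Proof.
split; last by exists (- r) => t [].
exists r; split; first by rewrite (le_trans _ r0)// oppr_le0.
by rewrite tail_right// le_max lexx.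
Qed.

Lemma quantile_ge s : - r <= quantile r f s.
Proof. by apply: lb_le_inf; [case: (has_inf_ray s)|move=> t []]. Qed.

Let quantile_le t s : ray s t -> quantile r f s <= t.
Proof. by move=> h; apply: ge_inf => //; case: (has_inf_ray s). Qed.

Let tail_quantile_le s : tail f (quantile r f s) <= level s.
Proof.
apply/ler_addgt0Pr => e e0.
have [t [rt tl] te] := inf_adherent e0 (has_inf_ray s).
have qt : quantile r f s <= t by exact: quantile_le.
by rewrite (le_trans (tail_lipschitz qt))// lerD// lerBlDl ltW.
Qed.

Let le_tail_quantile s : mass f / 2 - s <= mass f ->
  level s <= tail f (quantile r f s) \/ mass f / 2 - s < 0.
Proof.
move=> sm; have [|ls] := ltP (mass f / 2 - s) 0; [by right|left].
have lE : level s = mass f / 2 - s by rewrite /level max_r.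
have [qr|qr] := eqVneq (quantile r f s) (- r); first by rewrite qr tail_left// lE.
have {}qr : - r < quantile r f s by rewrite lt_neqAle eq_sym qr quantile_ge.
apply/ler_addgt0Pr => e e0.
(* A point just left of the quantile, yet not left of - r, has tail above the level; the Lipschitz
   bound carries this to the quantile. *)
pose t := Num.max (- r) (quantile r f s - e).
have tq : t < quantile r f s by rewrite gt_max qr/= gtrBl.
have : level s < tail f t.
  rewrite ltNge; apply/negP => h; move: tq; rewrite ltNge => /negP; apply.
  by apply: quantile_le; split => //; rewrite le_max lexx.
move=> /ltW/le_trans; apply; apply: le_trans (tail_lipschitz (ltW tq)) _.
by rewrite lerD2l lerBlDl -lerBlDr le_max lexx orbT.
Qed.

(** The Galois connection of a generalized inverse. It removes the infimum: measurability of the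
    quantile and the image of Lebesgue measure are both read off it. *)
Lemma lt_quantile t s : - r <= t ->
  (t < quantile r f s) = (Num.max 0 (mass f / 2 - s) < tail f t).
Proof.
move=> rt; apply/idP/idP; apply: contraTT; rewrite -!leNgt => h.
  exact: quantile_le.
exact: (le_trans (tail_anti h)).
Qed.

(** Between the two quantiles lies mass at least s' - s of f, and since f <= 1 it needs an interval
    of at least that length. *)
Lemma quantile_expanding s s' : - (mass f / 2) <= s -> s <= s' -> s' <= mass f / 2 ->
  s' - s <= quantile r f s' - quantile r f s.
Proof.
move=> hs ss' hs'.
have qq : quantile r f s <= quantile r f s'.
  apply: lb_le_inf; first by case: (has_inf_ray s').
  move=> t [rt tl]; apply: quantile_le; split => //; apply: (le_trans tl).
  by rewrite le_max2// lerD2l lerN2.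
have /(_ _)[|h|h] := @le_tail_quantile s; [lra| |lra].
have h' := tail_quantile_le s'; have := tail_lipschitz qq.
have lE : level s = mass f / 2 - s by rewrite /level max_r// subr_ge0 (le_trans ss').
have lE' : level s' = mass f / 2 - s' by rewrite /level max_r// subr_ge0.
by move: h h'; rewrite lE lE'  => h1 h2 h3; exact: (quantile_expanding_arith h1 h2 h3).
Qed.

Definition centered_itv : set (measurableTypeR R) := [set s | `|s| < mass f / 2].

Lemma measurable_centered_itv : measurable centered_itv.
Proof.
rewrite (_ : centered_itv = `](- (mass f / 2)), (mass f / 2)[%classic); first exact: measurable_itv.
by apply/seteqP; split => s /=; rewrite /centered_itv/= in_itv/= ltr_norml.
Qed.

Lemma measure_itv_oo (a b : R) : a <= b -> leb `]a, b[%classic = (b - a)%:E.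
Proof.
move=> ab; rewrite lebesgue_measure_itv/= lte_fin.
by case: ltgtP ab => // -> _; rewrite subrr.
Qed.

Let leb_centered_tail t : tail f t <= mass f ->
  leb [set s | centered_itv s /\ mass f / 2 - s < tail f t] = (tail f t)%:E.
Proof.
move=> tm.
have -> : [set s | centered_itv s /\ mass f / 2 - s < tail f t] =
    `](mass f / 2 - tail f t), (mass f / 2)[%classic.
  apply/seteqP; split => s; rewrite /centered_itv/= in_itv/= ltr_norml.
    by case=> /andP[_ ->]; rewrite ltrBlDr addrC -ltrBlDr => ->.
  move=> /andP[h1 h2]; split; first by rewrite h2 (centered_arith tm h1).
  by rewrite ltrBlDr addrC -ltrBlDr.
rewrite measure_itv_oo; first by congr EFin; ring.
by rewrite gerBl tail_ge0.
Qed.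

Lemma measure_centered_itv : leb centered_itv = (mass f)%:E.
Proof.
rewrite -(tail_left (t := - r))// -(leb_centered_tail (t := - r)) ?tail_left//.
congr (leb _); apply/seteqP; split => [s hs|s []//]; split => //.
by move: hs; rewrite /centered_itv/= ltr_norml => /andP[h _]; rewrite ltrBlDr -ltrBlDl; move: h; move: (mass f) => a; lra.
Qed.

(** Dynkin's theorem from the open rays, where [lt_quantile] identifies the preimage. Both measures
    have the finite total [mass f], which settles complements. *)
Let density_quantile (A : set (measurableTypeR R)) :
  measurable_fun setT (quantile r f : measurableTypeR R -> measurableTypeR R) ->
  measurable A ->
  (\int[leb]_(t in A) (f t)%:E = leb (centered_itv `&` quantile r f @^-1` A))%E.
Proof.
move=> mq; rewrite {1}RGenOInfty.measurableE.
have mpre (B : set (measurableTypeR R)) : measurable B ->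
    measurable (centered_itv `&` quantile r f @^-1` B).
  move=> mB; apply: measurableI; first exact: measurable_centered_itv.
  exact: measurable_preimageT.
apply: (dynkin_induction (P := fun A => (\int[leb]_(t in A) (f t)%:E =
    leb (centered_itv `&` quantile r f @^-1` A))%E)) => //.
- exact: RGenOInfty.measurableE.
- move=> _ _ [x ->] [y ->]; exists (Num.max x y).
  by apply/seteqP; split => t; rewrite /= !in_itv/= !andbT gt_max => /andP.
- by rewrite preimage_setT setIT massE measure_centered_itv.
- move=> _ [x ->]; rewrite tailE; have [rx|rx] := leP (- r) x; last first.
    rewrite tail_left ?(ltW rx)// -measure_centered_itv; congr (leb _).
    apply/seteqP; split => [s hs|s []//]; split => //=.
    by rewrite in_itv/= andbT (lt_le_trans rx)// quantile_ge.
  rewrite -leb_centered_tail; last first.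
    by rewrite -(tail_left (t := - r))// tail_anti.
  have lev s : centered_itv s -> Num.max 0 (mass f / 2 - s) = mass f / 2 - s.
    rewrite /centered_itv/= ltr_norml => /andP[_ h].
    by rewrite max_r// subr_ge0 ltW.
  congr (leb _); apply/seteqP; split => s [hs].
    by move=> h; split => //=; rewrite in_itv/= andbT lt_quantile// lev.
  by rewrite /= in_itv/= andbT lt_quantile// lev.
- move=> S mS IH.
  have E1 : (\int[leb]_(t in S) (f t)%:E + \int[leb]_(t in ~` S) (f t)%:E = (mass f)%:E)%E.
    rewrite -massE -(setUv S) ge0_integral_setU//; first exact: measurableC.
    - by move=> u _; rewrite lee_fin.
    - by rewrite disj_set2E setICr.
  have E2 : (leb (centered_itv `&` quantile r f @^-1` S) +
      leb (centered_itv `&` quantile r f @^-1` (~` S)) = (mass f)%:E)%E.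
    rewrite -measure_centered_itv -measureU//.
    - by rewrite -setIUr -preimage_setU setUv preimage_setT setIT.
    - exact: mpre.
    - by apply: mpre; exact: measurableC.
    - by apply/seteqP; split => s //= [[_ h1] [_ h2]].
  have fin : (\int[leb]_(t in S) (f t)%:E \is a fin_num)%E.
    rewrite ge0_fin_numE; last by apply: integral_ge0 => u _; rewrite lee_fin.
    rewrite (@le_lt_trans _ _ (mass f)%:E) ?ltry// -E1 leeDl//.
    by apply: integral_ge0 => u _; rewrite lee_fin.
  have cancel x y (a : \bar R) : a \is a fin_num -> (a + x = a + y -> x = y)%E.
    move=> af; rewrite [(a + x)%E]addeC [(a + y)%E]addeC => axy.
    by rewrite -(addeK x af) axy addeK.
  by apply: (cancel _ _ _ fin); rewrite E1 IH E2.
- move=> F mF tF IH; rewrite ge0_integral_bigcup//.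
  + rewrite preimage_bigcup setI_bigcupr measure_bigcup//.
    * rewrite [RHS](eq_eseriesl (Q := xpredT)); last by move=> k; rewrite in_setT.
      by apply: eq_eseriesr => k _; exact: IH.
    * by move=> k _; exact: mpre.
    * apply/trivIsetP => i j _ _ ij; apply/seteqP; split => s //= [[_ h1] [_ h2]].
      by move/trivIsetP : tF => /(_ i j I I ij)/seteqP[+ _]; apply; split; eassumption.
  + by move=> u _; rewrite lee_fin.
Qed.

Lemma quantile_transport (h : R -> \bar R) :
  measurable_fun setT (quantile r f : measurableTypeR R -> measurableTypeR R) ->
  measurable_fun setT h -> (forall t, 0 <= h t)%E ->
  (\int[leb]_t ((f t)%:E * h t) =
   \int[leb]_s ((\1_centered_itv s)%:E * h (quantile r f s)))%E.
Proof.
move=> mq mh h0.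
have mc := @measurable_indic _ _ R setT _ measurable_centered_itv.
have mid : measurable_fun setT (id : measurableTypeR R -> measurableTypeR R) by [].
apply: (@eq_weighted_integral _ _ _ h mh h0 _ _ _ _ leb leb f \1_centered_itv id
  (quantile r f) mf f0 mid mc _ mq).
  by move=> x; rewrite indicE.
move=> A mA.
transitivity (\int[leb]_(t in A) (f t)%:E)%E.
  rewrite [RHS]integral_mkcond; apply: eq_integral => t _; rewrite patchE indicE.
  by case: (t \in A); rewrite ?mule1 ?mule0.
rewrite density_quantile// measure_integral_indic.
  apply: eq_integral => t _; rewrite -EFinM !indicE in_setI.
  by rewrite -[in RHS]natrM mulnb.
apply: measurableI; first exact: measurable_centered_itv.
exact: measurable_preimageT.
Qed.

End quantile.

Section symmetrization.
Variables (R : realType) (n : nat) (g : 'rV[R]_n.+1 -> R) (r : R).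

Definition slice (z : 'rV[R]_n) (t : R) : R := g (rV_cons (t, z)).

(** On each line parallel to e_0, the open centred interval whose length is the mass of g there.
    This is not the layerwise symmetrization of g: the mass is packed with density 1. *)
Definition star : set 'rV[R]_n.+1 :=
  [set x : 'rV[R]_n.+1 | `|x ord0 ord0| < mass (slice (x *m drop_mx R n)) / 2].

Definition transport (x : 'rV[R]_n.+1) : 'rV[R]_n.+1 :=
  rV_cons (quantile r (slice (x *m drop_mx R n)) (x ord0 ord0), x *m drop_mx R n).

Hypotheses (r0 : 0 <= r) (mg : measurable_fun setT g).
Hypotheses (g0 : forall x, 0 <= g x) (g1 : forall x, g x <= 1).
Hypothesis gr : forall x : 'rV[R]_n.+1, r < `|x ord0 ord0| -> g x = 0.

Let measurable_cons_l (z : 'rV[R]_n) :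
  measurable_fun setT (fun t : measurableTypeR R => rV_cons (t, z)).
Proof. by apply: measurable_rV_cons_fun => //; exact: (@measurable_cst _ _ _ _ setT z). Qed.

Lemma measurable_slice z : measurable_fun setT (slice z).
Proof. exact: (measurableT_comp mg (measurable_cons_l z)). Qed.

Let slice_ge0 z t : 0 <= slice z t. Proof. exact: g0. Qed.
Let slice_le1 z t : slice z t <= 1. Proof. exact: g1. Qed.
Let slice_r z t : r < `|t| -> slice z t = 0.
Proof. by move=> h; apply: gr; rewrite rV_cons0. Qed.

Let measurable_slice2 : measurable_fun setT
  (fun p : measurableTypeR R * 'rV[R]_n => (slice p.2 p.1)%:E).
Proof.
apply/measurable_EFinP.
exact: (measurableT_comp mg (@measurable_rV_cons R n)).
Qed.

Lemma measurable_mass_slice : measurable_fun setT (fun z => mass (slice z)).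
Proof.
apply: measurableT_comp; first exact: fine_measurable.
apply: (measurable_integral2 leb (F := fun t z => (slice z t)%:E)) => //.
by move=> t z; rewrite lee_fin.
Qed.

Lemma measurable_tail_slice t : measurable_fun setT (fun z => tail (slice z) t).
Proof.
apply: measurableT_comp; first exact: fine_measurable.
under eq_fun do rewrite integral_mkcond.
apply: (measurable_integral2 leb
  (F := fun u z => ((fun u => (slice z u)%:E) \_ `]t, +oo[) u)).
  rewrite (_ : (fun p => _) = (fun p : measurableTypeR R * 'rV[R]_n =>
     (\1_(`]t, +oo[%classic : set (measurableTypeR R)) p.1)%:E * (slice p.2 p.1)%:E)%E).
    apply: emeasurable_funM => //.
    have m1 : measurable_fun setT (fun u : measurableTypeR R =>
        (\1_(`]t, +oo[%classic : set (measurableTypeR R)) u)%:E : \bar R).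
      by apply: measurable_indicE; exact: measurable_itv.
    exact: (measurableT_comp m1 measurable_fst).
  apply/funext => p; rewrite patchE indicE.
  by case: (p.1 \in _); rewrite ?mul1e ?mul0e.
by move=> u z; rewrite patchE; case: ifP => //; rewrite lee_fin.
Qed.

(** Preimages of open rays suffice; [lt_quantile] describes them by masses and tails of slices,
    which are measurable in z by Tonelli. Rays that start left of - r have full preimage. *)
Lemma measurable_quantile_slice d (T : measurableType d)
    (s : T -> measurableTypeR R) (z : T -> 'rV[R]_n) :
  measurable_fun setT s -> measurable_fun setT z ->
  measurable_fun setT (fun x => quantile r (slice (z x)) (s x) : measurableTypeR R).
Proof.
move=> ms mz; apply: (measurability _ (RGenOInfty.measurableE R)).
move=> _ [_ [t ->] <-]; rewrite setTI.
have [rt|rt] := leP (- r) t.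
  have -> : (fun x => quantile r (slice (z x)) (s x)) @^-1` `]t, +oo[ =
      (fun x => Num.max 0 (mass (slice (z x)) / 2 - s x) < tail (slice (z x)) t) @^-1` [set true].
    apply/seteqP; split => x /=; rewrite in_itv/= andbT;
      by rewrite (lt_quantile r0 (@measurable_slice (z x)) (slice_ge0 (z x)) (slice_le1 (z x)) (@slice_r (z x))).
  rewrite -[X in measurable X]setTI.
  apply: (measurable_fun_ltr _ _ measurableT) => //.
    apply: measurable_maxr; first exact: measurable_cst.
    apply: measurable_funB => //; apply: measurable_funM; last exact: measurable_cst.
    exact: (measurableT_comp measurable_mass_slice mz).
  exact: (measurableT_comp (measurable_tail_slice t) mz).
rewrite (_ : _ @^-1` _ = setT)//; apply/seteqP; split => x //= _.
by rewrite in_itv/= andbT (lt_le_trans rt)// (quantile_ge r0 (@measurable_slice (z x)) (slice_ge0 (z x)) (slice_le1 (z x)) (@slice_r (z x))).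
Qed.

Lemma measurable_drop : measurable_fun setT (fun x : 'rV[R]_n.+1 => x *m drop_mx R n).
Proof. exact: (measurable_mulmx (f := id)). Qed.

Lemma measurable_transport : measurable_fun setT transport.
Proof.
apply: measurable_rV_cons_fun; last exact: measurable_drop.
apply: measurable_quantile_slice; last exact: measurable_drop.
exact: measurable_rV_coord.
Qed.

Lemma measurable_star : measurable star.
Proof.
rewrite (_ : star = (fun x : 'rV[R]_n.+1 => `|x ord0 ord0| <
  mass (slice (x *m drop_mx R n)) / 2) @^-1` [set true]) //.
rewrite -[X in measurable X]setTI; apply: (measurable_fun_ltr _ _ measurableT) => //.
  apply: (measurableT_comp (f := fun x : measurableTypeR R => `|x| : measurableTypeR R)).
    exact: normr_measurable.
  exact: measurable_rV_coord.
apply: measurable_funM; last exact: measurable_cst.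
exact: (measurableT_comp measurable_mass_slice measurable_drop).
Qed.

Lemma transport_integral (f : 'rV[R]_n.+1 -> \bar R) :
  measurable_fun setT f -> (forall x, 0 <= f x)%E ->
  (\int[mu n.+1]_x ((g x)%:E * f x) =
   \int[mu n.+1]_x ((\1_star x)%:E * f (transport x)))%E.
Proof.
move=> mf f0.
have mT := measurable_transport.
have mS : measurable_fun setT (fun x => (\1_star x)%:E : \bar R).
  by apply: measurable_indicE; exact: measurable_star.
have m1 : measurable_fun setT (fun x => (g x)%:E * f x)%E.
  by apply: emeasurable_funM => //; exact/measurable_EFinP.
have m2 : measurable_fun setT (fun x => (\1_star x)%:E * f (transport x))%E.
  by apply: emeasurable_funM => //; exact: (measurableT_comp mf).
have p1 x : (0 <= (g x)%:E * f x)%E by rewrite mule_ge0 ?lee_fin.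
have p2 x : (0 <= (\1_star x)%:E * f (transport x))%E.
  by rewrite mule_ge0 ?lee_fin ?indicE.
rewrite (integral_rV_cons m1 p1) (integral_rV_cons m2 p2).
rewrite (tonelli_swap leb (mu n) (F := fun t z => (g (rV_cons (t, z)))%:E * f (rV_cons (t, z)))%E); last first.
- by move=> t z; exact: p1.
- exact: (measurableT_comp m1 (@measurable_rV_cons R n)).
rewrite (tonelli_swap leb (mu n) (F := fun t z => (\1_star (rV_cons (t, z)))%:E *
    f (transport (rV_cons (t, z))))%E); last first.
- by move=> t z; exact: p2.
- exact: (measurableT_comp m2 (@measurable_rV_cons R n)).
apply: eq_integral => z _.
have mz := measurableT_comp mf (measurable_cons_l z).
have mq : measurable_fun setT
    (quantile r (slice z) : measurableTypeR R -> measurableTypeR R).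
  apply: (measurable_quantile_slice (s := id) (z := fun=> z)) => //.
have E := quantile_transport r0 (@measurable_slice z) (slice_ge0 z) (slice_le1 z)
  (@slice_r z) mq mz (fun t => f0 _).
apply: (etrans E); apply: eq_integral => s _.
rewrite !indicE /transport rV_cons0 rV_cons_drop/=.
congr (_%:R%:E * _)%E; congr nat_of_bool.
by apply/idP/idP; rewrite !inE /star/= rV_cons_drop rV_cons0.
Qed.

End symmetrization.

(** * Monotonicity of the integral under symmetrization *)

Section flip.
Variable R : realType.

Lemma scale_cons q n (a : R) (x : 'rV[R]_n) (X : 'M[R]_(q, n)) :
  a *: (col_mx x X : 'M[R]_(q.+1, n)) = col_mx (a *: x) (a *: X).
Proof. exact: (@scale_col_mx _ 1 q n). Qed.

Lemma add_cons q n (x y : 'rV[R]_n) (X Y : 'M[R]_(q, n)) :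
  (col_mx x X : 'M[R]_(q.+1, n)) + col_mx y Y = col_mx (x + y) (X + Y).
Proof. exact: (@add_col_mx _ 1 q n). Qed.

Lemma mul_cons q n m (x : 'rV[R]_n) (X : 'M[R]_(q, n)) (Q : 'M[R]_(n, m)) :
  (col_mx x X : 'M[R]_(q.+1, n)) *m Q = col_mx (x *m Q) (X *m Q).
Proof. exact: (@mul_col_mx _ 1 q n m). Qed.

Lemma affine_same (V : lmodType R) (a : R) (x : V) : a *: x + (1 - a) *: x = x.
Proof. by rewrite -scalerDl [a + _]addrC subrK scale1r. Qed.

Lemma mix_mixC (th : R) (a b : \bar R) : 0 <= th -> th <= 1 ->
  (0 <= a -> 0 <= b ->
   (th%:E * a + (1 - th)%:E * b) + ((1 - th)%:E * a + th%:E * b) = a + b)%E.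
Proof.
move=> th0 th1 a0 b0; have th2 : 0 <= 1 - th by rewrite subr_ge0.
rewrite addeACA -ge0_muleDl ?lee_fin// -ge0_muleDl ?lee_fin// -!EFinD.
have -> : th + (1 - th) = 1 by ring.
by rewrite subrK !mul1e.
Qed.

Definition flip n : 'M[R]_n.+1 := block_mx (-1)%:M 0 0 1%:M : 'M[R]_(1 + n).

Lemma rV_cons_flip n (p : measurableTypeR R * 'rV[R]_n) :
  rV_cons p *m flip n = rV_cons (- p.1, p.2).
Proof.
rewrite /flip rV_cons_mul_lblock; congr (rV_cons (_, _)); last by rewrite mulmx1.
by rewrite mulmx0 !mxE eqxx mulr1n addr0 mulN1r.
Qed.

Lemma flip0 n (x : 'rV[R]_n.+1) : (x *m flip n) ord0 ord0 = - x ord0 ord0.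
Proof. by rewrite (rV_uncons_drop x) rV_cons_flip !rV_cons0. Qed.

Lemma flip_drop n q (X : 'M[R]_(q, n.+1)) : X *m flip n *m drop_mx R n = X *m drop_mx R n.
Proof.
apply/row_matrixP => i; rewrite !row_mul.
by rewrite [row i X]rV_uncons_drop rV_cons_flip !rV_cons_drop.
Qed.

Lemma flipK n q (X : 'M[R]_(q, n.+1)) : X *m flip n *m flip n = X.
Proof.
apply/row_matrixP => i; rewrite !row_mul [row i X]rV_uncons_drop !rV_cons_flip/=.
by rewrite opprK.
Qed.

Lemma orthogonal_flip n : is_orthogonal (flip n).
Proof.
rewrite /is_orthogonal; have -> : (flip n)^T = flip n.
  by rewrite /flip (@tr_block_mx _ 1 n 1 n) !tr_scalar_mx !trmx0.
by rewrite -[LHS]mul1mx mulmxA flipK.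
Qed.

Lemma integral_orthogonal n (Q : 'M[R]_n) (F : 'rV[R]_n -> \bar R) :
  is_orthogonal Q -> measurable_fun setT F -> (forall x, 0 <= F x)%E ->
  (\int[mu n]_x F (x *m Q)%R = \int[mu n]_x F x)%E.
Proof.
move=> oQ mF F0; rewrite [RHS](det_scaling_unit (orthogonal_unit oQ) mF F0).
by rewrite orthogonal_det// mul1e.
Qed.

Lemma map_rows_mulmx q n m (Q : 'M[R]_(n, m)) (X : 'M[R]_(q, n)) :
  map_rows (fun x => x *m Q) X = X *m Q.
Proof. by apply/row_matrixP => i; rewrite rowK row_mul. Qed.

Lemma measurable_fun_mulmx n (Q : 'M[R]_n) : measurable_fun setT (fun x : 'rV[R]_n => x *m Q).
Proof. exact: (measurable_mulmx (f := id)). Qed.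

Lemma witer_orthogonal q n (Q : 'M[R]_n) (g : 'rV[R]_n -> R) (F : 'M[R]_(q, n) -> \bar R) :
  is_orthogonal Q -> measurable_fun setT g -> (forall x, 0 <= g x) ->
  rows_measurable F -> (forall X, 0 <= F X)%E ->
  witer g F = witer (fun x => g (x *m Q)) (fun X => F (X *m Q)).
Proof.
move=> oQ mg g0 mF F0; have mQ := measurable_fun_mulmx Q.
rewrite (@witer_map_rows R q n n (fun x => g (x *m Q)) g 1 (fun x => x *m Q))//.
- by rewrite expr1n mul1e; apply: eq_witer => X; rewrite map_rows_mulmx.
- exact: (measurableT_comp mg mQ).
- move=> f mf f0; rewrite mul1e; apply/esym.
  apply: (integral_orthogonal oQ (F := fun x => (g x)%:E * f x)%E).
    by apply: emeasurable_funM => //; exact/measurable_EFinP.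
  by move=> x; rewrite mule_ge0 ?lee_fin.
Qed.

Lemma rows_measurable_mulmx q n (Q : 'M[R]_n) (F : 'M[R]_(q, n) -> \bar R) :
  rows_measurable F -> rows_measurable (fun X => F (X *m Q)).
Proof.
move=> mF; have := rows_measurable_map_rows (measurable_fun_mulmx Q) mF.
by under eq_fun do rewrite map_rows_mulmx.
Qed.

End flip.

Section expansion.
Variables (R : realType) (n : nat) (w : 'rV[R]_n.+1 -> R).
Hypotheses (mw : measurable_fun setT w) (w0 : forall x, 0 <= w x).
Hypothesis wflip : forall x : 'rV[R]_n.+1, w (x *m flip R n) = w x.

Lemma e0_convex_witer q (F : 'M[R]_(q.+1, n.+1) -> \bar R) :
  rows_measurable F -> (forall X, 0 <= F X)%E -> e0_convex F ->
  e0_convex (fun x : 'M[R]_(1, n.+1) =>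
    witer w (fun X : 'M[R]_(q, n.+1) => F (col_mx x X))).
Proof.
move=> mF F0 cF th x y th0 th1 xy.
have mx (z : 'rV[R]_n.+1) := rows_measurable_col_mx (q := q) z mF.
have mZ (a : R) (G : 'M[R]_(q, n.+1) -> \bar R) : rows_measurable G ->
    rows_measurable (fun X => a%:E * G X)%E.
  by move=> mG d T r mr; apply: emeasurable_funM => //; exact: mG.
have th1' : 0 <= 1 - th by rewrite subr_ge0.
rewrite -(witerZ mw w0 th0)// -(witerZ mw w0 th1')// -witerD//; first last.
- by move=> X; rewrite mule_ge0.
- exact: mZ.
- by move=> X; rewrite mule_ge0.
- exact: mZ.
apply: le_witer => //.
- move=> d T r mr; apply: emeasurable_funD.
    exact: (mZ th _ (mx x) _ _ _ mr).
  exact: (mZ (1 - th) _ (mx y) _ _ _ mr).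
- move=> X _.
  have -> : col_mx (th *: x + (1 - th) *: y) X =
      th *: (col_mx x X : 'M[R]_(q.+1, n.+1)) + (1 - th) *: col_mx y X.
    by rewrite !scale_cons add_cons affine_same.
  by apply: cF => //; rewrite !mul_cons xy.
- by move=> X; rewrite adde_ge0// mule_ge0.
Qed.

Variable S : 'rV[R]_n.+1 -> 'rV[R]_n.+1.
Hypotheses (mS : measurable_fun setT S).
Hypothesis S_drop : forall x, S x *m drop_mx R n = x *m drop_mx R n.
Hypothesis S_flip : forall x, S (x *m flip R n) = S x *m flip R n.
Hypothesis S_le : forall x, 0 < w x -> `|x ord0 ord0| <= `|S x ord0 ord0|.

(* By oddness and S_le, x is a convex combination of S x and its flip, and the
   flip of x is the combination with the weights exchanged. *)
Lemma integral_odd_expansion (H : 'rV[R]_n.+1 -> \bar R) :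
  measurable_fun setT H -> (forall x, 0 <= H x)%E ->
  e0_convex (H : 'M[R]_(1, n.+1) -> \bar R) ->
  (\int[mu n.+1]_x ((w x)%:E * H x) <= \int[mu n.+1]_x ((w x)%:E * H (S x)))%E.
Proof.
move=> mH H0 cH.
have mwE : measurable_fun setT (EFin \o w) by exact/measurable_EFinP.
have mf : measurable_fun setT (fun x : 'rV[R]_n.+1 => x *m flip R n).
  exact: measurable_fun_mulmx.
(* Evenness of w folds the integral, so that only the sum of H at x and at its reflection has to be
   compared pointwise. *)
have dbl (G : 'rV[R]_n.+1 -> \bar R) : measurable_fun setT G -> (forall x, 0 <= G x)%E ->
    (2%:E * \int[mu n.+1]_x ((w x)%:E * G x) =
     \int[mu n.+1]_x ((w x)%:E * (G x + G (x *m flip R n)%R)))%E.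
  move=> mG G0; have mwG : measurable_fun setT (fun x => (w x)%:E * G x)%E.
    exact: emeasurable_funM.
  have wG0 x : (0 <= (w x)%:E * G x)%E by rewrite mule_ge0 ?lee_fin.
  rewrite [in RHS](eq_integral (fun x => (w x)%:E * G x +
    (w (x *m flip R n)%R)%:E * G (x *m flip R n)%R)%E); last first.
    by move=> x _; rewrite wflip ge0_muleDr.
  rewrite ge0_integralD//; last exact: (measurableT_comp mwG mf).
  rewrite (integral_orthogonal (orthogonal_flip R n) mwG wG0).
  by rewrite mule_natl mule2n.
have mHS := measurableT_comp mH mS.
rewrite -(@lee_pmul2l _ 2%:E)// dbl// (dbl (H \o S) mHS); last by move=> x; exact: H0.
apply: ge0_le_integral => //.
- by move=> x _; rewrite mule_ge0 ?lee_fin// adde_ge0.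
- apply: emeasurable_funM => //; apply: emeasurable_funD => //.
  exact: (measurableT_comp mH mf).
- apply: emeasurable_funM => //; apply: emeasurable_funD => //.
  exact: (measurableT_comp mHS mf).
move=> x _; have [wx|wx] := eqVneq (w x) 0; first by rewrite wx !mul0e.
rewrite lee_wpmul2l ?lee_fin//= S_flip.
have {wx} sS : `|x ord0 ord0| <= `|S x ord0 ord0| by apply: S_le; rewrite lt_neqAle eq_sym wx w0.
set s := x ord0 ord0 in sS; set t := S x ord0 ord0 in sS.
(* Solves s = (2 th - 1) t; the case t = 0 forces s = 0, and then the weight 1 serves. *)
pose th := if t == 0 then 1 else (1 + s / t) / 2.
have [th0 th1 ths] : [/\ 0 <= th, th <= 1 & s = th * t - (1 - th) * t].
  rewrite /th; have [t0|t0] := eqVneq t 0.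
    have -> : s = 0 by apply/eqP; move: sS; rewrite t0 normr0 normr_le0.
    by rewrite t0 !mulr0 subr0; split.
  have : `|s / t| <= 1 by rewrite normrM normfV ler_pdivrMr ?mul1r// normr_gt0.
  rewrite ler_norml => /andP[h1 h2]; split; [lra|lra|].
  by rewrite -mulrBl; field.
have rep y c : y *m drop_mx R n = x *m drop_mx R n -> y ord0 ord0 = (2 * c - 1) * t ->
    y = c *: S x + (1 - c) *: (S x *m flip R n).
  move=> yx y0; rewrite [LHS]rV_uncons_drop [RHS]rV_uncons_drop; congr (rV_cons (_, _)).
    rewrite y0 [in RHS]mxE [X in _ = X + _]mxE [X in _ = _ + X]mxE flip0 -/t; ring.
  rewrite mulmxDl -!scalemxAl flip_drop S_drop -scalerDl.
  by rewrite [c + _]addrC subrK scale1r.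
have Sd : S x *m drop_mx R n = S x *m flip R n *m drop_mx R n by rewrite flip_drop.
have E1 : (H x <= th%:E * H (S x) + (1 - th)%:E * H (S x *m flip R n)%R)%E.
  rewrite {1}(rep x th erefl); first exact: cH.
  by rewrite -/s ths; ring.
have E2 : (H (x *m flip R n)%R <= (1 - th)%:E * H (S x) + th%:E * H (S x *m flip R n)%R)%E.
  rewrite {1}(rep (x *m flip R n) (1 - th)) ?flip_drop//; last first.
    by rewrite flip0 -/s ths; ring.
  have := cH (1 - th) (S x) (S x *m flip R n).
  have -> : 1 - (1 - th) = th by ring.
  apply => //; first by rewrite subr_ge0.
  by rewrite gerBl.
apply: le_trans (leeD E1 E2) _.
by rewrite mix_mixC.
Qed.

(** One row at a time: the first row moves with the others integrated out, then the others move with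
    the first held at its new place. *)
Lemma witer_odd_expansion q (F : 'M[R]_(q, n.+1) -> \bar R) :
  rows_measurable F -> (forall X, 0 <= F X)%E -> e0_convex F ->
  (witer w F <= witer w (fun X => F (map_rows S X)))%E.
Proof.
elim: q F => [|q IH] F mF F0 cF /=.
  by rewrite (_ : map_rows S 0 = 0)//; apply/matrixP; case.
have mH := measurable_witer_col_mx mw w0 mF F0.
apply: le_trans.
  apply: (integral_odd_expansion mH); last exact: e0_convex_witer.
  by move=> x; exact: witer_ge0.
have mFS := rows_measurable_map_rows mS mF.
apply: ge0_le_integral => //.
- by move=> x _; rewrite mule_ge0 ?lee_fin ?witer_ge0.
- apply: emeasurable_funM; first exact/measurable_EFinP.
  exact: (measurableT_comp mH mS).
- exact: (measurable_weight_witer mw w0 mFS).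
move=> x _; rewrite lee_wpmul2l ?lee_fin//.
rewrite [leRHS](eq_witer _ (G := fun X : 'M[R]_(q, n.+1) => F (col_mx (S x) (map_rows S X)))).
  apply: IH => //; first exact: rows_measurable_col_mx.
  move=> th X Y th0 th1 XY.
  have := cF th (col_mx (S x) X) (col_mx (S x) Y) th0 th1.
  rewrite !scale_cons add_cons affine_same.
  by apply; rewrite !mul_cons XY.
by move=> X; rewrite map_rows_col_mx.
Qed.

End expansion.

Section symmetrization_decreases.
Variables (R : realType) (n q : nat) (F : 'M[R]_(q, n.+1) -> \bar R).
Hypotheses (mF : rows_measurable F) (F0 : forall X, (0 <= F X)%E) (cF : e0_convex F).
Hypothesis F_flip : forall X, F (X *m flip R n) = F X.

(** The conjugate of [T] by the reflection gives the same integral, since [w] and [F] are invariant,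
    and convexity is applied at the midpoint of the two images. The averaged map is odd, which [T]
    need not be. *)
Lemma witer_average (w : 'rV[R]_n.+1 -> R) (T : 'rV[R]_n.+1 -> 'rV[R]_n.+1) :
  measurable_fun setT w -> (forall x, 0 <= w x) ->
  (forall x : 'rV[R]_n.+1, w (x *m flip R n) = w x) ->
  measurable_fun setT T -> (forall x, T x *m drop_mx R n = x *m drop_mx R n) ->
  (witer w (fun X => F (map_rows (fun x => 2^-1 *: (T x + T (x *m flip R n) *m flip R n)) X))
   <= witer w (fun X => F (map_rows T X)))%E.
Proof.
move=> mw w0 wf mT Td.
have mf : measurable_fun setT (fun x : 'rV[R]_n.+1 => x *m flip R n).
  exact: measurable_fun_mulmx.
have mFT := rows_measurable_map_rows mT mF.
have mFTf := rows_measurable_mulmx (flip R n) mFT.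
set S := fun x : 'rV[R]_n.+1 => _.
have mS : measurable_fun setT S.
  apply: (measurable_scalemx (a := fun=> 2^-1)); first exact: measurable_cst.
  apply: measurable_addmx => //; apply: (measurableT_comp mf).
  exact: (measurableT_comp mT mf).
have E : witer w (fun X => F (map_rows T (X *m flip R n))) = witer w (fun X => F (map_rows T X)).
  rewrite [RHS](witer_orthogonal (orthogonal_flip R n))//.
  by congr witer; apply/funext => x; rewrite wf.
have half0 : 0 <= 2^-1 :> R by rewrite invr_ge0.
have half (W : \bar R) : (0 <= W -> W = (2^-1)%:E * (W + W))%E.
  move=> W0; rewrite ge0_muleDr// -ge0_muleDl ?lee_fin// -EFinD.
  have -> : 2^-1 + 2^-1 = 1 :> R by field.
  by rewrite mul1e.
rewrite [leRHS]half; last exact: witer_ge0.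
rewrite -{2}E -witerD// -witerZ//; last 2 first.
- by move=> d T' t mt; apply: emeasurable_funD; [exact: mFT|exact: mFTf].
- by move=> X; rewrite adde_ge0.
apply: le_witer => //.
- exact: rows_measurable_map_rows.
- move=> d T' t mt; apply: emeasurable_funM => //.
  by apply: emeasurable_funD; [exact: mFT|exact: mFTf].
- move=> X _.
  have -> : map_rows S X =
      2^-1 *: map_rows T X + (1 - 2^-1) *: (map_rows T (X *m flip R n) *m flip R n).
    have -> : 1 - 2^-1 = 2^-1 :> R by field.
    apply/row_matrixP => i; rewrite raddfD/= !linearZ/= row_mul !rowK row_mul.
    by rewrite /S scalerDr.
  apply: (le_trans (cF half0 _ _)); first by rewrite invf_le1// ler1n.
    apply/row_matrixP => i; rewrite !row_mul !rowK flip_drop !Td row_mul.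
    by rewrite flip_drop.
  have -> : 1 - 2^-1 = 2^-1 :> R by field.
  by rewrite F_flip ge0_muleDr.
- by move=> X; rewrite mule_ge0 ?adde_ge0.
Qed.

End symmetrization_decreases.

Section symmetrization_theorem.
Variables (R : realType) (n q : nat) (F : 'M[R]_(q, n.+1) -> \bar R).
Hypotheses (mF : rows_measurable F) (F0 : forall X, (0 <= F X)%E) (cF : e0_convex F).
Hypothesis F_flip : forall X, F (X *m flip R n) = F X.
Variables (g : 'rV[R]_n.+1 -> R) (r : R).
Hypotheses (r0 : 0 <= r) (mg : measurable_fun setT g).
Hypotheses (g0 : forall x, 0 <= g x) (g1 : forall x, g x <= 1).
Hypothesis gr : forall x : 'rV[R]_n.+1, r < `|x ord0 ord0| -> g x = 0.

Lemma star_flip (x : 'rV[R]_n.+1) : \1_(star g) (x *m flip R n) = \1_(star g) x :> R.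
Proof.
rewrite !indicE; congr (nat_of_bool _)%:R; apply/idP/idP; rewrite !inE /star/=;
  by rewrite flip_drop flip0 normrN.
Qed.

(** [transport] pushes the indicator of [star g] forward to the weight g. Replacing it by its odd
    average lowers the integral, and so does replacing that odd expanding map by the identity. *)
Lemma witer_star : (witer \1_(star g) F <= witer g F)%E.
Proof.
have mT := measurable_transport r0 mg g0 g1 gr.
have mst := measurable_star mg g0.
have mi : measurable_fun setT (\1_(star g) : 'rV[R]_n.+1 -> R) by exact: measurable_indic.
have i0 x : 0 <= \1_(star g) x :> R by rewrite indicE.
have mf : measurable_fun setT (fun x : 'rV[R]_n.+1 => x *m flip R n).
  exact: measurable_fun_mulmx.
have Td x : transport g r x *m drop_mx R n = x *m drop_mx R n by rewrite rV_cons_drop.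
rewrite (@witer_map_rows R q _ _ \1_(star g) g 1 (transport g r))//; last first.
  by move=> f mf' f0; rewrite mul1e; exact: transport_integral.
rewrite expr1n mul1e.
pose S (x : 'rV[R]_n.+1) :=
  2^-1 *: (transport g r x + transport g r (x *m flip R n) *m flip R n).
have A : (witer \1_(star g) (fun X => F (map_rows S X)) <=
    witer \1_(star g) (fun X => F (map_rows (transport g r) X)))%E.
  exact: (witer_average mF F0 cF F_flip mi i0 star_flip mT Td).
apply: le_trans A.
have mS : measurable_fun setT S.
  apply: (measurable_scalemx (a := fun=> 2^-1)); first exact: measurable_cst.
  apply: measurable_addmx => //; apply: (measurableT_comp mf).
  exact: (measurableT_comp mT mf).
apply: (witer_odd_expansion mi i0 star_flip mS) => //.
- move=> x; rewrite /S -scalemxAl mulmxDl flip_drop !Td flip_drop.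
  rewrite scalerDr -scalerDl.
  have -> : 2^-1 + 2^-1 = 1 :> R by field.
  by rewrite scale1r.
- by move=> x; rewrite /S -scalemxAl mulmxDl !flipK addrC.
move=> x; rewrite indicE ltr0n lt0b inE /star/=.
set z := x *m drop_mx R n; set s := x ord0 ord0.
(* The odd part of the quantile map at s. The quantiles at - s and s are at least 2 |s| apart, so
   its modulus is at least |s|. *)
have -> : S x ord0 ord0 = 2^-1 * (quantile r (slice g z) s - quantile r (slice g z) (- s)).
  by rewrite /S mxE [X in _ * X]mxE flip0 /transport !rV_cons0 flip_drop flip0.
have sr t : r < `|t| -> slice g z t = 0 by move=> h; apply: gr; rewrite rV_cons0.
have qe := quantile_expanding r0 (@measurable_slice R n g mg z)
  (fun t => g0 _) (fun t => g1 _) sr.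
move: qe; move: (mass _) (quantile r _) => m Q qe.
rewrite ltr_norml => /andP[h1 h2].
rewrite normrM [`|2^-1|]ger0_norm ?invr_ge0// mulrC ler_pdivlMr//.
have [s0|s0] := leP 0 s.
  have := qe (- s) s; rewrite (ger0_norm s0) => q'.
  apply: le_trans (ler_norm _); apply: le_trans (q' _ _ _); lra.
have := qe s (- s); rewrite (ltr0_norm s0) => q'.
rewrite -normrN; apply: le_trans (ler_norm _); rewrite opprB; apply: le_trans (q' _ _ _); lra.
Qed.

End symmetrization_theorem.

(** * Convergence of symmetrizations to the ball *)

Section overlap1.
Variables (R : realType) (r : R) (f : R -> R).
Hypotheses (r0 : 0 <= r) (mf : measurable_fun setT f).
Hypotheses (f0 : forall t, 0 <= f t) (f1 : forall t, f t <= 1).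
Hypothesis fr : forall t, r < `|t| -> f t = 0.

Let sym (b : R) : set (measurableTypeR R) := [set t | `|t| <= b].

Let symE b : sym b = `[- b, b]%classic.
Proof. by apply/seteqP; split => t; rewrite /sym/= in_itv/= ler_norml. Qed.

Let measurable_sym b : measurable (sym b).
Proof. by rewrite symE; exact: measurable_itv. Qed.

Let measure_sym b : 0 <= b -> leb (sym b) = (2 * b)%:E.
Proof.
move=> b0; rewrite symE measure_itv_cc; first by congr EFin; ring.
by rewrite (le_trans _ b0)// oppr_le0.
Qed.

Lemma integral_translate1 (F : measurableTypeR R -> \bar R) (l : R) :
  measurable_fun setT F -> (forall t, 0 <= F t)%E ->
  (\int[leb]_t F (t + l)%R = \int[leb]_t F t)%E.
Proof.
move=> mF F0; rewrite [RHS](@integral_affine _ 1 l F)// ?oner_neq0//.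
by rewrite normr1 mul1e; apply: eq_integral => t _; rewrite mul1r.
Qed.

(** The right side is the minimum of [mass f] and 2 b, both intervals being centred. These numbers
    are the common mass plus the integral of [X], respectively of [Y], and the product of [X] with
    the translate of [Y] is at most either factor. *)
Lemma overlap1 (b l : R) : 0 <= b ->
  (\int[leb]_t (f t * \1_(sym b) t)%:E +
   \int[leb]_t (f t * (1 - \1_(sym b) t) * ((1 - f (t + l)) * \1_(sym b) (t + l)))%:E <=
   leb (centered_itv f `&` sym b))%E.
Proof.
move=> b0; set g := fun t : measurableTypeR R => \1_(sym b) t : R.
have mg : measurable_fun setT g by exact: measurable_indic.
have g0 t : 0 <= g t by rewrite /g indicE.
have g1 t : g t <= 1 by rewrite /g indicE lern1 leq_b1.
have mfb : measurable_fun setT (fun t : measurableTypeR R => (f t * g t)%:E).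
  by apply/measurable_EFinP; exact: measurable_funM.
have fb0 t : (0 <= (f t * g t)%:E)%E by rewrite lee_fin mulr_ge0.
pose X t := f t * (1 - g t); pose Y t := (1 - f t) * g t.
have mX : measurable_fun setT (fun t : measurableTypeR R => (X t)%:E).
  by apply/measurable_EFinP; apply: measurable_funM => //; apply: measurable_funB.
have mY : measurable_fun setT (fun t : measurableTypeR R => (Y t)%:E).
  by apply/measurable_EFinP; apply: measurable_funM => //; apply: measurable_funB.
have X0 t : 0 <= X t by rewrite mulr_ge0 ?subr_ge0.
have Y0 t : 0 <= Y t by rewrite mulr_ge0 ?subr_ge0.
have X1 t : X t <= 1 by rewrite mulr_ile1 ?subr_ge0// gerBl.
have Y1 t : Y t <= 1 by rewrite mulr_ile1 ?subr_ge0// gerBl.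
have mtr : measurable_fun setT (fun t : measurableTypeR R => t + l : measurableTypeR R).
  by apply: measurable_funD.
have mYl := measurableT_comp mY mtr.
have mXY : measurable_fun setT (fun t : measurableTypeR R => (X t * Y (t + l))%:E).
  by under eq_fun do rewrite EFinM; exact: emeasurable_funM.
have XY0 t : (0 <= (X t * Y (t + l))%:E)%E by rewrite lee_fin mulr_ge0.
have fE : (\int[leb]_t (f t * g t)%:E + \int[leb]_t (X t)%:E = (mass f)%:E)%E.
  rewrite -(massE r0)//.
  rewrite -ge0_integralD//; last by move=> t _; rewrite lee_fin.
  by apply: eq_integral => t _; rewrite -EFinD /X; congr EFin; ring.
have gE : (\int[leb]_t (f t * g t)%:E + \int[leb]_t (Y t)%:E = (2 * b)%:E)%E.
  rewrite -measure_sym// measure_integral_indic//.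
  rewrite -ge0_integralD//; last by move=> t _; rewrite lee_fin.
  by apply: eq_integral => t _; rewrite -EFinD /Y -/(g t); congr EFin; ring.
have le1 : (\int[leb]_t (X t * Y (t + l)%R)%:E <= \int[leb]_t (X t)%:E)%E.
  by apply: ge0_le_integral => // t _; rewrite lee_fin ler_piMr.
have le2 : (\int[leb]_t (X t * Y (t + l)%R)%:E <= \int[leb]_t (Y t)%:E)%E.
  rewrite -(integral_translate1 l mY); last by move=> t; rewrite lee_fin.
  by apply: ge0_le_integral => // t _; rewrite lee_fin ler_piMl.
have {}le1 := leeD2l (\int[leb]_t (f t * g t)%:E)%E le1.
have {}le2 := leeD2l (\int[leb]_t (f t * g t)%:E)%E le2.
rewrite fE in le1; rewrite gE in le2.
have [mb|mb] := leP (mass f / 2) b.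
  apply: le_trans le1 _; rewrite (_ : _ `&` _ = centered_itv f) ?(measure_centered_itv r0)//.
  apply/seteqP; split => [t []//|t H]; split => //.
  by move: H; rewrite /centered_itv /sym/= => h; rewrite (le_trans (ltW h)).
apply: le_trans le2 _; rewrite (_ : _ `&` _ = sym b) ?measure_sym//.
apply/seteqP; split => [t []//|t H]; split => //.
by move: H; rewrite /centered_itv /sym/= => h; rewrite (le_lt_trans h).
Qed.

End overlap1.

Section admissible.
Variables (R : realType) (n : nat).

Definition admissible m (r v : R) (g : 'rV[R]_m -> R) :=
  [/\ measurable_fun setT g, forall x, 0 <= g x <= 1,
      forall x, r < enorm x -> g x = 0 & (\int[mu m]_x (g x)%:E = v%:E)%E].

Lemma enorm_rV_cons (t : R) (z : 'rV[R]_n) :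
  enorm (rV_cons (t, z)) ^+ 2 = t ^+ 2 + enorm z ^+ 2.
Proof.
rewrite !enorm_sqr /dot big_ord_recl rV_cons0 -expr2; congr (_ + _).
by apply: eq_bigr => i _; rewrite rV_consS.
Qed.

Lemma chord_sqr_ge m (r : R) (z : 'rV[R]_m) : r ^+ 2 - enorm z ^+ 2 <= chord r z ^+ 2.
Proof.
rewrite /chord; have [h|h] := leP 0 (r ^+ 2 - enorm z ^+ 2); first by rewrite (sqr_sqrtr h).
by rewrite (le_trans (ltW h))// sqr_ge0.
Qed.

Lemma slice_chord (r : R) (g : 'rV[R]_n.+1 -> R) z t : 0 <= r ->
  (forall x, r < enorm x -> g x = 0) -> chord r z < `|t| -> slice g z t = 0.
Proof.
move=> r0 gr h; apply: gr; rewrite -(@ltr_pXn2r _ 2)// ?nnegrE ?enorm_ge0//.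
rewrite enorm_rV_cons -ltrBlDr (le_lt_trans (chord_sqr_ge _ _))//.
by rewrite -[ltRHS]real_normK ?num_real// ltr_pXn2r// nnegrE sqrtr_ge0.
Qed.

(** The support stays in the ball of radius r: the slice over z is carried by a chord and has
    density at most 1, so its mass is at most the length of that chord. *)
Lemma star_admissible r v (g : 'rV[R]_n.+1 -> R) : 0 <= r ->
  admissible r v g -> admissible r v \1_(star g).
Proof.
move=> r0 [mg g01 gr gv].
have g0 x : 0 <= g x by case/andP: (g01 x).
have g1 x : g x <= 1 by case/andP: (g01 x).
have gr0 (x : 'rV[R]_n.+1) : r < `|x ord0 ord0| -> g x = 0.
  by move=> h; apply: gr; rewrite (lt_le_trans h)// coord_le_enorm.
have mst := measurable_star mg g0.
split.
- exact: measurable_indic.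
- by move=> x; rewrite indicE ler0n lern1 leq_b1.
- move=> x; apply: contraPeq; rewrite indicE pnatr_eq0 eqb0 negbK inE /star/= => xs.
  apply/negP; rewrite -leNgt; move: xs.
  set z := x *m drop_mx R n => xs.
  have c0 : 0 <= chord r z by exact: sqrtr_ge0.
  have xc : `|x ord0 ord0| < chord r z.
    apply: lt_le_trans xs _; rewrite ler_pdivrMr// mulrC.
    apply: (mass_le2 c0 (@measurable_slice R n g mg z)) => t; [exact: g0|exact: g1|].
    exact: slice_chord.
  have : 0 < r ^+ 2 - enorm z ^+ 2.
    rewrite ltNge; apply/negP => /ler0_sqrtr c; move: xc.
    by rewrite /chord c ltNge normr_ge0.
  move=> /ltW h; rewrite -(@ler_pXn2r _ 2)// ?nnegrE ?enorm_ge0//.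
  rewrite [x]rV_uncons_drop enorm_rV_cons -/z -lerBrDr -(sqr_sqrtr h).
  by rewrite -[leLHS]real_normK ?num_real// ler_pXn2r// ?nnegrE// ltW.
- rewrite -gv; transitivity (\int[mu n.+1]_x ((\1_(star g) x)%:E * 1))%E.
    by apply: eq_integral => x _; rewrite mule1.
  rewrite -(@transport_integral R n g r r0 mg g0 g1 gr0 (fun=> 1%E))//.
    by apply: eq_integral => x _; rewrite mule1.
Qed.

Lemma orthogonal_admissible m r v (g : 'rV[R]_m -> R) (Q : 'M[R]_m) :
  is_orthogonal Q -> admissible r v g -> admissible r v (fun x => g (x *m Q)).
Proof.
move=> oQ [mg g01 gr gv]; split => //.
- exact: (measurableT_comp mg (measurable_fun_mulmx Q)).
- by move=> x h; apply: gr; rewrite orthogonal_enorm.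
- rewrite -gv; apply: (integral_orthogonal oQ (F := fun x => (g x)%:E)).
    exact/measurable_EFinP.
  by move=> x; rewrite lee_fin; case/andP: (g01 x).
Qed.

End admissible.

Section overlap.
Variable R : realType.

Lemma integral_rV_cons_swap n (F : 'rV[R]_n.+1 -> \bar R) :
  measurable_fun setT F -> (forall x, 0 <= F x)%E ->
  (\int[mu n.+1]_x F x = \int[mu n]_z \int[leb]_t F (rV_cons (t, z)))%E.
Proof.
move=> mF F0; rewrite (integral_rV_cons mF F0).
apply: (tonelli_swap leb (mu n) (F := fun t z => F (rV_cons (t, z)))) => //.
exact: (measurableT_comp mF (@measurable_rV_cons R n)).
Qed.

Lemma measurable_integral_rV_cons n (F : 'rV[R]_n.+1 -> \bar R) :
  measurable_fun setT F -> (forall x, 0 <= F x)%E ->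
  measurable_fun setT (fun z => \int[leb]_t F (rV_cons (t, z)))%E.
Proof.
move=> mF F0; apply: (measurable_integral2 leb (F := fun t z => F (rV_cons (t, z)))) => //.
exact: (measurableT_comp mF (@measurable_rV_cons R n)).
Qed.

Lemma rV_cons_shift n (t l : R) (z : 'rV[R]_n) :
  rV_cons (t, z) + l *: delta_mx ord0 ord0 = rV_cons (t + l, z).
Proof.
have -> : l *: delta_mx ord0 ord0 = rV_cons (l, (0 : 'rV[R]_n)) :> 'rV_n.+1.
  by apply: rV_consP => [|i]; rewrite ?rV_cons0 ?rV_consS !mxE ?eqxx ?mulr1 ?mulr0.
by rewrite rV_consD addr0.
Qed.

Definition ball0 n (r : R) : set 'rV[R]_n := [set x | enorm x <= r].

Lemma measurable_ball0 n r : measurable (@ball0 n r).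
Proof. by apply: closed_measurable_rV; exact: eball_closed. Qed.

(** [outer] and [defect] are the positive and negative parts of g minus the indicator of the ball
    when 0 <= g <= 1. They have equal mass when g has the mass of the ball. *)
Definition outer n (r : R) (g : 'rV[R]_n -> R) x : R := g x * (1 - \1_(ball0 r) x).
Definition defect n (r : R) (g : 'rV[R]_n -> R) x : R := (1 - g x) * \1_(ball0 r) x.

Section weight.
Variables (n : nat) (rho : R) (g : 'rV[R]_n -> R).
Hypotheses (mg : measurable_fun setT g) (g0 : forall x, 0 <= g x) (g1 : forall x, g x <= 1).

Let b (x : 'rV[R]_n) : R := \1_(ball0 rho) x.
Let mb : measurable_fun setT b. Proof. by apply: measurable_indic; exact: measurable_ball0. Qed.
Let b0 x : 0 <= b x. Proof. by rewrite /b indicE. Qed.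
Let b1 x : b x <= 1. Proof. by rewrite /b indicE lern1 leq_b1. Qed.

Lemma measurable_outer : measurable_fun setT (outer rho g).
Proof. by apply: measurable_funM => //; apply: measurable_funB. Qed.

Lemma measurable_defect : measurable_fun setT (defect rho g).
Proof. by apply: measurable_funM => //; apply: measurable_funB. Qed.

Lemma outer_ge0 x : 0 <= outer rho g x.
Proof. by rewrite mulr_ge0// subr_ge0. Qed.

Lemma defect_ge0 x : 0 <= defect rho g x.
Proof. by rewrite mulr_ge0// subr_ge0. Qed.

Lemma measurable_inner : measurable_fun setT (fun x => (g x * \1_(ball0 rho) x)%:E).
Proof. by apply/measurable_EFinP; exact: measurable_funM. Qed.

Lemma inner_ge0 x : 0 <= g x * \1_(ball0 rho) x.
Proof. by rewrite mulr_ge0. Qed.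

Lemma integral_inner_outer :
  (\int[mu n]_x (g x * \1_(ball0 rho) x)%:E + \int[mu n]_x (outer rho g x)%:E =
   \int[mu n]_x (g x)%:E)%E.
Proof.
rewrite -ge0_integralD//.
- by apply: eq_integral => x _; rewrite -EFinD /outer; congr EFin; ring.
- by move=> x _; rewrite lee_fin inner_ge0.
- exact: measurable_inner.
- by move=> x _; rewrite lee_fin outer_ge0.
- by apply/measurable_EFinP; exact: measurable_outer.
Qed.

Lemma integral_inner_defect :
  (\int[mu n]_x (g x * \1_(ball0 rho) x)%:E + \int[mu n]_x (defect rho g x)%:E =
   mu n (ball0 rho))%E.
Proof.
rewrite (measure_integral_indic _ (@measurable_ball0 n rho)) -ge0_integralD//.
- by apply: eq_integral => x _; rewrite -EFinD /defect; congr EFin; ring.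
- by move=> x _; rewrite lee_fin inner_ge0.
- exact: measurable_inner.
- by move=> x _; rewrite lee_fin defect_ge0.
- by apply/measurable_EFinP; exact: measurable_defect.
Qed.

End weight.

(* Mass of g outside the ball that a translation along e_0 carries into places
   where g falls short of 1 is gained as overlap with the ball. *)
Lemma star_overlap n (g : 'rV[R]_n.+1 -> R) (r rho l : R) : 0 <= r ->
  measurable_fun setT g -> (forall x, 0 <= g x) -> (forall x, g x <= 1) ->
  (forall x : 'rV[R]_n.+1, r < `|x ord0 ord0| -> g x = 0) ->
  (\int[mu n.+1]_x (g x * \1_(ball0 rho) x)%:E +
   \int[mu n.+1]_x (outer rho g x * defect rho g (x + l *: delta_mx ord0 ord0)%R)%:E
   <= mu n.+1 (star g `&` ball0 rho))%E.
Proof.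
move=> r0 mg g0 g1 gr.
have mi := measurable_inner rho mg.
have mo := measurable_outer rho mg.
have md := measurable_defect rho mg.
have msh : measurable_fun setT (fun x : 'rV[R]_n.+1 => x + l *: delta_mx ord0 ord0).
  by apply: measurable_addmx => //; exact: (@measurable_cst _ _ _ _ setT _).
have mod : measurable_fun setT (fun x : 'rV[R]_n.+1 =>
    (outer rho g x * defect rho g (x + l *: delta_mx ord0 ord0))%:E).
  apply/measurable_EFinP; apply: measurable_funM => //; exact: (measurableT_comp md msh).
have i0 x : (0 <= (g x * \1_(ball0 rho) x)%:E)%E by rewrite lee_fin inner_ge0.
have od0 (x : 'rV[R]_n.+1) :
    (0 <= (outer rho g x * defect rho g (x + l *: delta_mx ord0 ord0)%R)%:E)%E.
  by rewrite lee_fin mulr_ge0 ?outer_ge0 ?defect_ge0.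
have mS : measurable (star g `&` ball0 rho).
  by apply: measurableI; [exact: measurable_star|exact: measurable_ball0].
rewrite (integral_rV_cons_swap mi i0) (integral_rV_cons_swap mod od0).
rewrite (measure_rV_cons_swap mS) -ge0_integralD//; last 4 first.
- by move=> z _; exact: integral_ge0.
- exact: measurable_integral_rV_cons mi i0.
- by move=> z _; exact: integral_ge0.
- exact: measurable_integral_rV_cons mod od0.
apply: ge0_le_integral => //.
- by move=> z _; rewrite adde_ge0// integral_ge0.
- apply: emeasurable_funD.
    exact: measurable_integral_rV_cons mi i0.
  exact: measurable_integral_rV_cons mod od0.
- apply: (measurable_measure_section2 leb (B := [set p | (star g `&` ball0 rho) (rV_cons p)])).
  by apply: measurable_preimageT => //; exact: measurable_rV_cons.
move=> z _; have [zr|zr] := leP (enorm z) rho; last first.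
  have nb t : \1_(ball0 rho) (rV_cons (t, z)) = 0 :> R.
    rewrite indicE memNset// /ball0/= => h; move: zr; rewrite ltNge => /negP; apply.
    have rh : 0 <= rho by rewrite (le_trans _ h)// enorm_ge0.
    rewrite -(@ler_pXn2r _ 2)// ?nnegrE ?enorm_ge0//.
    rewrite -(@ler_pXn2r _ 2) ?nnegrE ?enorm_ge0// enorm_rV_cons in h.
    by rewrite (le_trans _ h)// lerDr sqr_ge0.
  rewrite !integral0_eq ?adde0//.
    by move=> t _; rewrite rV_cons_shift /defect nb !mulr0.
  by move=> t _; rewrite nb mulr0.
have rh : 0 <= rho by rewrite (le_trans _ zr)// enorm_ge0.
have c0 : 0 <= chord rho z by exact: sqrtr_ge0.
have c2 : chord rho z ^+ 2 = rho ^+ 2 - enorm z ^+ 2.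
  rewrite [LHS]sqr_sqrtr// subr_ge0 ler_pXn2r// ?nnegrE ?enorm_ge0//.
have bE t : ball0 rho (rV_cons (t, z)) <-> `|t| <= chord rho z.
  rewrite /ball0/= -(@ler_pXn2r _ 2) ?nnegrE ?enorm_ge0// enorm_rV_cons -lerBrDr -c2.
  by rewrite -[X in X <= _]real_normK ?num_real// ler_pXn2r// nnegrE.
have bI t : \1_(ball0 rho) (rV_cons (t, z)) =
    \1_([set t : measurableTypeR R | `|t| <= chord rho z]) t :> R.
  rewrite !indicE; congr (nat_of_bool _)%:R.
  by apply/idP/idP; rewrite !inE => /bE.
have := @overlap1 R r (slice g z) r0 (@measurable_slice R n g mg z)
  (fun t => g0 _) (fun t => g1 _) _ (chord rho z) l c0.
have sr t : r < `|t| -> slice g z t = 0 by move=> h; apply: gr; rewrite rV_cons0.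
move=> /(_ sr) H; apply: le_trans (le_trans _ H) _.
  rewrite le_eqVlt; apply/orP; left; apply/eqP; congr (_ + _)%E.
    by apply: eq_integral => t _; rewrite bI.
  apply: eq_integral => t _.
  by rewrite rV_cons_shift /outer /defect !bI.
rewrite le_eqVlt; apply/orP; left; apply/eqP; congr (leb _); apply/seteqP.
split => t [h1 h2]; split.
- by rewrite /star/= rV_cons_drop rV_cons0.
- exact/bE.
- by move: h1; rewrite /star/= rV_cons_drop rV_cons0.
- exact/bE.
Qed.

End overlap.

Section rearrangement.
Variable R : realType.

(* Average over all translations w in the ball of radius 2r. *)
Lemma exists_shift n (r a : R) (X Y : 'rV[R]_n -> R) : 0 < r -> 0 < a ->
  measurable_fun setT X -> measurable_fun setT Y ->
  (forall x, 0 <= X x) -> (forall x, 0 <= Y x) ->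
  (forall x, r < enorm x -> X x = 0) -> (forall x, r < enorm x -> Y x = 0) ->
  (\int[mu n]_x (X x)%:E = a%:E)%E -> (\int[mu n]_x (Y x)%:E = a%:E)%E ->
  exists w, ((a ^+ 2 / (2 * volume (@ball0 R n (2 * r))))%:E <=
    \int[mu n]_x (X x * Y (x + w)%R)%:E)%E.
Proof.
move=> r0 a0 mX mY X0 Y0 Xr Yr aX aY.
have r20 : 0 < 2 * r by rewrite mulr_gt0.
have C0 : 0 < volume (@ball0 R n (2 * r)).
  by rewrite /ball0 volume_eballr// mulr_gt0 ?exprn_gt0 ?omega_gt0.
set C := volume _ in C0 *; apply: contrapT => /forallNP nw.
(* Half of the average overlap over the ball of translations. The factor 2 lets the negated claim
   contradict the total a ^+ 2 through a non-strict integral inequality. *)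
set k := a ^+ 2 / (2 * C) in nw *.
have k0 : 0 <= k by rewrite divr_ge0 ?sqr_ge0// mulr_ge0 ?ltW.
have madd : measurable_fun setT (fun p : 'rV[R]_n * 'rV[R]_n => p.2 + p.1).
  exact: measurable_addmx measurable_snd measurable_fst.
have mXY : measurable_fun setT (fun p : 'rV[R]_n * 'rV[R]_n => (X p.2 * Y (p.2 + p.1))%:E).
  apply/measurable_EFinP; apply: measurable_funM; first exact: measurableT_comp mX measurable_snd.
  exact: measurableT_comp mY madd.
have XY0 x w : (0 <= (X x * Y (x + w)%R)%:E)%E by rewrite lee_fin mulr_ge0.
have E : (\int[mu n]_w \int[mu n]_x (X x * Y (x + w)%R)%:E = (a ^+ 2)%:E)%E.
  rewrite (tonelli_swap (mu n) (mu n) (F := fun w x => (X x * Y (x + w)%R)%:E))//.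
  transitivity (\int[mu n]_x ((X x)%:E * a%:E))%E.
    apply: eq_integral => x _.
    under eq_integral do rewrite EFinM.
    rewrite ge0_integralZl//.
    - congr (_ * _)%E; rewrite -aY -[RHS](integral_rV_translate x (F := fun y => (Y y)%:E)).
      + by apply: eq_integral => w _; rewrite addrC.
      + exact/measurable_EFinP.
      + by move=> y; rewrite lee_fin.
    - apply/measurable_EFinP; apply: (measurableT_comp mY).
      by apply: measurable_addmx => //; exact: (@measurable_cst _ _ _ _ setT x).
    - by move=> w _; rewrite lee_fin.
    - by rewrite lee_fin.
  rewrite ge0_integralZr//.
  - by rewrite aX -EFinM expr2.
  - exact/measurable_EFinP.
  - by move=> x _; rewrite lee_fin.
  - by rewrite lee_fin ltW.
have : ((a ^+ 2)%:E <= (k * C)%:E)%E.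
  rewrite -E EFinM -compact_volume; last exact: compact_eballr.
  rewrite measure_integral_indic; last exact: measurable_ball0.
  rewrite -ge0_integralZl//; last by apply: measurable_indicE; exact: measurable_ball0.
  apply: ge0_le_integral => //.
  - by move=> w _; exact: integral_ge0.
  - exact: (measurable_integral1 (mu n) (F := fun w x => (X x * Y (x + w)%R)%:E)).
  - by apply: emeasurable_funM => //; apply: measurable_indicE; exact: measurable_ball0.
  move=> w _; rewrite indicE; have [wr|] := boolP (w \in _).
    by rewrite mule1 ltW// ltNge; apply/negP.
  rewrite notin_setE /ball0/= => /negP; rewrite -ltNge => wr; rewrite mule0 integral0_eq//.
  move=> x _; have [xr|xr] := leP (enorm x) r; last by rewrite Xr// mul0r.
  rewrite Yr ?mulr0// ltNge; apply/negP => xwr; move: wr; rewrite ltNge => /negP; apply.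
  have -> : w = (x + w) - x by rewrite addrC addKr.
  rewrite (le_trans (enorm_triangle _ _))// enormN.
  by rewrite mulr_natl mulr2n lerD.
have a2 : 0 < a ^+ 2 by rewrite exprn_gt0.
have -> : k * C = a ^+ 2 / 2 by rewrite /k; field; rewrite gt_eqF.
rewrite lee_fin; lra.
Qed.

Section deficit.
Variables (n q : nat) (F : 'M[R]_(q, n.+1) -> \bar R).
Hypotheses (mF : rows_measurable F) (F0 : forall X, (0 <= F X)%E) (cF : e0_convex F).
Hypothesis F_orth : forall Q X, is_orthogonal Q -> F (X *m Q) = F X.
Variables (r rho v : R).
Hypotheses (r0 : 0 < r) (rho_r : rho <= r).
Hypothesis v_rho : (mu n.+1 (ball0 rho) = v%:E)%E.

Definition deficit (g : 'rV[R]_n.+1 -> R) : R :=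
  v - fine (\int[mu n.+1]_x (g x * \1_(ball0 rho) x)%:E)%E.

Let inner_fin g : admissible r v g ->
  (\int[mu n.+1]_x (g x * \1_(ball0 rho) x)%:E = (v - deficit g)%:E)%E.
Proof.
move=> [mg g01 gr gv].
have g0 x : 0 <= g x by case/andP: (g01 x).
have g1 x : g x <= 1 by case/andP: (g01 x).
rewrite /deficit subKr fineK// ge0_fin_numE.
  apply: le_lt_trans (ltry v); rewrite -gv -(integral_inner_outer rho mg g0) leeDl//.
  by apply: integral_ge0 => x _; rewrite lee_fin outer_ge0.
by apply: integral_ge0 => x _; rewrite lee_fin inner_ge0.
Qed.

Let outer_fin g : admissible r v g -> (\int[mu n.+1]_x (outer rho g x)%:E = (deficit g)%:E)%E.
Proof.
move=> ag; have [mg g01 gr gv] := ag.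
have g0 x : 0 <= g x by case/andP: (g01 x).
have := integral_inner_outer rho mg g0; rewrite gv (inner_fin ag).
case: (\int[_]_x _)%E => //= s; rewrite -EFinD => -[E]; congr EFin; move: E; lra.
Qed.

Lemma integral_defect g : admissible r v g -> (\int[mu n.+1]_x (defect rho g x)%:E = (deficit g)%:E)%E.
Proof.
move=> ag; have [mg g01 gr gv] := ag.
have g0 x : 0 <= g x by case/andP: (g01 x).
have g1 x : g x <= 1 by case/andP: (g01 x).
have := integral_inner_defect rho mg g0 g1; rewrite v_rho (inner_fin ag).
case: (\int[_]_x _)%E => //= s; rewrite -EFinD => -[E]; congr EFin; move: E; lra.
Qed.

Lemma deficit_ge0 g : admissible r v g -> 0 <= deficit g.
Proof.
move=> ag; have [mg g01 gr gv] := ag.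
have g0 x : 0 <= g x by case/andP: (g01 x).
rewrite -lee_fin -(outer_fin ag); apply: integral_ge0 => x _.
by rewrite lee_fin outer_ge0.
Qed.

Let C := 2 * volume (@ball0 R n.+1 (2 * r)).

(* The outer part and the defect of g have equal mass, the deficit, so some
   translation makes them overlap; symmetrize along its direction. *)
Lemma deficit_step g : admissible r v g -> exists g', [/\ admissible r v g',
  deficit g' <= deficit g - deficit g ^+ 2 / C & (witer g' F <= witer g F)%E].
Proof.
move=> ag; have [mg g01 gr gv] := ag.
have g0 x : 0 <= g x by case/andP: (g01 x).
have g1 x : g x <= 1 by case/andP: (g01 x).
have := deficit_ge0 ag; rewrite le_eqVlt => /predU1P[a0|a0].
  by exists g; split => //; rewrite -a0 expr0n mul0r subr0.
have Xr x : r < enorm x -> outer rho g x = 0 by move=> h; rewrite /outer gr// mul0r.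
have Yr x : r < enorm x -> defect rho g x = 0.
  move=> h; rewrite /defect indicE memNset ?mulr0// /ball0/= => xr.
  by move: h; rewrite ltNge (le_trans xr).
have [w hw] := exists_shift r0 a0 (measurable_outer rho mg) (measurable_defect rho mg)
  (fun x => outer_ge0 _ g0 x) (fun x => defect_ge0 _ g1 x) Xr Yr (outer_fin ag) (integral_defect ag).
have [Q [oQ wQ]] := householder w.
have oQt := orthogonal_tr oQ.
(* Rotates the translation [w] to |w| e_0; the ball, the mass and [F] are invariant under the
   rotation. *)
pose gt x := g (x *m Q^T).
have agt : admissible r v gt := orthogonal_admissible oQt ag.
have [mgt gt01 gtr gtv] := agt.
have gt0 x : 0 <= gt x by exact: g0.
have gt1 x : gt x <= 1 by exact: g1.
have bQ x : \1_(ball0 rho) (x *m Q^T) = \1_(ball0 rho) x :> R.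
  rewrite !indicE; congr (nat_of_bool _)%:R; apply/idP/idP;
    by rewrite !inE /ball0/= orthogonal_enorm.
exists \1_(star gt); split.
- by apply: star_admissible => //; exact: ltW.
- have gtr0 (x : 'rV[R]_n.+1) : r < `|x ord0 ord0| -> gt x = 0.
    by move=> h; apply: gtr; rewrite (lt_le_trans h)// coord_le_enorm.
  have := star_overlap rho (enorm w) (ltW r0) mgt gt0 gt1 gtr0.
  have -> : (mu n.+1 (star gt `&` ball0 rho) = (v - deficit \1_(star gt))%:E)%E.
    rewrite -(inner_fin (star_admissible (ltW r0) agt)).
    rewrite measure_integral_indic; last first.
      by apply: measurableI; [exact: measurable_star|exact: measurable_ball0].
    apply: eq_integral => x _; congr EFin.
    by rewrite !indicE in_setI -natrM mulnb.
  have -> : (\int[mu n.+1]_x (gt x * \1_(ball0 rho) x)%:E = (v - deficit g)%:E)%E.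
    rewrite -(inner_fin ag).
    rewrite -(integral_orthogonal oQt (F := fun x => (g x * \1_(ball0 rho) x)%:E)).
    + by apply: eq_integral => x _; rewrite bQ.
    + exact: measurable_inner.
    + by move=> x; rewrite lee_fin inner_ge0.
  move=> /(le_trans (leeD2l (v - deficit g)%:E _)) H.
  have : ((v - deficit g)%:E + (deficit g ^+ 2 / C)%:E <= (v - deficit \1_(star gt))%:E)%E.
    apply: H; apply: (le_trans hw).
    have msh : measurable_fun setT (fun x : 'rV[R]_n.+1 => x + w).
      by apply: measurable_addmx => //; exact: (@measurable_cst _ _ _ _ setT _).
    rewrite -(integral_orthogonal oQt (F := fun x => (outer rho g x * defect rho g (x + w)%R)%:E)).
    + rewrite le_eqVlt; apply/orP; left; apply/eqP; apply: eq_integral => x _.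
      have -> : x *m Q^T + w = (x + enorm w *: delta_mx ord0 ord0) *m Q^T.
        by rewrite mulmxDl -wQ -[w *m Q *m _]mulmxA oQ mulmx1.
      by rewrite /outer /defect !bQ.
    + apply/measurable_EFinP; apply: measurable_funM; first exact: measurable_outer.
      exact: (measurableT_comp (measurable_defect rho mg) msh).
    + by move=> x; rewrite lee_fin mulr_ge0 ?outer_ge0 ?defect_ge0.
  rewrite -EFinD lee_fin; lra.
- rewrite (witer_orthogonal oQt mg g0 mF F0).
  rewrite [leRHS](eq_witer _ (G := F)); last by move=> X; exact: F_orth.
  apply: (witer_star mF F0 cF) (ltW r0) mgt gt0 gt1 _.
    by move=> X; rewrite F_orth//; exact: orthogonal_flip.
  by move=> x h; apply: gtr; rewrite (lt_le_trans h)// coord_le_enorm.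
Qed.

(** [D] collects the deficits that can be reached without raising the integral. If its infimum were
    positive, [deficit_step] would push a near-minimizer below it. *)
Lemma deficit_small g e : admissible r v g -> 0 < e -> exists g',
  [/\ admissible r v g', deficit g' < e & (witer g' F <= witer g F)%E].
Proof.
move=> ag e0.
pose D := [set d | exists g', [/\ admissible r v g', deficit g' = d & (witer g' F <= witer g F)%E]].
have hD : has_inf D.
  split; first by exists (deficit g), g.
  by exists 0 => _ [g' [ag' <- _]]; exact: deficit_ge0.
have [iD|iD] := ltP (inf D) e.
  have [|_ [g' [ag' <- wg']] h] := @inf_adherent _ D (e - inf D) _ hD; first by rewrite subr_gt0.
  by exists g'; split => //; rewrite -(subrKC (inf D) e).
have i0 : 0 < inf D by exact: lt_le_trans iD.
have C0 : 0 < C.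
  by rewrite mulr_gt0// /ball0 volume_eballr ?mulr_gt0 ?exprn_gt0 ?omega_gt0// mulr_gt0.
(* The margin for the near-minimizer: a step from a deficit of at least inf D gains at least this
   much. *)
have p0 : 0 < inf D ^+ 2 / C by rewrite divr_gt0 ?exprn_gt0.
have [_ [g1 [ag1 <- wg1]] h1] := inf_adherent p0 hD.
have [g2 [ag2 d2 w2]] := deficit_step ag1.
have i1 : inf D <= deficit g1 by apply: ge_inf; [case: hD|exists g1].
have : inf D <= deficit g2.
  by apply: ge_inf; [case: hD|exists g2; split => //; exact: le_trans wg1].
have : inf D ^+ 2 / C <= deficit g1 ^+ 2 / C.
  by rewrite ler_pM2r ?invr_gt0// ler_pXn2r// nnegrE ltW// (lt_le_trans i0).
lra.
Qed.

Lemma ball_admissible : admissible r v \1_(@ball0 R n.+1 rho).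
Proof.
split.
- by apply: measurable_indic; exact: measurable_ball0.
- by move=> x; rewrite indicE ler0n lern1 leq_b1.
- move=> x h; rewrite indicE memNset// /ball0/= => xr.
  by move: h; rewrite ltNge (le_trans xr).
- by rewrite -v_rho measure_integral_indic//; exact: measurable_ball0.
Qed.

End deficit.

Definition bounded_rows n q (r c : R) (F : 'M[R]_(q, n) -> \bar R) :=
  forall X, (forall i, enorm (row i X) <= r) -> (F X <= c%:E)%E.

Lemma bounded_rows_col_mx n q (r c : R) (F : 'M[R]_(q.+1, n) -> \bar R) (x : 'rV[R]_n) :
  enorm x <= r -> bounded_rows r c F ->
  bounded_rows r c (fun X : 'M[R]_(q, n) => F (col_mx x X)).
Proof.
move=> xr bF X Xr; apply: bF => i; case: (split_ordP (i : 'I_(1 + q))) => j ->.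
  by rewrite row_consl.
by rewrite row_consr.
Qed.

Lemma witer_bounded n q (r v c : R) (g : 'rV[R]_n -> R) (F : 'M[R]_(q, n) -> \bar R) :
  admissible r v g -> 0 <= c -> rows_measurable F -> (forall X, 0 <= F X)%E ->
  bounded_rows r c F -> (witer g F <= (c * v ^+ q)%:E)%E.
Proof.
move=> [mg g01 gr gv] c0.
have g0 x : 0 <= g x by case/andP: (g01 x).
have v0 : 0 <= v by rewrite -lee_fin -gv integral_ge0// => x _; rewrite lee_fin.
elim: q F => [|q IH] F mF F0 bF /=.
  by rewrite mulr1; apply: bF => -[].
have cv0 : 0 <= c * v ^+ q by rewrite mulr_ge0 ?exprn_ge0.
have -> : c * v ^+ q.+1 = v * (c * v ^+ q) by rewrite exprS; ring.
rewrite [leRHS]EFinM -gv -ge0_integralZr//.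
- apply: ge0_le_integral => //.
  + by move=> x _; rewrite mule_ge0 ?lee_fin ?witer_ge0.
  + exact: measurable_weight_witer.
  + by apply: emeasurable_funM => //; exact/measurable_EFinP.
  move=> x _; have [xr|xr] := leP (enorm x) r; last by rewrite gr// !mul0e.
  rewrite lee_wpmul2l ?lee_fin//; apply: IH => //; first exact: rows_measurable_col_mx.
  exact: bounded_rows_col_mx.
- exact/measurable_EFinP.
- by move=> x _; rewrite lee_fin.
Qed.

(** One-sided stability in L^1: trading h for g costs a constant times the mass of the excess e. The
    constant is fixed before the weights, hence uniform along the symmetrizations. *)
Lemma witer_perturb n q (r v c : R) : 0 <= c -> exists2 K, 0 <= K &
  forall (h g e : 'rV[R]_n -> R) (d : R) (F : 'M[R]_(q, n) -> \bar R),
  admissible r v h -> admissible r v g ->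
  measurable_fun setT e -> (forall x, 0 <= e x) -> (forall x, r < enorm x -> e x = 0) ->
  (\int[mu n]_x (e x)%:E = d%:E)%E -> (forall x, h x <= g x + e x) ->
  rows_measurable F -> (forall X, 0 <= F X)%E -> bounded_rows r c F ->
  (witer h F <= witer g F + (K * d)%:E)%E.
Proof.
move=> c0; elim: q => [|q [K K0 IH]].
  by exists 0 => // *; rewrite mul0r adde0.
(* Either the first row is charged to the excess and the other rows contribute v ^+ q, or the first
   row keeps mass v and the others change. The modulus is there because v >= 0 follows only from the
   weights, introduced afterwards. *)
exists (c * `|v| ^+ q + `|v| * K); first by rewrite addr_ge0// mulr_ge0 ?exprn_ge0.
move=> h g e d F ah ag me e0 er ed hge mF F0 bF /=.
have [mh h01 hr hv] := ah; have [mg g01 gr gv] := ag.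
have h0 x : 0 <= h x by case/andP: (h01 x).
have g0 x : 0 <= g x by case/andP: (g01 x).
have v0 : 0 <= v by rewrite -lee_fin -gv integral_ge0// => x _; rewrite lee_fin.
have d0 : 0 <= d by rewrite -lee_fin -ed integral_ge0// => x _; rewrite lee_fin.
rewrite (ger0_norm v0).
pose W (x : 'rV[R]_n) := witer g (fun X : 'M[R]_(q, n) => F (col_mx x X)).
have W0 x : (0 <= W x)%E by apply: witer_ge0.
have mW : measurable_fun setT W := measurable_witer_col_mx mg g0 mF F0.
have mgW := measurable_weight_witer mg g0 mF F0.
have mhE : measurable_fun setT (EFin \o h) by exact/measurable_EFinP.
have meE : measurable_fun setT (EFin \o e) by exact/measurable_EFinP.
have cv0 : 0 <= c * v ^+ q by rewrite mulr_ge0 ?exprn_ge0.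
have Kd0 : 0 <= K * d by rewrite mulr_ge0.
have -> : (((c * v ^+ q + v * K) * d)%:E =
    \int[mu n]_x ((e x)%:E * (c * v ^+ q)%:E) + \int[mu n]_x ((h x)%:E * (K * d)%:E))%E.
  rewrite !ge0_integralZr ?lee_fin//; try by move=> x _; rewrite lee_fin.
  by rewrite hv ed -!EFinM -EFinD; congr EFin; ring.
rewrite -ge0_integralD//; last 4 first.
- by move=> x _; rewrite mule_ge0 ?lee_fin.
- exact: emeasurable_funM.
- by move=> x _; rewrite mule_ge0 ?lee_fin.
- exact: emeasurable_funM.
rewrite -ge0_integralD//; last 3 first.
- by move=> x _; rewrite mule_ge0 ?lee_fin//; exact: W0.
- by move=> x _; rewrite adde_ge0// mule_ge0 ?lee_fin.
- by apply: emeasurable_funD; exact: emeasurable_funM.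
apply: ge0_le_integral => //.
- by move=> x _; rewrite mule_ge0 ?lee_fin ?witer_ge0.
- exact: measurable_weight_witer.
- apply: emeasurable_funD => //; apply: emeasurable_funD; exact: emeasurable_funM.
move=> x _; have [xr|xr] := leP (enorm x) r; last first.
  by rewrite hr// gr// er// !mul0e !adde0.
have bFx := bounded_rows_col_mx xr bF.
have mFx := rows_measurable_col_mx (q := q) x mF.
have Wle : (W x <= (c * v ^+ q)%:E)%E by apply: witer_bounded bFx.
have {}IH := IH h g e d _ ah ag me e0 er ed hge mFx (fun X => F0 _) bFx.
apply: (@le_trans _ _ ((h x)%:E * (W x + (K * d)%:E))%E).
  by rewrite lee_wpmul2l ?lee_fin.
rewrite ge0_muleDr ?lee_fin// [leRHS]addeA leeD2r//.
apply: (@le_trans _ _ ((g x + e x)%:E * W x)%E); first by rewrite lee_wpmul2r ?lee_fin.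
rewrite EFinD ge0_muleDl ?lee_fin// leeD2l// lee_wpmul2l ?lee_fin//.
Qed.

(** The indicator of the ball is at most g' plus its defect, and symmetrizing makes the mass of the
    defect as small as desired; [witer_perturb] turns this into a comparison of integrals. *)
Lemma rearrangement n q (F : 'M[R]_(q, n.+1) -> \bar R) (r rho v c : R)
    (g : 'rV[R]_n.+1 -> R) :
  rows_measurable F -> (forall X, 0 <= F X)%E -> e0_convex F ->
  (forall Q X, is_orthogonal Q -> F (X *m Q) = F X) ->
  0 < r -> rho <= r -> (mu n.+1 (@ball0 R n.+1 rho) = v%:E)%E ->
  0 <= c -> bounded_rows r c F -> admissible r v g ->
  (witer \1_(@ball0 R n.+1 rho) F <= witer g F)%E.
Proof.
move=> mF F0 cF oF r0 rho_r vr c0 bF ag.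
have [K K0 HK] := witer_perturb n.+1 q r v c0.
apply/lee_addgt0Pr => e e0.
have eK : 0 < e / (K + 1) by rewrite divr_gt0// ltr_wpDl.
have [g' [ag' dg' wg']] := deficit_small mF F0 cF oF r0 rho_r vr ag eK.
have [mg g01 gr gv] := ag'.
have g1 x : g' x <= 1 by case/andP: (g01 x).
have g0 x : 0 <= g' x by case/andP: (g01 x).
apply: le_trans.
  apply: (HK _ g' (defect rho g') (deficit rho v g') F (ball_admissible rho_r vr) ag') => //.
  - exact: measurable_defect.
  - by move=> x; exact: defect_ge0.
  - move=> x h; rewrite /defect indicE memNset ?mulr0// /ball0/= => xr.
    by move: h; rewrite ltNge (le_trans xr).
  - exact: (integral_defect vr ag').
  - move=> x; rewrite /defect mulrBl mul1r.
    have := g0 x; rewrite indicE; case: (_ \in _) => /=; lra.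
apply: leeD => //; rewrite lee_fin.
have d0 : 0 <= deficit rho v g'.
  exact: deficit_ge0 ag'.
apply: le_trans (_ : (K + 1) * deficit rho v g' <= _); first by rewrite ler_wpM2r// lerDl.
by rewrite mulrC -ler_pdivlMr ?ltr_wpDl// ltW.
Qed.

End rearrangement.

(** * Rogers-Shephard inequality for sections and projections *)

Section beta.
Variable R : realType.

Lemma integral_beta (a b : nat) :
  (\int[leb]_t (t ^+ a * (1 - t) ^+ b * \1_(`[0%R, 1%R]%classic : set (measurableTypeR R)) t)%:E =
   ((a`! * b`!)%:R / (a + b).+1`!%:R)%:E :> \bar R)%E.
Proof.
rewrite -beta_fun_fact EFin_beta_fun; apply: eq_integral => t _.
rewrite patchE indicE /XMonemX /=.
by case: (_ \in _); rewrite ?mulr1 ?mulr0.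
Qed.

Lemma measurable_kernel (p : nat) (s : R) : measurable_fun setT
  (fun t : measurableTypeR R => (t ^+ p * \1_(`[0%R, s]%classic : set (measurableTypeR R)) t)%:E : \bar R).
Proof.
apply/measurable_EFinP; apply: measurable_funM; first exact: measurable_funX.
by apply: measurable_indic; exact: measurable_itv.
Qed.

Lemma kernel_ge0 (p : nat) (s t : R) :
  0 <= t ^+ p * \1_(`[0%R, s]%classic : set (measurableTypeR R)) t :> R.
Proof.
rewrite indicE; case: (boolP (t \in _)); last by rewrite mulr0.
by rewrite inE /= in_itv/= mulr1 => /andP[t0 _]; rewrite exprn_ge0.
Qed.

Lemma measurable_beta_kernel (p q : nat) : measurable_fun setT
  (fun t : measurableTypeR R => (t ^+ p * (1 - t) ^+ q * \1_(`[0%R, 1%R]%classic : set (measurableTypeR R)) t)%:E : \bar R).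
Proof.
apply/measurable_EFinP; apply: measurable_funM; last first.
  by apply: measurable_indic; exact: measurable_itv.
apply: measurable_funM; first exact: measurable_funX.
by apply: measurable_funX; exact: measurable_funB.
Qed.

Lemma beta_kernel_ge0 (p q : nat) (t : R) :
  0 <= t ^+ p * (1 - t) ^+ q * \1_(`[0%R, 1%R]%classic : set (measurableTypeR R)) t :> R.
Proof.
rewrite indicE; case: (boolP (t \in _)); last by rewrite mulr0.
rewrite inE /= in_itv/= mulr1 => /andP[t0 t1].
by rewrite mulr_ge0 ?exprn_ge0 ?subr_ge0.
Qed.

Lemma integral_power (p : nat) (s : R) : 0 <= s ->
  (\int[leb]_t (t ^+ p * \1_(`[0%R, s]%classic : set (measurableTypeR R)) t)%:E =
   (s ^+ p.+1 / p.+1%:R)%:E :> \bar R)%E.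
Proof.
rewrite le_eqVlt => /predU1P[<-|s0].
  rewrite expr0n mul0r.
  transitivity (\int[leb]_(t in (`[0%R, 0%R]%classic : set (measurableTypeR R))) (t ^+ p)%:E : \bar R)%E.
    rewrite [RHS]integral_mkcond; apply: eq_integral => t _; rewrite patchE indicE.
    by case: (_ \in _); rewrite ?mulr1 ?mulr0.
  by rewrite set_itv1 integral_set1.
rewrite (@integral_affine _ s 0)//; last 3 first.
- by rewrite gt_eqF.
- exact: measurable_kernel.
- by move=> t; rewrite lee_fin kernel_ge0.
have -> : s ^+ p.+1 / p.+1%:R = `|s| * (s ^+ p * p.+1%:R^-1).
  by rewrite gtr0_norm// exprS mulrA.
rewrite EFinM; congr (_ * _)%E; rewrite [RHS]EFinM.
have <- : (\int[leb]_t (t ^+ p * (1 - t) ^+ 0 * \1_(`[0%R, 1%R]%classic : set (measurableTypeR R)) t)%:E =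
   (p.+1%:R^-1)%:E :> \bar R)%E.
  have hp : p`!%:R != 0 :> R by rewrite pnatr_eq0 -lt0n fact_gt0.
  rewrite integral_beta addn0 fact0 muln1 factS natrM invfM.
  by rewrite [p.+1%:R^-1 * _]mulrC mulrA divff// mul1r.
rewrite -ge0_integralZl ?lee_fin ?exprn_ge0 ?ltW//.
- apply: eq_integral => t _; rewrite -EFinM expr0 mulr1 addr0 exprMn -mulrA; congr (_ * (_ * _))%:E.
  have sE : (s * t <= s) = (t <= 1) by rewrite -[X in _ <= X]mulr1 ler_pM2l.
  rewrite !indicE; congr (nat_of_bool _)%:R; apply/idP/idP; rewrite !inE /= !in_itv/=;
    by rewrite pmulr_rge0// sE.
- under eq_fun do rewrite expr0 mulr1; exact: measurable_kernel.
- by move=> t _; rewrite lee_fin expr0 mulr1 kernel_ge0.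
Qed.

(** An explicit modulus of continuity, used to carry a bound over to a supremum that need not be
    attained. *)
Lemma exprB_le (p : nat) (s t : R) : 0 <= t -> t <= s -> s <= 1 ->
  s ^+ p <= t ^+ p + p%:R * (s - t).
Proof.
move=> t0 ts s1; elim: p => [|p IH]; first by rewrite !expr0 mul0r addr0.
have s0 := le_trans t0 ts.
have h1 : s * s ^+ p <= s * (t ^+ p + p%:R * (s - t)) by rewrite ler_wpM2l.
have h2 : 0 <= (1 - s) * (p%:R * (s - t)) by rewrite !mulr_ge0 ?subr_ge0.
have h3 : 0 <= (1 - t ^+ p) * (s - t).
  by rewrite mulr_ge0 ?subr_ge0 ?exprn_ile1// (le_trans ts).
rewrite !exprS -[p.+1%:R]natr1; nra.
Qed.

End beta.

Section rogers_shephard.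
Variable R : realType.

Definition fst_mx m p : 'M[R]_(m + p, m) := col_mx 1%:M 0.

Lemma row_mx_fst m p (y : 'rV[R]_m) (z : 'rV[R]_p) : row_mx y z *m fst_mx m p = y.
Proof. by rewrite /fst_mx mul_row_col mulmx1 mulmx0 addr0. Qed.

Lemma fst_row_mx m p (x : 'rV[R]_(m + p)) : x = row_mx (x *m fst_mx m p) (rsubmx x).
Proof. by rewrite -[in x *m _](hsubmxK x) row_mx_fst hsubmxK. Qed.

Definition fiber m p (K : set 'rV[R]_(m + p)) (y : 'rV[R]_m) : set 'rV[R]_p :=
  [set z | K (row_mx y z)].

Lemma compact_fiber m p (K : set 'rV[R]_(m + p)) y : compact K -> compact (fiber K y).
Proof.
move=> cK.
have -> : fiber K y = [set x *m (col_mx 0 1%:M : 'M[R]_(m + p, p)) |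
    x in K `&` [set x | x *m fst_mx m p = y]].
  apply/seteqP; split => [z Kz|_ [x [Kx <-] <-]].
    by exists (row_mx y z); rewrite ?mul_row_col ?mulmx0 ?mulmx1 ?add0r//= row_mx_fst.
  rewrite /fiber/= -[x in x *m col_mx 0 _]hsubmxK mul_row_col mulmx0 mulmx1 add0r.
  by rewrite -fst_row_mx.
apply: compact_image_mulmx; apply: (subclosed_compact _ cK); last by move=> x [].
apply: closedI; first exact: compact_closed_mx.
apply: (@preimage_closed _ _ (fun x : 'rV[R]_(m + p) => x *m fst_mx m p) [set y]).
  by move=> x _; exact: continuous_mulmxr.
by apply: compact_closed_mx; exact: compact_set1.
Qed.

Lemma measurable_fiber m p (K : set 'rV[R]_(m + p)) y : compact K -> measurable (fiber K y).
Proof. by move=> cK; apply: compact_measurable_rV; exact: compact_fiber. Qed.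

Lemma measurable_fiber_measure m p (K : set 'rV[R]_(m + p)) : compact K ->
  measurable_fun setT (fun y => mu p (fiber K y)).
Proof.
move=> cK; apply: (measurable_measure_section1 (mu p) (B := [set q | K (row_mx q.1 q.2)])).
apply: (measurable_preimageT (f := fun q : 'rV[R]_m * 'rV[R]_p => row_mx q.1 q.2)).
  exact: measurable_row_mx measurable_fst measurable_snd.
exact: compact_measurable_rV.
Qed.

Lemma fiber_measureE m p (K : set 'rV[R]_(m + p)) y : compact K ->
  mu p (fiber K y) = (volume (fiber K y))%:E.
Proof. by move=> cK; apply: compact_volume; exact: compact_fiber. Qed.

Lemma measure_translate_dilate n (t : R) (w : 'rV[R]_n) (A : set 'rV[R]_n) : 0 < t ->
  measurable A ->
  mu n [set x | exists2 a, A a & x = t *: a + w] = ((t ^+ n)%:E * mu n A)%E.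
Proof.
move=> t0 mA; rewrite -measure_dilate// -[RHS](measure_preimage_translate (- w)); last first.
  exact: measurable_dilate.
congr (mu n _); apply/seteqP; split => x /=.
  by move=> [a Aa ->]; exists a => //; rewrite addrK.
by move=> [a Aa ax]; exists a => //; rewrite ax subrK.
Qed.

(** Take a point x of K over k: by convexity, t times the fibre over y0 plus 1 - t times the last
    coordinates of x lies in K over the mixed point. With p > 0 the left side vanishes at t = 0. *)
Lemma fiber_scaled m p (K : set 'rV[R]_(m + p)) y0 k (t : R) :
  compact K -> is_convex K -> [set x *m fst_mx m p | x in K] k -> 0 <= t -> t <= 1 ->
  (0 < p)%N ->
  t ^+ p * volume (fiber K y0) <= volume (fiber K (t *: y0 + (1 - t) *: k)).
Proof.
move=> cK /is_convexP coK [x Kx xk]; rewrite le_eqVlt => /predU1P[<-|t0] t1 p0.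
  by rewrite expr0n gtn_eqF// mul0r volume_ge0.
rewrite -lee_fin EFinM -!fiber_measureE//.
rewrite -(measure_translate_dilate ((1 - t) *: rsubmx x) t0 (measurable_fiber y0 cK)).
have mD : measurable [set z | exists2 a, fiber K y0 a & z = t *: a + (1 - t) *: rsubmx x].
  rewrite (_ : mkset _ = [set z | dilate t (fiber K y0) (z - (1 - t) *: rsubmx x)]).
    apply: (measurable_preimageT (f := fun z : 'rV[R]_p => z - (1 - t) *: rsubmx x) (A := dilate t (fiber K y0))).
      by apply: measurable_addmx => //; exact: (@measurable_cst _ _ _ _ setT _).
    by apply: measurable_dilate => //; exact: measurable_fiber.
  apply/seteqP; split => z /=.
    by move=> [a Aa ->]; exists a => //; rewrite addrK.
  by move=> [a Aa az]; exists a => //; rewrite az subrK.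
apply: le_measure; rewrite ?inE//; first exact: measurable_fiber.
move=> _ [a Ka ->]; rewrite /fiber/=.
have := coK _ _ t Ka Kx (ltW t0) t1.
by rewrite {1}(fst_row_mx x) xk !scale_row_mx add_row_mx.
Qed.

Definition shrink m (P : set 'rV[R]_m) y0 : set (measurableTypeR R * 'rV[R]_m) :=
  [set q | exists2 k, P k & q.1 *: y0 + (1 - q.1) *: k = q.2].

Lemma measurable_shrink m (P : set 'rV[R]_m) y0 : compact P -> measurable (shrink P y0).
Proof.
move=> cP.
pose f (q : 'rV[R]_m * 'M[R]_(1, 1 + m)) : 'rV[R]_m :=
  lsubmx q.2 ord0 ord0 *: y0 + (1 - lsubmx q.2 ord0 ord0) *: q.1 - rsubmx q.2.
have cf : continuous f.
  have cZ i j : continuous (fun q : 'rV[R]_m * 'M[R]_(1, 1 + m) => q.2 i j).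
    by apply: continuous_coord => q; exact: cvg_snd.
  have cc i : continuous (fun q : 'rV[R]_m * 'M[R]_(1, 1 + m) => q.1 ord0 i).
    by apply: continuous_coord => q; exact: cvg_fst.
  apply: continuous_mx => i j q; rewrite ord1.
  under eq_fun do rewrite !mxE.
  apply: cvgB; last exact: cZ.
  apply: cvgD; first by apply: cvgM; [exact: cZ|exact: cvg_cst].
  apply: cvgM; last exact: cc.
  by apply: cvgB; [exact: cvg_cst|exact: cZ].
have -> : shrink P y0 = (fun q : measurableTypeR R * 'rV[R]_m => rV_cons q : 'M[R]_(1, 1 + m)) @^-1`
    [set Z | exists2 c, P c & f (c, Z) = 0].
  apply/seteqP; split => -[t y] [k Pk] /=; rewrite /f /= /rV_cons row_mxKl row_mxKr mxE eqxx mulr1n.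
    by move=> /= E; exists k => //=; rewrite E subrr.
  by move=> /subr0_eq E; exists k.
apply: measurable_preimage_closed_mx; last exact: closed_projection.
move=> i j; rewrite ord1; apply: measurable_rV_coord_fun.
exact: measurable_rV_cons.
Qed.

Lemma measure_shrink m (P : set 'rV[R]_m.+1) y0 (t : R) : compact P -> 0 <= t -> t <= 1 ->
  (((1 - t) ^+ m.+1)%:E * mu m.+1 P <= mu m.+1 [set y | shrink P y0 (t, y)])%E.
Proof.
move=> cP t0; rewrite le_eqVlt => /predU1P[->|t1].
  by rewrite subrr expr0n mul0e.
rewrite -(measure_translate_dilate (t *: y0)) ?subr_gt0//; last exact: compact_measurable_rV.
rewrite le_eqVlt; apply/orP; left; apply/eqP; congr (mu _ _); apply/seteqP.
split => y /=.
  by move=> [a Pa ->]; exists a => //=; rewrite addrC.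
by move=> [a Pa /= <-]; exists a => //; rewrite addrC.
Qed.

Lemma integral_fiber m p (K : set 'rV[R]_(m + p)) : compact K ->
  (mu (m + p) K = \int[mu m]_y mu p (fiber K y))%E.
Proof. by move=> cK; apply: measure_row_mx; exact: compact_measurable_rV. Qed.

(** Let s be the supremum of the t in [0, 1] such that y lies in t y0 + (1 - t) P. The fibre over y
    has at least s^(p+1) times the volume of that over y0, and s^(p+1) is the integral of (p+1) t^p
    from 0 to s. *)
Lemma integral_power_fiber m p (K : set 'rV[R]_(m + p.+1)) y0 y :
  compact K -> is_convex K ->
  (\int[leb]_t (p.+1%:R * volume (fiber K y0) *
     (t ^+ p * \1_(`[0%R, 1%R]%classic : set (measurableTypeR R)) t *
      \1_(shrink [set x *m fst_mx m p.+1 | x in K] y0) (t, y)))%:E <=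
   mu p.+1 (fiber K y))%E.
Proof.
move=> cK coK; set P := [set x *m _ | x in K]; set v := volume _.
have v0 : 0 <= v by exact: volume_ge0.
have cP : compact P by exact: compact_image_mulmx.
pose S := [set t : R | 0 <= t <= 1 /\ shrink P y0 (t, y)].
have SE t : t \notin S -> \1_(`[0%R, 1%R]%classic : set (measurableTypeR R)) t *
    \1_(shrink P y0) (t, y) = 0 :> R.
  move=> tS; rewrite !indicE -natrM mulnb.
  case: andP => // -[]; rewrite !inE /= in_itv/= => t01 ts.
  by move: tS; rewrite notin_setE => /(_ (conj t01 ts)).
have [S0|/set0P/negP/negPn/eqP S0] := pselect (S !=set0); last first.
  rewrite integral0_eq ?measure_ge0// => t _.
  by rewrite -(mulrA (t ^+ p)) SE ?mulr0// S0 in_set0.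
have hS : has_sup S by split => //; exists 1 => t [/andP[]].
have s1 : sup S <= 1 by apply: ge_sup => // t [/andP[]].
have leS t : S t -> t <= sup S by move=> St; apply: ub_le_sup => //; case: hS.
have s0 : 0 <= sup S.
  by have [t St] := S0; apply: le_trans (leS t St); case: St => /andP[].
have bound t : S t -> t ^+ p.+1 * v <= volume (fiber K y).
  move=> [/andP[t0 t1] [k Pk /= <-]]; exact: fiber_scaled.
have bsup : sup S ^+ p.+1 * v <= volume (fiber K y).
  apply: (@ler_all_eps _ _ _ (p.+1%:R * v)) => h h0.
  have [t St th] := sup_adherent h0 hS.
  have t0 : 0 <= t by case: St => /andP[].
  have := exprB_le p.+1 t0 (leS t St) s1; have := bound t St.
  move=> b1 b2.
  apply: (le_trans (ler_wpM2r v0 b2)); rewrite mulrDl lerD// -mulrA mulrCA.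
  by rewrite ler_wpM2r ?mulr_ge0 ?ler0n// lerBlDl -lerBlDr ltW.
rewrite fiber_measureE//; apply: le_trans (_ : ((sup S ^+ p.+1 * v)%:E <= _)%E); last first.
  by rewrite lee_fin.
have -> : sup S ^+ p.+1 * v = p.+1%:R * v * (sup S ^+ p.+1 / p.+1%:R).
  by rewrite [p.+1%:R * v]mulrC [_ / _]mulrC mulrA mulfK ?pnatr_eq0// mulrC.
rewrite EFinM -integral_power// -ge0_integralZl ?lee_fin ?mulr_ge0//; last 2 first.
- exact: measurable_kernel.
- by move=> t _; rewrite lee_fin kernel_ge0.
have pv0 : 0 <= p.+1%:R * v by rewrite mulr_ge0.
apply: ge0_le_integral => //.
- by move=> t _; rewrite lee_fin mulr_ge0// mulr_ge0 ?kernel_ge0 ?indicE.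
- apply/measurable_EFinP; apply: measurable_funM => //.
  apply: measurable_funM; first by apply/measurable_EFinP; exact: measurable_kernel.
  have mt : measurable_fun setT (fun t : measurableTypeR R => (t, y)).
    by apply: measurable_fun_pair => //; exact: (@measurable_cst _ _ _ _ setT y).
  have mi : measurable_fun setT (\1_(shrink P y0) : _ -> measurableTypeR R).
    by apply: measurable_indic; exact: measurable_shrink.
  exact: (measurableT_comp mi mt).
- by apply: emeasurable_funM => //; exact: measurable_kernel.
move=> t _; rewrite -EFinM lee_fin ler_wpM2l//.
have [tS|tS] := boolP (t \in S); last by rewrite -(mulrA (t ^+ p)) SE ?mulr0 ?kernel_ge0.
move: (tS); rewrite inE => tS'; have [/andP[t0 t1] _] := tS'.
apply: (@le_trans _ _ (t ^+ p)).
  by rewrite -mulrA ler_piMr ?exprn_ge0// !indicE -natrM mulnb lern1 leq_b1.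
by rewrite indicE mem_set ?mulr1//= in_itv/= t0 leS.
Qed.

(* The fiber of K over y contains a translate of t times the fiber over y0
   whenever y lies in t y0 + (1 - t) P, with P the projection of K; integrating
   over t and y gives a beta integral. *)
Lemma rogers_shephard m p (K : set 'rV[R]_(m.+1 + p)) y0 :
  compact K -> is_convex K ->
  (mu p (fiber K y0) * mu m.+1 [set x *m fst_mx m.+1 p | x in K] <=
   'C(m.+1 + p, p)%:R%:E * mu (m.+1 + p) K)%E.
Proof.
move=> cK coK; set P := [set x *m _ | x in K].
have cP : compact P by exact: compact_image_mulmx.
(* For p = 0 the fibres are points or empty and K has the measure of its projection; the weight
   t^(p-1) of the general argument would make no sense. *)
case: p K y0 cK coK @P cP => [|p] K y0 cK coK P cP.
  rewrite bin0 mul1e (integral_fiber cK).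
  have f0 y : (mu 0 (fiber K y) = (\1_(fiber K y) 0)%:E)%E.
    rewrite measure_integral_indic; last exact: measurable_fiber.
    by rewrite integral_rV0//; apply: measurable_indicE; exact: measurable_fiber.
  apply: (@le_trans _ _ (mu m.+1 P)).
    rewrite f0 -[leRHS]mul1e lee_wpmul2r// lee_fin indicE lern1 leq_b1//.
  rewrite measure_integral_indic; last exact: compact_measurable_rV.
  rewrite le_eqVlt; apply/orP; left; apply/eqP; apply: eq_integral => y _.
  rewrite f0 !indicE; congr (nat_of_bool _)%:R%:E; apply/idP/idP; rewrite !inE.
    move=> [x Kx <-]; rewrite /fiber/= (_ : 0 = rsubmx x) -?fst_row_mx//.
    by apply/matrixP => i; case.
  by move=> Ky; exists (row_mx y 0) => //; rewrite row_mx_fst.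
have v0 := volume_ge0 (fiber K y0).
have mP := compact_measurable_rV cP.
(* The beta integral of t^p (1 - t)^(m+1), times p + 1, is the inverse of this binomial
   coefficient. *)
have bin : 'C(m.+1 + p.+1, p.+1)%:R * (p.+1%:R * ((p`! * m.+1`!)%:R / (p + m.+1).+1`!%:R)) = 1 :> R.
  have : 'C(m.+1 + p.+1, p.+1)%:R * (p.+1`!%:R * m.+1`!%:R) = (m.+1 + p.+1)`!%:R :> R.
    by rewrite -!natrM -(@bin_fact (m.+1 + p.+1) p.+1) ?leq_addl// addnK.
  rewrite (_ : (p + m.+1).+1 = m.+1 + p.+1)%N; last by rewrite addnS addnC addnS.
  move=> E; have hm : (m.+1 + p.+1)`!%:R != 0 :> R by rewrite pnatr_eq0 -lt0n fact_gt0.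
  rewrite mulrA mulrA -[X in _ / _ = X](divff hm); congr (_ / _).
  by rewrite -E factS !natrM; ring.
suff H : (mu p.+1 (fiber K y0) * mu m.+1 P * (p.+1%:R * ((p`! * m.+1`!)%:R / (p + m.+1).+1`!%:R))%:E <=
    mu (m.+1 + p.+1) K)%E.
  have C0 : (0 <= 'C(m.+1 + p.+1, p.+1)%:R%:E :> \bar R)%E by rewrite lee_fin.
  have := lee_wpmul2l C0 H.
  by rewrite muleC -muleA -EFinM [_ * 'C(_, _)%:R]mulrC bin mule1.
rewrite (integral_fiber cK).
pose G (t : measurableTypeR R) (y : 'rV[R]_m.+1) := (p.+1%:R * volume (fiber K y0) *
     (t ^+ p * \1_(`[0%R, 1%R]%classic : set (measurableTypeR R)) t *
      \1_(shrink P y0) (t, y)))%:E.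
have pv0 : 0 <= p.+1%:R * volume (fiber K y0) by rewrite mulr_ge0.
have mG : measurable_fun setT (fun q : measurableTypeR R * 'rV[R]_m.+1 => G q.1 q.2).
  apply/measurable_EFinP; apply: measurable_funM => //.
  apply: measurable_funM.
    have mk : measurable_fun setT (fun t : measurableTypeR R =>
        t ^+ p * \1_(`[0%R, 1%R]%classic : set (measurableTypeR R)) t : measurableTypeR R).
      by apply/measurable_EFinP; exact: measurable_kernel.
    exact: (measurableT_comp mk measurable_fst).
  rewrite (_ : (fun q => _) = \1_(shrink P y0)); last by apply/funext => -[].
  by apply: measurable_indic; exact: measurable_shrink.
have G0 t y : (0 <= G t y)%E.
  by rewrite lee_fin mulr_ge0// mulr_ge0 ?kernel_ge0 ?indicE.
apply: (@le_trans _ _ (\int[mu m.+1]_y \int[leb]_t G t y)%E); last first.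
  apply: ge0_le_integral => //.
  - by move=> y _; exact: integral_ge0.
  - exact: measurable_integral2.
  - exact: measurable_fiber_measure.
  - by move=> y _; exact: integral_power_fiber.
rewrite -(tonelli_swap leb (mu m.+1) mG G0).
have -> : (mu p.+1 (fiber K y0) * mu m.+1 P * (p.+1%:R * ((p`! * m.+1`!)%:R / (p + m.+1).+1`!%:R))%:E =
    \int[leb]_t ((p.+1%:R * volume (fiber K y0))%:E * mu m.+1 P *
     (t ^+ p * (1 - t) ^+ m.+1 * \1_(`[0%R, 1%R]%classic : set (measurableTypeR R)) t)%:E))%E.
  rewrite ge0_integralZl//.
  - rewrite integral_beta fiber_measureE// !EFinM.
    rewrite -!muleA [in RHS]muleCA; congr (_ * _)%E.
    by rewrite muleCA.
  - exact: measurable_beta_kernel.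
  - by move=> t _; rewrite lee_fin beta_kernel_ge0.
  - by rewrite mule_ge0 ?lee_fin.
apply: ge0_le_integral => //.
- by move=> t _; rewrite mule_ge0 ?mule_ge0 ?lee_fin ?beta_kernel_ge0.
- by apply: emeasurable_funM => //; exact: measurable_beta_kernel.
- exact: (measurable_integral1 (mu m.+1)).
move=> t _; have [t01|t01] := boolP (t \in `[0%R, 1%R]%classic); last first.
  by rewrite indicE (negbTE t01) mulr0 mule0 integral_ge0.
move: (t01); rewrite inE /= in_itv/= => /andP[t0 t1].
have mS : measurable [set y | shrink P y0 (t, y)].
  apply: (measurable_preimageT (f := fun y : 'rV[R]_m.+1 => (t : measurableTypeR R, y))).
    by apply: measurable_fun_pair => //; exact: (@measurable_cst _ _ _ _ setT t).
  exact: measurable_shrink.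
have -> : (\int[mu m.+1]_y G t y =
    (p.+1%:R * volume (fiber K y0) * t ^+ p)%:E * mu m.+1 [set y | shrink P y0 (t, y)])%E.
  rewrite measure_integral_indic// -ge0_integralZl//.
  - apply: eq_integral => y _; rewrite -EFinM /G [X in _ * (_ * X * _)]indicE t01 mulr1 mulrA.
    by congr (_ * _)%:E; rewrite !indicE; congr (nat_of_bool _)%:R; apply/idP/idP; rewrite !inE.
  - exact: measurable_indicE.
  - by rewrite lee_fin mulr_ge0 ?exprn_ge0.
rewrite indicE t01 mulr1 [X in (X <= _)%E]muleC muleA -EFinM.
have -> : t ^+ p * (1 - t) ^+ m.+1 * (p.+1%:R * volume (fiber K y0)) =
  (p.+1%:R * volume (fiber K y0) * t ^+ p) * (1 - t) ^+ m.+1 by ring.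
rewrite EFinM -muleA lee_wpmul2l ?lee_fin ?mulr_ge0 ?exprn_ge0//.
exact: measure_shrink.
Qed.

End rogers_shephard.

(** * Lower bound for a single projection *)

Section key.
Variable R : realType.

Definition ball_integral q m : \bar R := witer \1_(@eball R m) (@hull_volume R q m).

Lemma witer_weightZ q n (a : R) (g : 'rV[R]_n -> R) (F : 'M[R]_(q, n) -> \bar R) :
  0 <= a -> measurable_fun setT g -> (forall x, 0 <= g x) ->
  rows_measurable F -> (forall X, 0 <= F X)%E ->
  (witer (fun x => a * g x)%R F = (a ^+ q)%:E * witer g F)%E.
Proof.
move=> a0 mg g0 mF F0.
rewrite (@witer_map_rows R q n n g (fun x => a * g x) a id)//.
- congr (_ * _)%E; apply: eq_witer => X; congr F.
  by apply/row_matrixP => i; rewrite rowK.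
- by apply: measurable_funM.
- by move=> x; rewrite mulr_ge0.
- move=> f mf f0; rewrite -ge0_integralZl//.
  + by apply: eq_integral => x _; rewrite EFinM muleA.
  + by apply: emeasurable_funM => //; exact/measurable_EFinP.
  + by move=> x _; rewrite mule_ge0 ?lee_fin.
Qed.

Lemma measurable_indic_eball m : measurable_fun setT (\1_(@eball R m) : 'rV[R]_m -> R).
Proof. by apply: measurable_indic; exact: measurable_eball. Qed.

(** Scaling contributes rho^m for each of the q points and once more for the volume of the hull. *)
Lemma witer_ball q m (rho : R) : 0 < rho ->
  (witer \1_(@ball0 R m rho) (@hull_volume R q m) =
   ((rho ^+ m) ^+ q.+1)%:E * ball_integral q m)%E.
Proof.
move=> r0; pose S (x : 'rV[R]_m) := rho *: x.
have mS : measurable_fun setT S.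
  by apply: (measurable_scalemx (a := fun=> rho)) => //; exact: measurable_cst.
have mb : measurable_fun setT (\1_(@ball0 R m rho) : 'rV[R]_m -> R).
  by apply: measurable_indic; exact: measurable_ball0.
have rm0 : 0 <= rho ^+ m by rewrite exprn_ge0 ?ltW.
rewrite (@witer_map_rows R q m m \1_(@eball R m) \1_(@ball0 R m rho) (rho ^+ m) S)//.
- rewrite exprSr EFinM -muleA; congr (_ * _)%E.
  rewrite -witerZ//.
  + apply: eq_witer => X; rewrite -hull_volumeZ//; congr hull_volume.
    by apply/row_matrixP => i; rewrite rowK linearZ.
  + exact: measurable_indic_eball.
  + exact: rows_measurable_hull_volume.
- exact: measurable_indic_eball.
- move=> f mf f0; have rhoU : rho%:M \in @unitmx R m by rewrite unitmxE det_scalar unitfE expf_eq0 gt_eqF// andbF.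
  have mbf : measurable_fun setT (fun y => (\1_(@ball0 R m rho) y)%:E * f y)%E.
    by apply: emeasurable_funM => //; exact/measurable_EFinP.
  rewrite (det_scaling_unit rhoU mbf); last by move=> x; rewrite mule_ge0.
  rewrite det_scalar ger0_norm//; congr (_ * _)%E; apply: eq_integral => x _.
  rewrite mul_mx_scalar; congr (_%:E * _)%E; rewrite !indicE; congr (nat_of_bool _)%:R.
  have sE : (rho * enorm x <= rho) = (enorm x <= 1) by rewrite -[X in _ <= X]mulr1 ler_pM2l.
  by apply/idP/idP; rewrite !inE /ball0 /eball/= enormZ gtr0_norm// sE.
- exact: rows_measurable_hull_volume.
Qed.

Lemma eball_admissible m : admissible 1 (omega R m) \1_(@eball R m).
Proof.
split.
- exact: measurable_indic_eball.
- by move=> x; rewrite indicE ler0n lern1 leq_b1.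
- move=> x h; rewrite indicE memNset// /eball/= => xr.
  by move: h; rewrite ltNge xr.
- rewrite -measure_integral_indic; last exact: measurable_eball.
  by apply: compact_volume; exact: compact_eball.
Qed.

Lemma bounded_rows_hull_volume q m (r : R) : 0 <= r ->
  bounded_rows r (volume (@ball0 R m r)) (@hull_volume R q m).
Proof.
move=> r0 X Xr; rewrite -compact_volume; last exact: compact_eballr.
apply: hull_volume_le => //; first exact: compact_eballr.
  exact: convex_eballr.
by rewrite /ball0/= enorm0.
Qed.

Lemma ball_integralE q m : ball_integral q m = (fine (ball_integral q m))%:E.
Proof.
rewrite fineK// ge0_fin_numE.
  apply: le_lt_trans (ltry (volume (@ball0 R m 1) * omega R m ^+ q)).
  apply: (witer_bounded (eball_admissible m)); first exact: volume_ge0.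
  - exact: rows_measurable_hull_volume.
  - exact: hull_volume_ge0.
  - exact: bounded_rows_hull_volume.
apply: witer_ge0; last exact: hull_volume_ge0.
by move=> x; rewrite indicE.
Qed.

(** By Fubini, the image of the measure on K under the projection has the fibre volumes as
    density. *)
Lemma witer_fiber q m p (K : set 'rV[R]_(m + p)) (F : 'M[R]_(q, m) -> \bar R) :
  compact K -> rows_measurable F -> (forall X, 0 <= F X)%E ->
  witer \1_K (fun X => F (X *m fst_mx R m p)) = witer (fun y => volume (fiber K y)) F.
Proof.
move=> cK mF F0.
have mf : measurable_fun setT (fun y => volume (fiber K y)).
  by apply: (measurableT_comp (f := fine)) => //; exact: measurable_fiber_measure.
have mi : measurable_fun setT (\1_K : 'rV[R]_(m + p) -> R).
  by apply: measurable_indic; exact: compact_measurable_rV.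
have mS : measurable_fun setT (fun x : 'rV[R]_(m + p) => x *m fst_mx R m p).
  exact: (measurable_mulmx (f := id)).
rewrite [RHS](@witer_map_rows R q (m + p) m \1_K _ 1 (fun x => x *m fst_mx R m p))//.
- by rewrite expr1n mul1e; apply: eq_witer => X; rewrite map_rows_mulmx.
- by move=> y; exact: volume_ge0.
- move=> f mfx f0; rewrite mul1e.
  have mi' : measurable_fun setT (fun x => (\1_K x)%:E * f (x *m fst_mx R m p))%E.
    apply: emeasurable_funM; first exact/measurable_EFinP.
    exact: (measurableT_comp mfx mS).
  rewrite (integral_row_mx mi'); last by move=> x; rewrite mule_ge0.
  apply: eq_integral => y _; rewrite -fiber_measureE//.
  under [RHS]eq_integral do rewrite row_mx_fst.
  rewrite ge0_integralZr//.
  + congr (_ * _)%E; rewrite measure_integral_indic; last exact: measurable_fiber.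
    by apply: eq_integral => z _; rewrite !indicE; congr (nat_of_bool _)%:R%:E; apply/idP/idP; rewrite !inE.
  + apply: (measurableT_comp (f := fun x => (\1_K x)%:E)).
      exact/measurable_EFinP.
    by apply: measurable_row_mx => //; exact: (@measurable_cst _ _ _ _ setT y).
Qed.

Lemma exists_root (m : nat) (a : R) : 0 < a -> exists2 rho : R, 0 < rho & rho ^+ m.+1 = a.
Proof.
move=> a0; exists (a `^ (m.+1%:R^-1)); first exact: powR_gt0.
by rewrite -powR_mulrn ?powR_ge0// -powRrM mulVf ?pnatr_eq0// powRr1// ltW.
Qed.

Let C m p : R := 'C(m + p, p)%:R.

(** The integral for balls divided by omega_m^(q+1) is its value for the ball of volume 1; the
    binomial coefficient is the loss in Rogers-Shephard. *)
Definition key_const q m p : R :=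
  fine (ball_integral q m) / omega R m ^+ q.+1 / 'C(m + p, p)%:R.

Lemma key_const_ge0 q m p : 0 <= key_const q m p.
Proof.
rewrite !divr_ge0// ?exprn_ge0 ?volume_ge0// -lee_fin -ball_integralE.
apply: witer_ge0; last exact: hull_volume_ge0.
by move=> x; rewrite indicE.
Qed.

Lemma key_fst_pos q m p (K : set 'rV[R]_(m.+1 + p)) :
  compact K -> is_convex K -> 0 < volume K ->
  0 < volume [set x *m fst_mx R m.+1 p | x in K] ->
  ((key_const q m.+1 p * volume K ^+ q *
     volume [set x *m fst_mx R m.+1 p | x in K])%:E <=
   witer \1_K (fun X : 'M[R]_(q, m.+1 + p) => hull_volume (X *m fst_mx R m.+1 p)))%E.
Proof.
set P := [set x *m _ | x in K] => cK coK; set v := volume K; set w := volume P => v0 w0.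
have cP : compact P by exact: compact_image_mulmx.
pose f y := volume (fiber K y); set F := @hull_volume R q m.+1.
have mF : rows_measurable F by exact: rows_measurable_hull_volume.
have F0 X : (0 <= F X)%E by exact: hull_volume_ge0.
rewrite (witer_fiber cK mF F0).
have mf : measurable_fun setT f.
  by apply: (measurableT_comp (f := fine)) => //; exact: measurable_fiber_measure.
have f0 y : 0 <= f y by exact: volume_ge0.
have fv : (\int[mu m.+1]_y (f y)%:E = v%:E)%E.
  rewrite -compact_volume// (integral_fiber cK); apply: eq_integral => y _.
  by rewrite fiber_measureE.
have fP y : ~ P y -> f y = 0.
  move=> nP; rewrite /f /volume (_ : fiber K y = set0) ?measure0//.
  apply/seteqP; split => z //= Kz; apply: nP; exists (row_mx y z) => //.
  by rewrite row_mx_fst.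
have fle y : f y <= C m.+1 p * v / w.
  rewrite ler_pdivlMr// -lee_fin !EFinM -!compact_volume// -?fiber_measureE//.
    exact: rogers_shephard.
  exact: compact_fiber.
have hS : has_sup (range f).
  by split; [exists (f 0), 0|exists (C m.+1 p * v / w) => _ [y _ <-]].
(* Dividing by M gives a density bounded by 1 with mass v / M. The comparison ball has this volume,
   which fixes [rho]. *)
pose M := sup (range f).
have fM y : f y <= M by apply: ub_le_sup; [case: hS|exists y].
have MC : M <= C m.+1 p * v / w by apply: ge_sup; [exists (f 0), 0|move=> _ [y _ <-]].
have M0 : 0 < M.
  rewrite lt_neqAle (le_trans (f0 0) (fM 0)) andbT; apply/eqP => M0.
  have : (v%:E = 0 :> \bar R)%E.
    rewrite -fv integral0_eq// => y _; congr EFin; apply/eqP.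
    by rewrite eq_le f0 andbT M0.
  by case=> E; rewrite E ltxx in v0.
have om0 := omega_gt0 R m.+1.
have [rho rho0 rhoE] := exists_root m (divr_gt0 v0 (mulr_gt0 M0 om0)).
have [s s0 Ps] : exists2 s, 0 <= s & P `<=` @ball0 R m.+1 s.
  have [s s0 Ps] := bounded_sub_cube (compact_bounded_rV cP).
  exists (\sum_(i < m.+1) s); first by apply: sumr_ge0.
  move=> y /Ps yc; apply: (le_trans (enorm_le_sum _)).
  by apply: ler_sum => i _; exact: yc.
pose r := Num.max s rho.
have r0 : 0 < r by rewrite lt_max rho0 orbT.
have rho_r : rho <= r by rewrite le_max lexx orbT.
pose g y := M^-1 * f y.
have ag : admissible r (v / M) g.
  split.
  - exact: measurable_funM.
  - by move=> y; rewrite /g mulr_ge0 ?invr_ge0 ?(ltW M0)//= mulrC ler_pdivrMr// mul1r.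
  - move=> y ry; rewrite /g fP ?mulr0// => /Ps; rewrite /ball0/= leNgt => /negP; apply.
    by rewrite (le_lt_trans _ ry)// le_max lexx.
  - under eq_integral do rewrite /g EFinM.
    rewrite ge0_integralZl ?lee_fin ?invr_ge0 ?ltW//.
    + by rewrite fv -EFinM mulrC.
    + exact/measurable_EFinP.
    + by move=> y _; rewrite lee_fin.
have vr : (mu m.+1 (@ball0 R m.+1 rho) = (v / M)%:E)%E.
  rewrite compact_volume; last exact: compact_eballr.
  rewrite /ball0 volume_eballr// rhoE; congr EFin.
  by field; rewrite !gt_eqF.
have := rearrangement mF F0 (@hull_volume_e0_convex R q m)
  (fun Q X oQ => hull_volume_orthogonal X oQ) r0 rho_r vr (volume_ge0 _)
  (bounded_rows_hull_volume (ltW r0)) ag.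
rewrite witer_ball// ball_integralE => H.
have -> : witer f F = ((M ^+ q)%:E * witer g F)%E.
  rewrite -(witer_weightZ (ltW M0))//.
  - by congr witer; apply/funext => y; rewrite /g mulVKf// gt_eqF.
  - exact: measurable_funM.
  - by move=> y; rewrite /g mulr_ge0 ?invr_ge0 ?(ltW M0).
have Mq0 : (0 <= (M ^+ q)%:E :> \bar R)%E by rewrite lee_fin exprn_ge0 ?ltW.
apply: le_trans (lee_wpmul2l Mq0 H).
rewrite -!EFinM lee_fin rhoE /key_const.
set phi := fine _; have phi0 : 0 <= phi.
  rewrite -lee_fin -ball_integralE; apply: witer_ge0; last exact: hull_volume_ge0.
  by move=> x; rewrite indicE.
(* All powers of M cancel but one, in the denominator, so the upper bound [MC] on M is what yields
   the claim. *)
have -> : M ^+ q * ((v / (M * omega R m.+1)) ^+ q.+1 * phi) =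
    phi / omega R m.+1 ^+ q.+1 * v ^+ q * (v / M).
  rewrite expr_div_n exprMn !exprS; field.
  by rewrite !expf_neq0 ?gt_eqF.
have C0 : 0 < C m.+1 p by rewrite ltr0n bin_gt0 leq_addl.
have -> : phi / omega R m.+1 ^+ q.+1 / 'C(m.+1 + p, p)%:R * v ^+ q * w =
    phi / omega R m.+1 ^+ q.+1 * v ^+ q * (w / C m.+1 p).
  by rewrite /C; ring.
apply: ler_wpM2l; first by apply: mulr_ge0; rewrite ?divr_ge0 ?exprn_ge0 ?(ltW om0) ?(ltW v0).
rewrite ler_pdivrMr// mulrC mulrA ler_pdivlMr// mulrC.
by rewrite [w * M]mulrC [v * _]mulrC -ler_pdivlMr.
Qed.

Lemma key_fst q m p (K : set 'rV[R]_(m.+1 + p)) :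
  compact K -> is_convex K -> (0 < q)%N ->
  ((key_const q m.+1 p * volume K ^+ q *
     volume [set x *m fst_mx R m.+1 p | x in K])%:E <=
   witer \1_K (fun X : 'M[R]_(q, m.+1 + p) => hull_volume (X *m fst_mx R m.+1 p)))%E.
Proof.
move=> cK coK q0.
have W0 : (0 <= witer \1_K (fun X : 'M[R]_(q, m.+1 + p) => hull_volume (X *m fst_mx R m.+1 p)))%E.
  by apply: witer_ge0 => [x|X]; [rewrite indicE|exact: hull_volume_ge0].
have := volume_ge0 K; rewrite le_eqVlt => /predU1P[<-|v0].
  by rewrite expr0n gtn_eqF// mulr0 mul0r.
have := volume_ge0 [set x *m fst_mx R m.+1 p | x in K]; rewrite le_eqVlt => /predU1P[<-|w0].
  by rewrite mulr0.
exact: key_fst_pos.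
Qed.

Lemma volume_hyperplane n (A : set 'rV[R]_n.+1) (u : 'rV[R]_n.+1) : compact A ->
  u != 0 -> (forall x, A x -> dot x u = 0) -> volume A = 0.
Proof.
move=> cA u0 Au; have [Q [oQ uQ]] := householder u.
have mA := compact_measurable_rV cA.
rewrite /volume -(volume_orthogonal oQ mA).
set B := [set x *m Q | x in A].
have mB : measurable B by apply: compact_measurable_rV; exact: compact_image_mulmx.
rewrite (measure_rV_cons_swap mB) integral0_eq// => v _.
apply/eqP; rewrite eq_le measure_ge0 andbT.
apply: (@le_trans _ _ (leb [set 0 : R])); last by rewrite lebesgue_measure_set1.
apply: le_measure; rewrite ?inE.
- apply: (measurable_preimageT (f := fun t : measurableTypeR R => rV_cons (t, v))) mB.
  by apply: measurable_rV_cons_fun => //; exact: (@measurable_cst _ _ _ _ setT v).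
- exact: measurable_set1.
move=> t [x Ax xt] /=; have := Au x Ax.
rewrite -(orthogonal_dot x u oQ) xt uQ dotZr dotC dot_delta rV_cons0 => /eqP.
by rewrite mulf_eq0 enorm_eq0 (negbTE u0) => /eqP.
Qed.

(** From the factorization of G through [col_ebase], [pid_mx] and [row_ebase], the last factor being
    moved across the projection as a diagonal block. *)
Lemma full_rank_factor m p (G : 'M[R]_(m + p, m)) : \rank G = m ->
  exists2 T : 'M[R]_(m + p), T \in unitmx & G = T *m fst_mx R m p.
Proof.
move=> rG; exists (col_ebase G *m block_mx (row_ebase G) 0 0 1%:M).
  rewrite unitmx_mul col_ebase_unit/= unitmxE det_ublock det1 mulr1.
  by rewrite -unitmxE row_ebase_unit.
rewrite -[LHS]mulmx_ebase rG -!mulmxA; congr (_ *m _).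
rewrite /fst_mx pid_mx_col mul_block_col mul_col_mx !mulmx1 !mul1mx !mul0mx ?mulmx0.
by rewrite ?addr0 ?add0r.
Qed.

(** For G of full rank, replacing K by its image under [T] multiplies both sides by the same power
    of |det T|, which reduces to the coordinate projection. For smaller rank the image of K lies in
    a hyperplane and the left side is 0. *)
Lemma key_gen q m p (G : 'M[R]_(m.+1 + p, m.+1)) (K : set 'rV[R]_(m.+1 + p)) :
  compact K -> is_convex K -> (0 < q)%N ->
  ((key_const q m.+1 p * volume K ^+ q * volume [set x *m G | x in K])%:E <=
   witer \1_K (fun X : 'M[R]_(q, m.+1 + p) => hull_volume (X *m G)))%E.
Proof.
move=> cK coK q0.
have W0 : (0 <= witer \1_K (fun X : 'M[R]_(q, m.+1 + p) => hull_volume (X *m G)))%E.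
  by apply: witer_ge0 => [x|X]; [rewrite indicE|exact: hull_volume_ge0].
have [rG|rG] := eqVneq (\rank G) m.+1; last first.
  rewrite (_ : volume [set x *m G | x in K] = 0) ?mulr0//.
  have : kermx G^T != 0 by rewrite kermx_eq0 /row_free mxrank_tr.
  case/rowV0Pn => u /sub_kermxP uG u0.
  apply: (@volume_hyperplane m _ u); [exact: compact_image_mulmx|exact: u0|].
  move=> _ [x Kx <-].
  have : (x *m G) *m u^T = 0 by rewrite -mulmxA -(trmxK G) -trmx_mul uG trmx0 mulmx0.
  by rewrite dotE => /matrixP/(_ ord0 ord0); rewrite !mxE eqxx mulr1n.
have [T uT GT] := full_rank_factor rG.
set K' := [set x *m T | x in K].
have cK' : compact K' by exact: compact_image_mulmx.
have coK' : is_convex K' by exact: convex_image_mulmx.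
have mK := compact_measurable_rV cK; have mK' := compact_measurable_rV cK'.
have dT : 0 < `|\det T| by rewrite normr_gt0 -unitfE -unitmxE.
pose c := `|\det T|^-1.
have c0 : 0 <= c by rewrite invr_ge0 ltW.
have KK' x : K (x *m invmx T) <-> K' x.
  split=> [h|[y Ky <-]]; last by rewrite mulmxK.
  by exists (x *m invmx T) => //; rewrite mulmxKV.
have uTi : invmx T \in unitmx by rewrite unitmx_inv.
have dTi : `|\det (invmx T)| = c by rewrite det_inv normrV// -unitmxE.
have vK : volume K = c * volume K'.
  apply: EFin_inj; rewrite EFinM -!compact_volume//.
  rewrite (measure_preimage_linear uTi mK) dTi; congr (_ * mu _ _)%E.
  by apply/seteqP; split => x /KK'.
have mT := measurable_fun_mulmx (invmx T).
have mF (H : 'M[R]_(m.+1 + p, m.+1)) :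
    rows_measurable (fun X : 'M[R]_(q, m.+1 + p) => hull_volume (X *m H)).
  have mS : measurable_fun setT (fun x : 'rV[R]_(m.+1 + p) => x *m H).
    exact: (measurable_mulmx (f := id)).
  have := rows_measurable_map_rows mS (@rows_measurable_hull_volume R q m.+1).
  by under eq_fun do rewrite map_rows_mulmx.
have mi (A : set 'rV[R]_(m.+1 + p)) : measurable A ->
    measurable_fun setT (\1_A : 'rV[R]_(m.+1 + p) -> R) by move=> mA; exact: measurable_indic.
rewrite (@witer_map_rows R q _ _ \1_K' \1_K c (fun x => x *m invmx T))//; first last.
- move=> f mf' f0; have mKf : measurable_fun setT (fun y => (\1_K y)%:E * f y)%E.
    by apply: emeasurable_funM => //; apply/measurable_EFinP; exact: mi.
  rewrite (det_scaling_unit uTi mKf); last by move=> x; rewrite mule_ge0.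
  rewrite dTi; congr (_ * _)%E; apply: eq_integral => x _.
  congr (_%:E * _)%E; rewrite !indicE; congr (nat_of_bool _)%:R.
  by apply/idP/idP; rewrite !inE => /KK'.
rewrite (eq_witer _ (G := fun X : 'M[R]_(q, m.+1 + p) => hull_volume (X *m fst_mx R m.+1 p))); last first.
  by move=> X; rewrite map_rows_mulmx GT mulmxA mulmxKV.
have H := key_fst cK' coK' q0.
have cq0 : (0 <= (c ^+ q)%:E :> \bar R)%E by rewrite lee_fin exprn_ge0.
apply: le_trans (lee_wpmul2l cq0 H).
rewrite image_mulmx_comp -GT -EFinM lee_fin vK exprMn.
by rewrite le_eqVlt; apply/orP; left; apply/eqP; ring.
Qed.

End key.

(** * Passage to quermassintegrals *)

Section assembly.
Variable R : realType.

Lemma key n q m p (G : 'M[R]_(n, m)) (K : set 'rV[R]_n) : n = (m + p)%N -> (0 < m)%N ->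
  compact K -> is_convex K -> (0 < q)%N ->
  ((key_const R q m p * volume K ^+ q * volume [set x *m G | x in K])%:E <=
   witer \1_K (fun X : 'M[R]_(q, n) => hull_volume (X *m G)))%E.
Proof. by move=> E; subst n; case: m G K => // m G K _; exact: key_gen. Qed.

Lemma hull0_body q n (X : 'M[R]_(q, n)) :
  [/\ compact (hull0 X), is_convex (hull0 X) & hull0 X 0].
Proof. by split; [exact: compact_hull0|exact: convex_hull0|exact: hull0_0]. Qed.

Lemma rows_measurable_hull_volume_mulmx q n m (G : 'M[R]_(n, m)) :
  rows_measurable (fun X : 'M[R]_(q, n) => hull_volume (X *m G)).
Proof.
have mS : measurable_fun setT (fun x : 'rV[R]_n => x *m G).
  exact: (measurable_mulmx (f := id)).
have := rows_measurable_map_rows mS (@rows_measurable_hull_volume R q m).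
by under eq_fun do rewrite map_rows_mulmx.
Qed.

Lemma segment_coef_hull0 n q (Gs : forall m, seq (R * 'M[R]_(n, m))) (k : 'I_n.+1)
    (X : 'M[R]_(q, n)) :
  ((segment_coef Gs (hull0 X) k)%:E =
   \sum_(p <- Gs (n - k)%N) p.1%:E * hull_volume (X *m p.2))%E.
Proof.
rewrite /segment_coef -sumEFin; apply: eq_bigr => p _.
rewrite EFinM hull0_mulmx -compact_volume//; exact: compact_hull0.
Qed.

Lemma rows_measurable_segment_coef n q (Gs : forall m, seq (R * 'M[R]_(n, m))) k :
  rows_measurable (fun X : 'M[R]_(q, n) => (segment_coef Gs (hull0 X) k)%:E).
Proof.
move=> d T r mr; under eq_fun do rewrite segment_coef_hull0.
apply: emeasurable_sum => p; apply: emeasurable_funM => //.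
exact: rows_measurable_hull_volume_mulmx.
Qed.

(** A pointwise limit of finite combinations of hull volumes with accuracy 1/(i+1); the matrices
    chosen for i do not depend on the points. *)
Lemma rows_measurable_steiner_coef n q (k : 'I_n.+1) :
  rows_measurable (fun X : 'M[R]_(q, n) => (steiner_coef (hull0 X) k)%:E).
Proof.
have ip (i : nat) : 0 < i.+1%:R^-1 :> R by rewrite invr_gt0.
have [Gs HGs] := choice (fun i => steiner_coef_approx n (ip i)).
move=> d T r mr; apply/measurable_EFinP.
apply: (measurable_fun_cvg (h := fun i t => segment_coef (Gs i) (hull0 (r t)) k)).
  by move=> i; apply/measurable_EFinP; exact: rows_measurable_segment_coef.
move=> t _; apply/cvgrPdist_le => e e0.
near=> i; rewrite distrC.
have [_ H] := HGs i.
have [c1 c2 c3] := hull0_body (r t); have [/(_ k) Hi _] := H _ c1 c2 c3.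
apply: (le_trans Hi); rewrite mulrC ler_pdivrMr// mulrC -ler_pdivrMr//.
apply: (@le_trans _ _ i%:R); last by rewrite ler_nat.
by near: i; exact: nbhs_infty_ger.
Unshelve. all: by end_near. Qed.

Lemma witer_sum n q (g : 'rV[R]_n -> R) (I : Type) (s : seq I)
    (F : I -> 'M[R]_(q, n) -> \bar R) :
  measurable_fun setT g -> (forall x, 0 <= g x) ->
  (forall i, rows_measurable (F i)) -> (forall i X, 0 <= F i X)%E ->
  (witer g (fun X => \sum_(i <- s) F i X) = \sum_(i <- s) witer g (F i))%E.
Proof.
move=> mg g0 mF F0; elim: s => [|i s IH].
  have m0 : rows_measurable (fun _ : 'M[R]_(q, n) => 0%E : \bar R).
    by move=> d T r mr; exact: measurable_cst.
  have E := witerZ mg g0 (lexx 0) m0 (fun=> lexx _).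
  rewrite big_nil; transitivity (witer g (fun _ : 'M[R]_(q, n) => 0%:E * 0 : \bar R)%E).
    by apply: eq_witer => X; rewrite big_nil mul0e.
  by rewrite E mul0e.
rewrite big_cons -IH -witerD//.
- by apply: eq_witer => X; rewrite big_cons.
- by move=> d T r mr; apply: emeasurable_sum => j; exact: mF.
- by move=> X; apply: sume_ge0 => j _; exact: F0.
Qed.

Lemma witer_cst n q (g : 'rV[R]_n -> R) (c v : R) : 0 <= c -> 
  measurable_fun setT g -> (forall x, 0 <= g x) -> (\int[mu n]_x (g x)%:E = v%:E)%E ->
  witer g (fun _ : 'M[R]_(q, n) => c%:E) = (c * v ^+ q)%:E.
Proof.
move=> c0 mg g0 gv.
have v0 : 0 <= v by rewrite -lee_fin -gv integral_ge0// => x _; rewrite lee_fin.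
elim: q => [|q IH] /=; first by rewrite mulr1.
under eq_integral do rewrite IH.
rewrite ge0_integralZr//.
- by rewrite gv -EFinM exprS; congr EFin; ring.
- exact/measurable_EFinP.
- by move=> x _; rewrite lee_fin.
- by rewrite lee_fin mulr_ge0 ?exprn_ge0.
Qed.

Lemma integral_indic_volume n (K : set 'rV[R]_n) : compact K ->
  (\int[mu n]_x (\1_K x : R)%:E = (volume K)%:E)%E.
Proof.
move=> cK; rewrite -compact_volume//; apply/esym/measure_integral_indic.
exact: compact_measurable_rV.
Qed.

Section body.
Variables (n q : nat) (K : set 'rV[R]_n) (k : 'I_n.+1).
Hypotheses (cK : compact K) (coK : is_convex K) (K0 : K 0) (q0 : (0 < q)%N) (kn : (k < n)%N).

Let mi : measurable_fun setT (\1_K : 'rV[R]_n -> R).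
Proof. by apply: measurable_indic; exact: compact_measurable_rV. Qed.

Let i0 x : 0 <= \1_K x :> R. Proof. by rewrite indicE. Qed.

Let inK (X : 'M[R]_(q, n)) : (forall i, 0 < \1_K (row i X) :> R) -> hull0 X `<=` K.
Proof.
move=> h; apply: hull0_sub => // i; have := h i.
by rewrite indicE ltr0n lt0b inE.
Qed.

Let sc0 (X : 'M[R]_(q, n)) : (0 <= (steiner_coef (hull0 X) k)%:E)%E.
Proof.
by rewrite lee_fin steiner_coef_ge0//; [exact: compact_hull0|exact: convex_hull0|exact: hull0_0].
Qed.

Lemma witer_steiner_coef_le :
  (witer \1_K (fun X : 'M[R]_(q, n) => (steiner_coef (hull0 X) k)%:E) <=
   (volume K ^+ q * steiner_coef K k)%:E)%E.
Proof.
have sK0 := steiner_coef_ge0 k cK coK K0.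
rewrite mulrC -(witer_cst q sK0 mi i0 (integral_indic_volume cK)).
apply: le_witer => //.
- exact: rows_measurable_steiner_coef.
- by move=> X /inK XK; rewrite lee_fin le_steiner_coef//;
    [exact: compact_hull0|exact: convex_hull0|exact: hull0_0].
Qed.

Lemma le_witer_steiner_coef :
  ((key_const R q (n - k) k * volume K ^+ q * steiner_coef K k)%:E <=
   witer \1_K (fun X : 'M[R]_(q, n) => (steiner_coef (hull0 X) k)%:E))%E.
Proof.
set J := witer _ _.
have msc := @rows_measurable_steiner_coef n q k.
have J0 : (0 <= J)%E by apply: witer_ge0.
(* Finiteness comes from the upper bound. *)
have JE : J = (fine J)%:E.
  by rewrite fineK// ge0_fin_numE// (le_lt_trans witer_steiner_coef_le)// ltry.
rewrite JE lee_fin; set c := key_const _ _ _ _.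
have c0 : 0 <= c by exact: key_const_ge0.
set V := volume K ^+ q; have V0 : 0 <= V by rewrite exprn_ge0 ?volume_ge0.
pose B := steiner_bound K k.
(* Approximating the coefficients of the hulls under the integral costs h V B, and approximating
   that of K on the left costs h c V B. *)
apply: (@ler_all_eps _ _ _ (V * B + c * V * B)) => h h0.
have [Gs [Gs0 HGs]] := steiner_coef_approx n h0.
have B0 : 0 <= B.
  by apply: sumr_ge0 => i _; rewrite mulr_ge0 ?volume_ge0.
have [/(_ k) HK _] := HGs K cK coK K0.
have mseg := @rows_measurable_segment_coef n q Gs k.
have lower : ((c * V * segment_coef Gs K k)%:E <=
    witer \1_K (fun X : 'M[R]_(q, n) => (segment_coef Gs (hull0 X) k)%:E))%E.
  (* The modulus changes nothing on the members of [Gs], but makes the weight nonnegative for every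
     p, as [witer_sum] demands. *)
  have E (X : 'M[R]_(q, n)) : ((segment_coef Gs (hull0 X) k)%:E =
      \sum_(p <- Gs (n - k)%N) `|p.1|%:E * hull_volume (X *m p.2))%E.
    rewrite segment_coef_hull0; apply: eq_big_seq => p pG.
    by rewrite ger0_norm// (Gs0 _ _ pG).
  rewrite (eq_witer _ E) (@witer_sum _ _ _ _ _ (fun p X => `|p.1|%:E * hull_volume (X *m p.2))%E)//; last 2 first.
  - move=> p d T r mr; apply: emeasurable_funM => //.
    exact: rows_measurable_hull_volume_mulmx.
  - by move=> p X; rewrite mule_ge0 ?lee_fin// hull_volume_ge0.
  rewrite /segment_coef mulr_sumr -sumEFin big_seq [leRHS]big_seq; apply: lee_sum => p pG.
  rewrite (witerZ mi i0 (normr_ge0 _) (@rows_measurable_hull_volume_mulmx q _ _ p.2)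
    (fun X => hull_volume_ge0 _)).
  rewrite ger0_norm ?(Gs0 _ _ pG)// mulrCA EFinM lee_wpmul2l ?lee_fin ?(Gs0 _ _ pG)//.
  apply: key => //; first by rewrite subnK// ltnW.
  by rewrite subn_gt0.
have upper : (witer \1_K (fun X : 'M[R]_(q, n) => (segment_coef Gs (hull0 X) k)%:E) <=
    (fine J + h * B * V)%:E)%E.
  rewrite EFinD -JE; have hB0 : 0 <= h * B by rewrite mulr_ge0// ltW.
  rewrite -(witer_cst q hB0 mi i0 (integral_indic_volume cK)) -witerD//.
  apply: le_witer => //.
  - by move=> d T r mr; apply: emeasurable_funD => //; exact: msc.
  - move=> X; rewrite lee_fin /segment_coef big_seq; apply: sumr_ge0 => p pG.
    by rewrite mulr_ge0 ?volume_ge0 ?(Gs0 _ _ pG).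
  - move=> X /inK XK; rewrite -EFinD lee_fin.
    have [c1 c2 c3] := hull0_body X; have [/(_ k) HX _] := HGs _ c1 c2 c3.
    (* Monotonicity of the bound makes the error uniform over all hulls contained in K. *)
    have bX := le_steiner_bound k c1 cK XK.
    move: HX; rewrite ler_distl => /andP[_ HX]; apply: (le_trans HX).
    by rewrite lerD2l ler_wpM2l// ltW.
  - by move=> X; rewrite adde_ge0// lee_fin.
have := le_trans lower upper; rewrite lee_fin.
move: HK; rewrite ler_distl => /andP[HK _] H.
have : c * V * (steiner_coef K k - h * B) <= c * V * segment_coef Gs K k.
  apply: ler_wpM2l; first exact: mulr_ge0.
  exact: HK.
move: H; lra.
Qed.

End body.

End assembly.

(* Over the integers, 0 <= j <= n - k - 1 <= n - 1 says that k and j are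
   natural numbers with k + j < n. *)
Theorem theorem4p3 (R : realType) (n k j : nat) (hkj : (k + j < n)%N)
    (K : set 'rV[R]_n) (hK : convex_body K) (hsym : centrally_symmetric K) :
  let I := iter_integral K
    (fun X : 'M[R]_(n - k, n) => (quermassintegral (n - k) (hull0 X) j)%:E) in
  (c_const R n k j * (volume K ^+ (n - k) * quermassintegral n K (k + j))%:E
     <= I)%E /\
  (I <= (delta_const R n k j * volume K ^+ (n - k)
           * quermassintegral n K (k + j))%:E)%E.
Proof.
move=> I.
have [cK coK [x Kx]] := hK.
(* By central symmetry 0 is the midpoint of two points of K; hence the hulls of 0 and points of K
   stay in K. *)
have {Kx} K0 : K 0.
  have {}Kx := interior_subset Kx; have /is_convexP coK' := coK.
  have := coK' _ _ 2^-1 Kx (hsym _ Kx).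
  have -> : 1 - 2^-1 = 2^-1 :> R by field.
  rewrite scalerN subrr; apply; first by rewrite invr_ge0.
  by rewrite invf_le1 ?ler1n.
have kn : (k <= n)%N by rewrite (leq_trans _ (ltnW hkj))// leq_addr.
have nE : n = (n - k + k)%N by rewrite subnK.
have jN : (j <= n - k)%N by rewrite leq_subRL// ltnW.
have q0 : (0 < n - k)%N by rewrite subn_gt0 (leq_ltn_trans _ hkj)// leq_addr.
pose i : 'I_n.+1 := inord (k + j).
have iE : i = (k + j)%N :> nat by rewrite inordK// ltnS ltnW.
have i_n : (i < n)%N by rewrite iE.
set V := volume K ^+ (n - k).
(* The factor in [quermassintegral_hull0], common to all hulls. *)
pose a : R := omega R j / omega R (k + j) / 'C(n - k, j)%:R.
have a0 : 0 <= a by rewrite !divr_ge0 ?volume_ge0.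
have WE : quermassintegral n K (k + j) = steiner_coef K i / 'C(n, k + j)%:R.
  by apply: quermassintegral_full => //; [rewrite addn0|exact: ltnW].
pose J := witer \1_K (fun X : 'M[R]_(n - k, n) => (steiner_coef (hull0 X) i)%:E).
have IE : I = (a%:E * J)%E.
  rewrite /I iter_integral_witer /J -witerZ//.
  - apply: eq_witer => X; rewrite (quermassintegral_hull0 X nE jN) -EFinM addnC.
    by congr EFin; rewrite /a; ring.
  - by apply: measurable_indic; exact: compact_measurable_rV.
  - exact: rows_measurable_steiner_coef.
  - move=> X; rewrite lee_fin; have [c1 c2 c3] := hull0_body X.
    exact: steiner_coef_ge0.
have bin0 : 'C(n, k + j)%:R != 0 :> R by rewrite pnatr_eq0 -lt0n bin_gt0 ltnW.
have a0E : (0 <= a%:E :> \bar R)%E by rewrite lee_fin.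
have U := @witer_steiner_coef_le R n (n - k) K i cK coK K0.
have L := @le_witer_steiner_coef R n (n - k) K i cK coK K0 q0 i_n.
rewrite IE WE; split; last first.
  apply: (le_trans (lee_wpmul2l a0E U)).
  rewrite -EFinM lee_fin le_eqVlt; apply/orP; left; apply/eqP.
  (* The binomial coefficient C(n, k + j) of [delta_const] undoes the denominator in [WE]. *)
  by rewrite /a /delta_const -/V; field; rewrite bin0 !gt_eqF ?omega_gt0// ltr0n bin_gt0.
apply: (le_trans _ (lee_wpmul2l a0E L)).
rewrite le_eqVlt; apply/orP; left; apply/eqP.
(* With n - i = n - k - j, [calF] of the simplex is the ball integral over omega^(n-k); the further
   omega in the denominator of [c_const] accounts for the exponent q + 1 in [key_const]. *)
have -> : c_const R n k j = (omega R j / (omega R (k + j) * omega R (n - i)) *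
    ('C(n - k, j)%:R)^-1 * ((omega R (n - i) ^+ (n - k))^-1 * fine (ball_integral R (n - k) (n - i))))%:E.
  rewrite /c_const /calF iE subnDA [RHS]EFinM; congr (_ * _)%E.
  rewrite [RHS]EFinM; congr (_ * _)%E.
  rewrite -ball_integralE iter_integral_witer; apply: eq_witer => X.
  by rewrite bracket_simplex.
rewrite -!EFinM /key_const -/V; congr EFin.
have -> : (n - i + i = n)%N by rewrite subnK// ltnW.
rewrite exprS /a iE.
have w0 := omega_gt0 R (n - (k + j)); have w1 := omega_gt0 R (k + j).
have w2 : 0 < omega R (n - (k + j)) ^+ (n - k) by rewrite exprn_gt0.
have b0 : 'C(n - k, j)%:R != 0 :> R by rewrite pnatr_eq0 -lt0n bin_gt0.
move: w0 w2; move: (omega R (n - (k + j))) => w w0; move: (w ^+ (n - k)) => wn wn0.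
by field; rewrite bin0 b0 !gt_eqF.
Qed.
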